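(* Let $0<\beta<\infty$, $1\le q\le\infty$, $r=r_n\ge0$, and let the kernel $K$ satisfy Assumption 1. Let $\hat f_{\mathrm{PP}}$ be the PP estimator $\mathrm{PP}(M,\ell,h,\tau)$ with an integer $\ell\ge\lfloor\beta\rfloor$, bandwidth $$h\asymp\begin{cases} r\vee n^{-\frac1{2\beta+d}}, & 1\le q<\infty,\\ r\vee\left(\frac{n}{\log n}\right)^{-\frac1{2\beta+d}}, & q=\infty,\end{cases}$$ integer $M=M_n\asymp 1/h$, and regularization parameter $\tau=\tau_n$ with $\tau\to0$ and $n^\gamma\tau\to\infty$ for some fixed $\gamma>0$. Then $$\sup_{\mathbb P_{(X,Y)}\in\mathcal P(\beta)}\ \sup_{A\in\mathcal T'(r)}R_{A,q}(\hat f_{\mathrm{PP}},f)\lesssim\begin{cases} r^{q(1\wedge\beta)}+n^{-\frac{q\beta}{2\beta+d}}, & 1\le q<\infty,\\ r^{1\wedge\beta}+\left(\frac{n}{\log n}\right)^{-\frac{\beta}{2\beta+d}}, & q=\infty,\end{cases}$$ where $\lesssim$ hides a constant independent of $n$.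
   Context: Data: $(X,Y)$ is a random pair in $\mathbb R^d\times\mathbb R$ and $Z_n=\{(X_i,Y_i)\}_{i=1}^n$ are i.i.d. copies of $(X,Y)$, independent of $(X,Y)$; $\Omega=\operatorname{supp}(\mathbb P_X)$, $f(x)=\mathbb E(Y\mid X=x)$, $\xi=Y-f(X)$. $\lfloor\beta\rfloor$ is the largest integer strictly less than $\beta$; $\|\cdot\|$ is the Euclidean norm; $B(u,h)$ the closed Euclidean ball. Hölder class $\mathcal F(\beta,C_\beta)$: all $f:[0,1]^d\to\mathbb R$ with continuous partial derivatives of order $\lfloor\beta\rfloor$ such that $\max_{0\le|s|\le\lfloor\beta\rfloor}\sup_{x}|D^sf(x)|+\max_{|s|=\lfloor\beta\rfloor}\sup_{x\neq z}\frac{|D^sf(x)-D^sf(z)|}{\|x-z\|^{\beta-\lfloor\beta\rfloor}}\le C_\beta$. Class $\mathcal P(\beta)=\mathcal P(\beta,C_\beta,\mu_{\min},\mu_{\max},\sigma)$ (fixed constants): laws of $(X,Y)$ with $f\in\mathcal F(\beta,C_\beta)$; $\mathbb P_X$ supported on $\Omega=[0,1]^d$ with Lebesgue density $\mu$, $\mu_{\min}<\mu<\mu_{\max}$ on $[0,1]^d$; $\mathbb E[e^{t\xi}\mid X=x]\le e^{t^2\sigma^2/2}$ for all $t,x$. $\mathcal T'(r)$: all maps $A$ assigning to each $x\in\Omega$ a measurable set $A(x)$ with $x\in A(x)\subseteq\Omega$ and $\sup_{x\in\Omega,x'\in A(x)}\|x'-x\|\le r$. Adversarial risk: $R_{A,q}(\hat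 f,f)=\mathbb E\sup_{X'\in A(X)}|\hat f(X')-f(X)|^q$ for $1\le q<\infty$ and $R_{A,\infty}(\hat f,f)=\mathbb E_{Z_n}\sup_{x\in\Omega}\sup_{x'\in A(x)}|\hat f(x')-f(x)|$. Assumption 1 (kernel): $K:\mathbb R^d\to[0,\infty)$ and there are constants $0<K_{\min}<K_{\max}<\infty$, $0<\Delta<1$ with $K_{\min}1_{\{\|u\|\le\Delta\}}\le K(u)\le K_{\max}1_{\{\|u\|\le1\}}$ for all $u$. Regularized local polynomial estimator $\mathrm{LP}(\ell,h,\tau)$: let $N_{\ell,d}=\mathrm{Card}\{s\in\mathbb N^d:|s|\le\ell\}$ and $U(x)=(x^s/s!)_{0\le|s|\le\ell}\in\mathbb R^{N_{\ell,d}}$ (ordered by increasing $|s|$). For $u\in\mathbb R^d$, $h>0$ set $B_{uh}=\frac1{nh^d}\sum_{i=1}^nU(\tfrac{X_i-u}h)U^\top(\tfrac{X_i-u}h)K(\tfrac{X_i-u}h)$, $a_{uh}=\frac1{nh^d}\sum_{i=1}^nY_iU(\tfrac{X_i-u}h)K(\tfrac{X_i-u}h)$, $n_{uh}=\mathrm{Card}\{i:X_i\in B(u,h)\}$, and $\tilde B_{uh}=B_{uh}+\tau I\,1_{\{\lambda_{\min}(B_{uh})<\tau\}}$. Then $\tilde f_{uh}(x)=U^\top(\tfrac{x-u}h)\tilde B_{uh}^{-1}a_{uh}$ if $n_{uh}>0$ and $\tilde f_{uh}(x)=0$ if $n_{uh}=0$. PP estimator $\mathrm{PP}(M,\ell,h,\tau)$: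 let $\Lambda_M=\{((2k_1+1)/(2M),\dots,(2k_d+1)/(2M)):k_i\in\{0,\dots,M-1\}\}$; for $x\in\Omega$ let $u_x$ be the point of $\Lambda_M$ closest to $x$ (among ties, the one closest to $0$); then $\hat f_{\mathrm{PP}}(x)=\tilde f_{u_xh}(x)$. *)

(* Defs.v *)
From HB Require Import structures.
From mathcomp Require Import all_boot all_order all_algebra.
From mathcomp Require Import all_classical all_reals all_analysis.
Set Implicit Arguments. Unset Strict Implicit. Unset Printing Implicit Defensive.
Import Order.TTheory GRing.Theory Num.Theory.
Import numFieldNormedType.Exports.
Local Open Scope classical_set_scope.
Local Open Scope ring_scope.

Section Defs.
Variable R : realType.

(** Points of R^d are d-tuples of reals (product sigma-algebra = Borel). *)
Definition tsub d (x y : d.-tuple R) : d.-tuple R :=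
  [tuple tnth x i - tnth y i | i < d].
Definition tscale d (c : R) (x : d.-tuple R) : d.-tuple R :=
  [tuple c * tnth x i | i < d].
Definition tzero d : d.-tuple R := [tuple 0 | i < d].
Definition enorm d (x : d.-tuple R) : R := Num.sqrt (\sum_(i < d) tnth x i ^+ 2).
Definition inball d (u : d.-tuple R) (h : R) (x : d.-tuple R) : Prop :=
  enorm (tsub x u) <= h.
Definition incube d (x : d.-tuple R) : Prop := forall i, 0 <= tnth x i <= 1.
Definition inopencube d (x : d.-tuple R) : Prop := forall i, 0 < tnth x i < 1.
Definition setc d (x : d.-tuple R) (i : 'I_d) (t : R) : d.-tuple R :=
  [tuple if j == i then t else tnth x j | j < d].

(** floor_lt b = largest integer strictly less than b (b > 0) *)
Definition floor_lt (b : R) : nat := `|Num.ceil b - 1|%N.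

Definition multi_indices (d l : nat) : seq (seq nat) :=
  sort (fun s t => (sumn s <= sumn t)%N)
    [seq s <- [seq [seq nat_of_ord i | i <- val t] | t : d.-tuple 'I_l.+1]
       | (sumn s <= l)%N].
Definition Ndim d l : nat := size (multi_indices d l).
Definition monom d (s : seq nat) (x : d.-tuple R) : R :=
  \prod_(i < d) (tnth x i ^+ nth 0%N s i / ((nth 0%N s i)`!)%:R).
Definition Uvec d l (x : d.-tuple R) : 'cV[R]_(Ndim d l) :=
  \col_(j < Ndim d l) monom (nth [::] (multi_indices d l) j) x.

Definition lambda_min N (B : 'M[R]_N) : R := inf [set a : R | eigenvalue B a].

Section LP.
Variables (d l : nat) (h tau : R) (K : d.-tuple R -> R)
          (Z : seq (d.-tuple R * R)).
Let n := size Z.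
Let zi u (p : d.-tuple R * R) := tscale h^-1 (tsub p.1 u).
Definition Bmat (u : d.-tuple R) : 'M[R]_(Ndim d l) :=
  (n%:R * h ^+ d)^-1 *:
    \sum_(p <- Z) (K (zi u p) *: (Uvec l (zi u p) *m (Uvec l (zi u p))^T)).
Definition avec (u : d.-tuple R) : 'cV[R]_(Ndim d l) :=
  (n%:R * h ^+ d)^-1 *: \sum_(p <- Z) ((p.2 * K (zi u p)) *: Uvec l (zi u p)).
Definition nball (u : d.-tuple R) : nat :=
  count (fun p => `[< inball u h p.1 >]) Z.
Definition Btilde (u : d.-tuple R) : 'M[R]_(Ndim d l) :=
  Bmat u + (if lambda_min (Bmat u) < tau then tau%:M else 0).
Definition ftilde (u x : d.-tuple R) : R :=
  if (0 < nball u)%N then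
    ((Uvec l (tscale h^-1 (tsub x u)))^T *m invmx (Btilde u) *m avec u) 0 0
  else 0.
End LP.

Definition in_grid d (M : nat) (u : d.-tuple R) : Prop :=
  forall i, exists2 k : nat, (k < M)%N & tnth u i = (2 * k + 1)%:R / (2 * M)%:R.
Definition closest_grid d (M : nat) (x : d.-tuple R) : d.-tuple R :=
  xget (tzero d) [set u | in_grid M u /\
    (forall v, in_grid M v -> enorm (tsub u x) <= enorm (tsub v x)) /\
    (forall v, in_grid M v -> enorm (tsub v x) = enorm (tsub u x) ->
        enorm u <= enorm v)].
Definition fPP d (M l : nat) (h tau : R) (K : d.-tuple R -> R)
    (Z : seq (d.-tuple R * R)) (x : d.-tuple R) : R :=
  ftilde l h tau K Z (closest_grid M x) x.

Definition kernel_assumption d (K : d.-tuple R -> R) : Prop :=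
  exists Kmin Kmax Delta : R, [/\ 0 < Kmin, Kmin < Kmax, 0 < Delta, Delta < 1 &
    forall u, (if enorm u <= Delta then Kmin else 0) <= K u /\
              K u <= (if enorm u <= 1 then Kmax else 0)].

Definition pderiv d (i : 'I_d) (g : d.-tuple R -> R) (x : d.-tuple R) : R :=
  derive1 (fun t => g (setc x i t)) (tnth x i).
Definition Dlist d (js : seq 'I_d) (g : d.-tuple R -> R) : d.-tuple R -> R :=
  foldr (@pderiv d) g js.
Definition Dmulti d (s : seq nat) (g : d.-tuple R -> R) : d.-tuple R -> R :=
  Dlist (flatten (map (fun i : 'I_d => nseq (nth 0%N s i) i) (enum 'I_d))) g.
Definition cont_on d (P : d.-tuple R -> Prop) (g : d.-tuple R -> R) : Prop :=
  forall x, P x -> forall e : R, 0 < e -> exists2 del : R, 0 < del &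
    forall z, P z -> enorm (tsub z x) < del -> `|g z - g x| < e.
Definition holder_class d (beta C : R) (f : d.-tuple R -> R) : Prop :=
  let k := floor_lt beta in
  [/\ cont_on (@incube d) f,
      (forall js : seq 'I_d, (size js < k)%N -> forall i x, inopencube x ->
          derivable (fun t => Dlist js f (setc x i t)) (tnth x i) 1),
      (forall js : seq 'I_d, (size js <= k)%N -> cont_on (@inopencube d) (Dlist js f)) &
      exists a b : R, [/\ a + b <= C,
        forall s, s \in multi_indices d k -> forall x, inopencube x ->
          `|Dmulti s f x| <= a &
        forall s, s \in multi_indices d k -> sumn s = k -> forall x z,
          inopencube x -> inopencube z -> x != z ->
          `|Dmulti s f x - Dmulti s f z| <= b * enorm (tsub x z) `^ (beta - k%:R)]].

(** Lebesgue integral over R^d of a nonnegative function, as the iterated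
    integral over the coordinates (Tonelli) *)
Local Open Scope ereal_scope.
Fixpoint intRd (d : nat) : (d.-tuple R -> \bar R) -> \bar R :=
  match d with
  | 0%N => fun g => g [tuple]
  | d'.+1 => fun g => \int[@lebesgue_measure R]_(t in [set: R])
                         intRd (fun v : d'.-tuple R => g [tuple of t :: v])
  end.

(** The class P(beta): the law of (X,Y) is given by the density mu of X
    and a probability kernel kappa (regular conditional law of Y given X). *)
Definition in_class d (beta C mumin mumax sigma : R) (mu : d.-tuple R -> R)
    (kappa : R.-pker (d.-tuple R) ~> R) (f : d.-tuple R -> R) : Prop :=
  holder_class beta C f /\
  [/\ measurable_fun [set: d.-tuple R] mu,
      (forall x, ~ incube x -> mu x = 0%R),
      (forall x, incube x -> (mumin < mu x < mumax)%R) &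
      (intRd (fun x => (mu x)%:E) = 1)] /\
  (forall x, incube x -> \int[kappa x]_(y in [set: R]) y%:E = (f x)%:E) /\
      (forall x, incube x -> forall t : R,
         \int[kappa x]_(y in [set: R]) (expR (t * (y - f x)))%:E
           <= (expR (t ^+ 2 * sigma ^+ 2 / 2))%:E).

Fixpoint sampleE d (mu : d.-tuple R -> R) (kappa : R.-pker (d.-tuple R) ~> R)
    (n : nat) (G : seq (d.-tuple R * R) -> \bar R) : \bar R :=
  match n with
  | 0%N => G [::]
  | n'.+1 => intRd (fun x => (mu x)%:E *
               \int[kappa x]_(y in [set: R])
                  sampleE mu kappa n' (fun Z => G ((x, y) :: Z)))
  end.

Definition adv_class d (r : R) (A : d.-tuple R -> set (d.-tuple R)) : Prop :=
  forall x, incube x -> [/\ measurable (A x), A x x, A x `<=` @incube d &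
    forall x', A x x' -> (enorm (tsub x' x) <= r)%R].

Definition adv_risk d (q : \bar R) (mu : d.-tuple R -> R)
    (kappa : R.-pker (d.-tuple R) ~> R) (n : nat)
    (fhat : seq (d.-tuple R * R) -> d.-tuple R -> R) (f : d.-tuple R -> R)
    (A : d.-tuple R -> set (d.-tuple R)) : \bar R :=
  match q with
  | +oo => sampleE mu kappa n (fun Z =>
        ereal_sup [set (`|fhat Z p.2 - f p.1|)%:E | p in
                     [set p | incube p.1 /\ A p.1 p.2]])
  | -oo => 0
  | q'%:E => sampleE mu kappa n (fun Z =>
        intRd (fun x => (mu x)%:E *
          ereal_sup [set (`|fhat Z x' - f x| `^ q')%:E | x' in A x]))
  end.
Local Close Scope ereal_scope.

Definition bw_rate (q : \bar R) (beta : R) (d : nat) (r : nat -> R) (n : nat) : R :=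
  match q with
  | +oo%E => Num.max (r n) ((n%:R / ln n%:R) `^ (- (2 * beta + d%:R)^-1))
  | _ => Num.max (r n) (n%:R `^ (- (2 * beta + d%:R)^-1))
  end.
Definition risk_rate (q : \bar R) (beta : R) (d : nat) (r : nat -> R) (n : nat) : R :=
  match q with
  | +oo%E => r n `^ (Num.min 1 beta) + (n%:R / ln n%:R) `^ (- (beta / (2 * beta + d%:R)))
  | q'%:E => r n `^ (q' * Num.min 1 beta) + n%:R `^ (- (q' * beta / (2 * beta + d%:R)))
  | -oo%E => 0
  end.

Definition asymp_equiv (a b : nat -> R) : Prop :=
  exists c1 c2 : R, [/\ 0 < c1, 0 < c2 &
    \forall n \near \oo, c1 * b n <= a n <= c2 * b n].

End Defs.

(* Main.v *)
(** Fix a grid point [u] and put [H = n h^d]. A Taylor expansion of [f] at [u],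
    coordinate by coordinate, gives a polynomial of degree at most [l] within
    [O(h^beta)] of [f] near [u]. If each of finitely many small boxes around
    [u] contains a fixed fraction of [H] design points, then unisolvence of a
    tensor grid makes the Gram matrix of the estimator coercive, the
    regularisation is inactive, and the error at [x] near [u] is at most
    [O(h^beta)] plus the sum over the coordinates [j] of [|S_j|], where [S_j] is
    [1/H] times the kernel-weighted sum of the noises. Otherwise
    [invmx Btilde] is still bounded by [1/tau]. By
    Chernoff bounds the bad event has weight [exp (- kap H)], which beats every
    power of [n], and [E exp (t S_j) <= exp (C t^2 / H)] for [0 < t <= H].
    Taking [t = sqrt H] for finite [q], and [t = sqrt (H ln n)] together with a sum over
    all [M^d] grid points for [q = +oo], yields the stochastic rate; the
    Hölder modulus of [f] accounts for the attack. For finite [q] the supremum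
    over [A x] only sees the grid points within [O(h)] of [x], and these have
    total measure [O(1)] once [x] is integrated out.

    The kernel [K] and the estimator need not be measurable, and [\int] of a
    non-measurable nonnegative function is a lower integral, so additivity
    fails: every random quantity is first dominated by a finite sum of products
    of measurable functions of the single observations (the predicate [tame]),
    after which only monotonicity is used. *)
Require Import Defs.
From HB Require Import structures.
From mathcomp Require Import all_boot all_order all_algebra.
From mathcomp Require Import all_classical all_reals all_analysis.
From mathcomp Require Import measurable_realfun ring lra.
Set Implicit Arguments. Unset Strict Implicit. Unset Printing Implicit Defensive.
Import Order.TTheory GRing.Theory Num.Theory.
Import numFieldNormedType.Exports.
Local Open Scope classical_set_scope.
Local Open Scope ring_scope.

(** Only sums of products over the observations have an expectation that can be bounded factor by
    factor, so neither indicators of bad events nor moments of scores are integrated as such: both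
    are first traded for exponentials. The obstacle is the bad event. There the crude bound still
    contains the average absolute noise, which is unbounded and whose law may depend on the design,
    so that it cannot be split off from the Chernoff bound. Each Chernoff factor is therefore tilted
    by the exponential of [n%:R^-1] times the absolute noise of its observation. The tilt is weak
    enough for the [n] factors together to cost only a constant, and strong enough for the product
    to absorb any fixed power of the average noise. *)

(** * Iterated integrals of nonnegative functions on R^d *)

Section Integration.
Local Open Scope ereal_scope.
Import HBNNSimple.

(** The integral of a nonnegative function is the supremum over the simple functions below it, and
    this supremum grows with the function whether or not it is measurable. *)
Lemma ge0_le_integral_nonmeas dd (T : measurableType dd) (R : realType)
    (m : {measure set T -> \bar R}) (f g : T -> \bar R) :
  (forall x, 0 <= f x) -> (forall x, f x <= g x) ->
  \int[m]_(x in [set: T]) f x <= \int[m]_(x in [set: T]) g x.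
Proof.
move=> f0 fg; have g0 x : 0 <= g x by exact: le_trans (fg x).
rewrite !ge0_integralTE//; apply: ereal_sup_le => _ [s sf <-].
by exists s => // x; exact: le_trans (fg x).
Qed.

Variable R : realType.
Implicit Types d : nat.

Lemma intRd_ge0 d (g : d.-tuple R -> \bar R) :
  (forall x, 0 <= g x) -> 0 <= intRd g.
Proof.
elim: d g => [|d IH] g g0 //=.
by apply: integral_ge0 => t _; apply: IH.
Qed.

Lemma le_intRd d (f g : d.-tuple R -> \bar R) :
  (forall x, 0 <= f x) -> (forall x, f x <= g x) -> intRd f <= intRd g.
Proof.
elim: d f g => [|d IH] f g f0 fg //=.
apply: ge0_le_integral_nonmeas => t; first exact: intRd_ge0.
by apply: IH.
Qed.

Lemma eq_intRd d (f g : d.-tuple R -> \bar R) :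
  (forall x, f x = g x) -> intRd f = intRd g.
Proof. by move=> /funext ->. Qed.

(** The parameter space [T] serves the induction: the coordinate to be integrated is moved into it,
    and Tonelli's theorem then integrates it out. *)
Lemma measurable_intRd dd (T : measurableType dd) d
    (g : T * d.-tuple R -> \bar R) :
  measurable_fun setT g -> (forall x, 0 <= g x) ->
  measurable_fun [set: T] (fun t => intRd (fun v => g (t, v))).
Proof.
elim: d dd T g => [|d IH] dd T g mg g0 /=.
  apply: (measurableT_comp mg).
  by apply/measurable_fun_pair => //; exact: measurable_cst.
pose g' (z : (T * R) * d.-tuple R) := g (z.1.1, [tuple of z.1.2 :: z.2]).
have mg' : measurable_fun setT g'.
  apply: (measurableT_comp mg); apply/measurable_fun_pair => /=.
    by apply: measurableT_comp.
  by apply: measurable_cons => //; exact: measurableT_comp.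
have := @measurable_fun_fubini_tonelli_F _ _ T (measurableTypeR R) R
  (@lebesgue_measure R)
  (fun z => intRd (fun v => g' (z, v))) (IH _ _ _ mg' (fun=> g0 _)).
by apply=> z; apply: intRd_ge0 => v; exact: g0.
Qed.

Lemma measurable_intRd_cons d (g : d.+1.-tuple R -> \bar R) :
  measurable_fun [set: d.+1.-tuple R] g -> (forall x, 0 <= g x) ->
  measurable_fun [set: R] (fun t => intRd (fun v : d.-tuple R => g [tuple of t :: v])).
Proof.
move=> mg g0.
apply: (@measurable_intRd _ R d (fun z => g [tuple of z.1 :: z.2])) => //.
by apply: (measurableT_comp mg); exact: measurable_cons.
Qed.

Lemma measurable_section_cons d (g : d.+1.-tuple R -> \bar R) t :
  measurable_fun [set: d.+1.-tuple R] g ->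
  measurable_fun [set: d.-tuple R] (fun v => g [tuple of t :: v]).
Proof.
by move=> mg; apply: (measurableT_comp mg); exact: measurable_cons.
Qed.

Lemma intRdD d (f g : d.-tuple R -> \bar R) :
  measurable_fun [set: d.-tuple R] f -> measurable_fun [set: d.-tuple R] g ->
  (forall x, 0 <= f x) -> (forall x, 0 <= g x) ->
  intRd (fun x => f x + g x) = intRd f + intRd g.
Proof.
elim: d f g => [|d IH] f g mf mg f0 g0 //=.
rewrite -ge0_integralD//.
- by apply: eq_integral => t _; apply: IH => //; exact: measurable_section_cons.
- by move=> t _; exact: intRd_ge0.
- exact: measurable_intRd_cons.
- by move=> t _; exact: intRd_ge0.
- exact: measurable_intRd_cons.
Qed.

Lemma intRdZl d (c : R) (g : d.-tuple R -> \bar R) :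
  measurable_fun [set: d.-tuple R] g -> (forall x, 0 <= g x) -> (0 <= c)%R ->
  intRd (fun x => c%:E * g x) = c%:E * intRd g.
Proof.
elim: d g => [|d IH] g mg g0 c0 //=.
rewrite -ge0_integralZl_EFin//.
- by apply: eq_integral => t _; apply: IH => //; exact: measurable_section_cons.
- by move=> t _; exact: intRd_ge0.
- exact: measurable_intRd_cons.
Qed.

Lemma intRd_sum d I (s : seq I) (g : I -> d.-tuple R -> \bar R) :
  (forall i, measurable_fun [set: d.-tuple R] (g i)) ->
  (forall i x, 0 <= g i x) ->
  intRd (fun x => \sum_(i <- s) g i x) = \sum_(i <- s) intRd (g i).
Proof.
move=> mg g0; elim: s => [|i s IH].
  rewrite big_nil (eq_intRd (g := fun=> 0%:E * 0)); last first.
    by move=> x; rewrite big_nil mul0e.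
  by rewrite intRdZl// ?mul0e//; exact: measurable_cst.
rewrite big_cons -IH -intRdD//.
- by apply: eq_intRd => x; rewrite big_cons.
- by apply: emeasurable_sum.
- by move=> x; apply: sume_ge0.
Qed.

End Integration.

(** * Axis-parallel boxes and their volumes *)

Section Boxes.
Variable R : realType.

Definition inbox d (a b x : d.-tuple R) : bool :=
  [forall i, tnth a i <= tnth x i <= tnth b i].

Lemma inbox_cons d (a b x : d.+1.-tuple R) :
  inbox a b x = (thead a <= thead x <= thead b) &&
     inbox [tuple of behead a] [tuple of behead b] [tuple of behead x].
Proof.
apply/forallP/andP => [H|[H0 /forallP H] i].
  split; first exact: H ord0.
  by apply/forallP => i; rewrite !tnth_behead; exact: H.
case: (unliftP ord0 i) => [j ->|->] //.
have E : inord j.+1 = lift ord0 j :> 'I_d.+1.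
  by apply: val_inj; rewrite /= inordK// ltnS.
by move: (H j); rewrite !tnth_behead E.
Qed.

Lemma measurable_inbox d (a b : d.-tuple R) :
  measurable_fun [set: d.-tuple R] (fun x => (inbox a b x)%:R : R).
Proof.
have -> : (fun x => (inbox a b x)%:R : R) = fun x =>
    \prod_(i <- enum 'I_d) ((tnth a i <= tnth x i) && (tnth x i <= tnth b i))%:R.
  apply/funext => x; rewrite big_enum /=.
  case: (boolP (inbox a b x)) => [/forallP H|].
    by rewrite big1// => i _; rewrite H.
  by rewrite negb_forall => /existsP[i Hi]; rewrite (bigD1 i)//= (negbTE Hi) mul0r.
apply: measurable_prod => i _.
apply: (@measurableT_comp _ _ _ _ _ _ (fun b : bool => b%:R : R)) => //.
apply: measurable_and; apply: measurable_fun_ler => //;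
  by [exact: measurable_cst|exact: measurable_tnth].
Qed.

(** The factor [c] serves the induction: the indicator of the first coordinate is absorbed into it
    before the remaining coordinates are integrated. *)
Lemma intRd_inbox d (a b : d.-tuple R) (c : R) :
  0 <= c -> (forall i, tnth a i <= tnth b i) ->
  intRd (fun x => (c * (inbox a b x)%:R)%:E) = (c * \prod_i (tnth b i - tnth a i))%:E.
Proof.
elim: d a b c => [|d IH] a b c c0 ab /=.
  rewrite big_ord0 (_ : inbox _ _ _ = true)//; by apply/forallP => -[].
set a' := [tuple of behead a]; set b' := [tuple of behead b].
have ab' i : tnth a' i <= tnth b' i by rewrite !tnth_behead.
have p0 : 0 <= \prod_i (tnth b' i - tnth a' i).
  by apply: prodr_ge0 => i _; rewrite subr_ge0.
transitivity (\int[@lebesgue_measure R]_(t in [set: R])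
  ((c * \prod_(i < d) (tnth b' i - tnth a' i))%:E *
    (\1_(`[tnth a ord0, tnth b ord0]%classic) t)%:E))%E.
  apply: eq_integral => t _.
  have -> : \1_(`[tnth a ord0, tnth b ord0]%classic) t =
     (tnth a ord0 <= t <= tnth b ord0)%R%:R :> R.
    by rewrite indicE mem_setE in_itv.
  rewrite -EFinM -mulrA [X in c * X]mulrC mulrA -IH//; last exact: mulr_ge0.
  apply: eq_intRd => v; congr EFin.
  rewrite inbox_cons theadE /= -mulrA; congr (_ * _).
  by rewrite -natrM mulnb; congr (_ && inbox _ _ _)%:R; apply: val_inj.
rewrite ge0_integralZl_EFin//; last 2 first.
- by apply/measurable_EFinP; exact: measurable_indic.
- exact: mulr_ge0.
rewrite integral_indic// setIT [X in (_ * X)%E](lebesgue_measure_itv `[tnth a ord0, tnth b ord0])/= lte_fin.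
have -> : (if tnth a ord0 < tnth b ord0 then
    ((tnth b ord0)%:E - (tnth a ord0)%:E)%E else 0%E) = (tnth b ord0 - tnth a ord0)%:E.
  case: ifPn => //; rewrite -leNgt => ba.
  by congr EFin; apply/eqP; rewrite eq_sym subr_eq0 eq_le ba ab.
rewrite -EFinM big_ord_recl -mulrA; congr (_ * _)%:E; rewrite mulrC; congr (_ * _).
apply: eq_bigr => i _; rewrite !tnth_behead.
have -> // : inord i.+1 = lift ord0 i :> 'I_d.+1.
by apply: val_inj; rewrite /= inordK// ltnS.
Qed.
End Boxes.

(** * Expectation over an i.i.d. sample and domination by products *)

Section Sampling.
Variables (R : realType) (d : nat).
Variables (mu : d.-tuple R -> R) (kappa : R.-pker (d.-tuple R) ~> R).
Implicit Types (Z : seq (d.-tuple R * R)).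

Definition incubeZ Z := forall p, p \in Z -> incube p.1.

Hypothesis mmu : measurable_fun [set: d.-tuple R] mu.
Hypothesis mu_out : forall x, ~ incube x -> mu x = 0.
Hypothesis mu_ge0 : forall x, 0 <= mu x.
Hypothesis mu_prob : intRd (fun x => (mu x)%:E) = 1%E.

Lemma sampleE_ge0 n (G : seq (d.-tuple R * R) -> \bar R) :
  (forall Z, size Z = n -> incubeZ Z -> 0%E <= G Z)%E -> (0%E <= sampleE mu kappa n G)%E.
Proof.
elim: n G => [|n IH] G G0 /=; first by apply: G0.
apply: intRd_ge0 => x; have [xc|xc] := pselect (incube x); last first.
  by rewrite mu_out// mul0e.
apply: mule_ge0; first by rewrite lee_fin.
apply: integral_ge0 => y _; apply: IH => Z sZ ZC; apply: G0; first by rewrite /= sZ.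
by move=> p; rewrite inE => /orP[/eqP->//|]; exact: ZC.
Qed.

(** Only monotonicity of the nested integrals is involved, so the functionals need not be
    measurable. Samples leaving the cube may be ignored because [mu] vanishes there. *)
Lemma le_sampleE n (G F : seq (d.-tuple R * R) -> \bar R) :
  (forall Z, size Z = n -> incubeZ Z -> 0%E <= G Z)%E ->
  (forall Z, size Z = n -> incubeZ Z -> G Z <= F Z)%E ->
  (sampleE mu kappa n G <= sampleE mu kappa n F)%E.
Proof.
elim: n G F => [|n IH] G F G0 GF /=; first by apply: GF.
have consC x y Z : incube x -> incubeZ Z -> incubeZ ((x, y) :: Z).
  by move=> xc ZC p; rewrite inE => /orP[/eqP->//|]; exact: ZC.
apply: le_intRd => x; have [xc|xc] := pselect (incube x).
- apply: mule_ge0; first by rewrite lee_fin.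
  apply: integral_ge0 => y _; apply: sampleE_ge0 => Z sZ ZC.
  by apply: G0; [rewrite /= sZ|exact: consC].
- by rewrite mu_out// mul0e.
- apply: lee_wpmul2l; first by rewrite lee_fin.
  apply: ge0_le_integral_nonmeas => y.
    by apply: sampleE_ge0 => Z sZ ZC; apply: G0; [rewrite /= sZ|exact: consC].
  apply: IH => Z sZ ZC; first by apply: G0; [rewrite /= sZ|exact: consC].
  by apply: GF; [rewrite /= sZ|exact: consC].
- by rewrite mu_out// !mul0e.
Qed.

(* [K] is not assumed measurable, so [g] need only be measurable in [y];
   its conditional mean given [x] is dominated by a measurable [gb]. *)
Definition tame_factor (g : d.-tuple R * R -> R) (rho : R) : Prop :=
  (forall z, 0 <= g z) /\ exists gb : d.-tuple R -> R,
  [/\ measurable_fun [set: d.-tuple R] gb, forall x, 0 <= gb x,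
     forall x, incube x -> measurable_fun [set: R] (fun y => g (x, y)) /\
        (\int[kappa x]_(y in [set: R]) (g (x, y))%:E <= (gb x)%:E)%E &
     (intRd (fun x => (mu x * gb x)%:E) <= rho%:E)%E].

Lemma tame_factor_rho_ge0 g rho : tame_factor g rho -> 0 <= rho.
Proof.
move=> [_ [gb [_ gb0 _ H]]]; rewrite -lee_fin; apply: le_trans H.
by apply: intRd_ge0 => x; rewrite lee_fin mulr_ge0.
Qed.

(** Induction on [n] with the coefficients generalised: once the first observation is fixed, the
    numbers [a i * g i (x, y)] are the new coefficients. Additivity is invoked only on measurable
    integrands: in [y] after the inner expectation has been replaced by its bound, and in [x] after
    the conditional means have been replaced by [gb]. *)
Lemma sampleE_sum_prod n I (J : seq I) (a : I -> R)
    (g : I -> d.-tuple R * R -> R) (rho : I -> R) :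
  (forall i, 0 <= a i) -> (forall i, tame_factor (g i) (rho i)) ->
  (sampleE mu kappa n (fun Z => (\sum_(i <- J) a i * \prod_(z <- Z) g i z)%:E)
    <= (\sum_(i <- J) a i * rho i ^+ n)%:E)%E.
Proof.
move=> + gP; elim: n a => [|n IH] a a0 /=.
  by rewrite lee_fin; apply: ler_sum => i _; rewrite big_nil expr0.
have rho0 i := tame_factor_rho_ge0 (gP i).
have g0 i z : 0 <= g i z by have [+ _] := gP i; exact.
have [gb gbP] := choice (fun i => (gP i).2).
have mgb i : measurable_fun [set: d.-tuple R] (gb i) by have [] := gbP i.
have gb0 i x : 0 <= gb i x by have [_ + _ _] := gbP i; exact.
have c0 i : 0 <= a i * rho i ^+ n by rewrite mulr_ge0// exprn_ge0.
apply: (@le_trans _ _ (intRd (fun x =>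
    (\sum_(i <- J) (a i * rho i ^+ n)%:E * (mu x * gb i x)%:E)%E))).
  have F0 x y Z : 0 <= \sum_(i <- J) a i * \prod_(z <- (x, y) :: Z) g i z.
    by apply: sumr_ge0 => i _; rewrite mulr_ge0// prodr_ge0.
  apply: le_intRd => x.
    apply: mule_ge0; first by rewrite lee_fin.
    apply: integral_ge0 => y _; apply: sampleE_ge0 => Z _ _; exact: F0.
  have [xc|xc] := pselect (incube x); last first.
    by rewrite mu_out// mul0e; apply: sume_ge0 => i _; rewrite lee_fin mul0r mulr0.
  have -> : (\sum_(i <- J) (a i * rho i ^+ n)%:E * (mu x * gb i x)%:E)%E =
     ((mu x)%:E * (\sum_(i <- J) a i * rho i ^+ n * gb i x)%:E)%E.
    rewrite sumEFin -EFinM mulr_sumr; congr EFin.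
    by apply: eq_bigr => i _; ring.
  apply: lee_wpmul2l; first by rewrite lee_fin.
  apply: (@le_trans _ _ (\int[kappa x]_(y in [set: R])
    (\sum_(i <- J) (a i * rho i ^+ n)%:E * (g i (x, y))%:E))%E).
    apply: ge0_le_integral_nonmeas => y.
      apply: sampleE_ge0 => Z _ _; exact: F0.
    have := IH (fun i => a i * g i (x, y)) (fun i => mulr_ge0 (a0 i) (g0 i _)).
    rewrite sumEFin; congr (_ <= _)%E.
      congr (sampleE _ _ _ _); apply/funext => Z; congr EFin.
      by apply: eq_bigr => i _; rewrite big_cons mulrA.
    by congr EFin; apply: eq_bigr => i _; ring.
  rewrite ge0_integral_sum//; last 2 first.
  - move=> i; apply: measurable_funeM; apply/measurable_EFinP.
    by have [_ _ /(_ _ xc)[]] := gbP i.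
  - by move=> i y _; rewrite lee_fin mulr_ge0.
  rewrite -sumEFin; apply: lee_sum => i _.
  have [_ _ /(_ _ xc)[mg gle] _] := gbP i.
  rewrite ge0_integralZl_EFin//; last 2 first.
  - by move=> y _; rewrite lee_fin.
  - exact/measurable_EFinP.
  by rewrite [leRHS]EFinM; apply: lee_wpmul2l; rewrite ?lee_fin.
rewrite intRd_sum//; last 2 first.
- move=> i; apply: measurable_funeM; apply/measurable_EFinP.
  exact: measurable_funM.
- by move=> i x; rewrite lee_fin !mulr_ge0// exprn_ge0.
rewrite -sumEFin; apply: lee_sum => i _.
rewrite intRdZl//; last 2 first.
- by apply/measurable_EFinP; exact: measurable_funM.
- by move=> x; rewrite lee_fin mulr_ge0.
have [_ _ _ H] := gbP i.
apply: (@le_trans _ _ ((a i * rho i ^+ n)%:E * (rho i)%:E)%E).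
  by apply: lee_wpmul2l; rewrite ?lee_fin.
by rewrite lee_fin exprSr mulrA.
Qed.

Record term := Term { tcoef : R; tfac : d.-tuple R * R -> R; trate : R }.

(* [F] is dominated by a sum of products over the sample; such functionals are
   closed under sums and their expectation factorises. *)
Definition tame n (F : seq (d.-tuple R * R) -> R) (B : R) : Prop :=
  exists m (t : 'I_m -> term),
  [/\ forall i, 0 <= tcoef (t i) /\ tame_factor (tfac (t i)) (trate (t i)),
      forall Z, size Z = n -> incubeZ Z ->
        F Z <= \sum_i tcoef (t i) * \prod_(z <- Z) tfac (t i) z &
      \sum_i tcoef (t i) * trate (t i) ^+ n <= B].

Lemma tame_sampleE n (G : seq (d.-tuple R * R) -> \bar R) F B :
  tame n F B ->
  (forall Z, size Z = n -> incubeZ Z -> 0%E <= G Z)%E ->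
  (forall Z, size Z = n -> incubeZ Z -> G Z <= (F Z)%:E)%E ->
  (sampleE mu kappa n G <= B%:E)%E.
Proof.
move=> [m [t [tP FZ tB]]] G0 GF.
apply: (@le_trans _ _ (sampleE mu kappa n (fun Z =>
   (\sum_i tcoef (t i) * \prod_(z <- Z) tfac (t i) z)%:E))).
  apply: le_sampleE => // Z sZ ZC; apply: (le_trans (GF _ sZ ZC)).
  by rewrite lee_fin FZ.
apply: le_trans (sampleE_sum_prod _ _ _ _) _.
- by move=> i; have [] := tP i.
- by move=> i; have [_] := tP i; exact.
- by rewrite lee_fin.
Qed.

Lemma le_tame n F F' B B' : tame n F B ->
  (forall Z, size Z = n -> incubeZ Z -> F' Z <= F Z) -> B <= B' -> tame n F' B'.
Proof.
move=> [m [t [tP FZ tB]]] FF BB; exists m, t; split => //.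
  by move=> Z sZ ZC; apply: le_trans (FZ _ sZ ZC); exact: FF.
exact: le_trans BB.
Qed.

Lemma tame_prod n g rho : tame_factor g rho ->
  tame n (fun Z => \prod_(z <- Z) g z) (rho ^+ n).
Proof.
move=> gP; exists 1%N, (fun=> Term 1 g rho); split => //=.
- by move=> Z _ _; rewrite big_ord1 mul1r.
- by rewrite big_ord1 mul1r.
Qed.

Lemma tame0 n : tame n (fun=> 0) 0.
Proof.
exists 0%N, (fun i => Term 0 (fun=> 0) 0); split => //=.
- by case.
- by move=> Z _ _; rewrite big_ord0.
- by rewrite big_ord0.
Qed.

Lemma tameD n F F' B B' : tame n F B -> tame n F' B' ->
  tame n (fun Z => F Z + F' Z) (B + B').
Proof.
move=> [m [t [tP FZ tB]]] [m' [t' [tP' FZ' tB']]].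
pose s (i : 'I_(m + m')) := match fintype.split i with inl j => t j | inr j => t' j end.
have sl j : s (lshift m' j) = t j.
  by rewrite /s -[lshift m' j]/(unsplit (inl j)) unsplitK.
have sr j : s (rshift m j) = t' j.
  by rewrite /s -[rshift m j]/(unsplit (inr j)) unsplitK.
exists (m + m')%N, s; split.
- by move=> i; rewrite /s; case: fintype.split => j; [exact: tP|exact: tP'].
- move=> Z sZ ZC; rewrite big_split_ord /=.
  apply: lerD.
    by apply: le_trans (FZ _ sZ ZC) _; under [leRHS]eq_bigr do rewrite sl.
  by apply: le_trans (FZ' _ sZ ZC) _; under [leRHS]eq_bigr do rewrite sr.
- rewrite big_split_ord /=; apply: lerD.
    by apply: le_trans tB; under eq_bigr do rewrite sl.
  by apply: le_trans tB'; under eq_bigr do rewrite sr.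
Qed.

Lemma tameZ n c F B : 0 <= c -> tame n F B -> tame n (fun Z => c * F Z) (c * B).
Proof.
move=> c0 [m [t [tP FZ tB]]].
exists m, (fun i => Term (c * tcoef (t i)) (tfac (t i)) (trate (t i))); split => /=.
- by move=> i; have [? ?] := tP i; split => //; exact: mulr_ge0.
- move=> Z sZ ZC; under eq_bigr do rewrite -mulrA.
  by rewrite -mulr_sumr ler_wpM2l// FZ.
- by under eq_bigr do rewrite -mulrA; rewrite -mulr_sumr ler_wpM2l.
Qed.

Lemma tame_sum n I (s : seq I) (F : I -> _) (B : I -> R) :
  (forall i, tame n (F i) (B i)) ->
  tame n (fun Z => \sum_(i <- s) F i Z) (\sum_(i <- s) B i).
Proof.
move=> H; elim: s => [|i s IH].
  by apply: le_tame (tame0 n) _ _ => [Z _ _|]; rewrite big_nil.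
by apply: le_tame (tameD (H i) IH) _ _ => [Z _ _|]; rewrite big_cons.
Qed.

Lemma tame_cst n c : 0 <= c -> tame n (fun=> c) c.
Proof.
move=> c0.
have H : tame_factor (fun=> 1) 1.
  split=> //; exists (fun=> 1); split => //.
  - move=> x _; split; first exact: measurable_cst.
    by rewrite integral_cst// mul1e prob_kernel.
  - by under eq_intRd do rewrite mulr1; rewrite mu_prob.
apply: le_tame (tameZ c0 (tame_prod n H)) _ _ => [Z _ _|].
  by rewrite big1// mulr1.
by rewrite expr1n mulr1.
Qed.

Lemma intRd_mu_boxD (c mumax : R) (a b : d.-tuple R) : 0 <= c -> 0 <= mumax ->
  (forall x, incube x -> mu x <= mumax) -> (forall i, tnth a i <= tnth b i) ->
  (intRd (fun x => (mu x * (1 + c * (inbox a b x)%:R))%:E) <=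
    (1 + c * mumax * \prod_i (tnth b i - tnth a i))%:E)%E.
Proof.
move=> c0 mm0 mm ab.
rewrite (eq_intRd (g := fun x => ((mu x)%:E + (mu x * (c * (inbox a b x)%:R))%:E)%E)); last first.
  by move=> x; rewrite -EFinD mulrDr mulr1.
have mB : measurable_fun [set: d.-tuple R] (fun x => c * (inbox a b x)%:R).
  by apply: measurable_funM; [exact: measurable_cst|exact: measurable_inbox].
have B0 x : 0 <= c * (inbox a b x)%:R by rewrite mulr_ge0.
rewrite intRdD; last 4 first.
- exact/measurable_EFinP.
- by apply/measurable_EFinP; exact: measurable_funM.
- by move=> x; rewrite lee_fin.
- by move=> x; rewrite lee_fin mulr_ge0.
rewrite mu_prob EFinD leeD2lE// -intRd_inbox//; last exact: mulr_ge0.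
apply: le_intRd => x; rewrite lee_fin; first by rewrite mulr_ge0.
have [xc|xc] := pselect (incube x).
  rewrite mulrA [c * mumax]mulrC; apply: ler_wpM2r => //.
  by apply: ler_wpM2r => //; exact: mm.
by rewrite mu_out// mul0r !mulr_ge0.
Qed.

(** The mass of the box is subtracted from the total mass [1]. The box has to lie in the cube
    because the lower bound on [mu] holds only there. *)
Lemma intRd_mu_boxB (c mumin : R) (a b : d.-tuple R) : 0 <= c <= 1 -> 0 <= mumin ->
  (forall x, incube x -> mumin <= mu x) -> (forall i, tnth a i <= tnth b i) ->
  (forall x, inbox a b x -> incube x) ->
  (intRd (fun x => (mu x * (1 - c * (inbox a b x)%:R))%:E) <=
    (1 - c * mumin * \prod_i (tnth b i - tnth a i))%:E)%E.
Proof.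
move=> /andP[c0 c1] mm0 mm ab boxC.
have mB : measurable_fun [set: d.-tuple R] (fun x => c * (inbox a b x)%:R).
  by apply: measurable_funM; [exact: measurable_cst|exact: measurable_inbox].
have B0 x : 0 <= c * (inbox a b x)%:R by rewrite mulr_ge0.
have B1 x : 0 <= 1 - c * (inbox a b x)%:R.
  by rewrite subr_ge0; case: inbox; rewrite ?mulr1 ?mulr0.
have := mu_prob.
rewrite (eq_intRd (g := fun x => ((mu x * (1 - c * (inbox a b x)%:R))%:E +
   (mu x * (c * (inbox a b x)%:R))%:E)%E)); last first.
  by move=> x; rewrite -EFinD mulrBr mulr1 subrK.
rewrite intRdD; last 4 first.
- apply/measurable_EFinP; apply: measurable_funM => //.
  by apply: measurable_funB => //; exact: measurable_cst.
- by apply/measurable_EFinP; exact: measurable_funM.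
- by move=> x; rewrite lee_fin mulr_ge0.
- by move=> x; rewrite lee_fin mulr_ge0.
move=> E; rewrite EFinB leeBrDr// -E leeD2l// -intRd_inbox//; last exact: mulr_ge0.
apply: le_intRd => x; rewrite lee_fin; first by rewrite !mulr_ge0.
rewrite [c * mumin]mulrC -mulrA.
have [/boxC xc|_] := boolP (inbox a b x); last by rewrite !mulr0.
by apply: ler_wpM2r; [rewrite mulr1|exact: mm].
Qed.

End Sampling.

(** * Quadratic forms, smallest eigenvalue and inverses *)

Section QuadraticForms.
Variables (R : realType) (N : nat).
Implicit Types (P A B : 'M[R]_N) (u v w : 'cV[R]_N).

Definition qf P u v : R := (u^T *m P *m v) 0 0.
Definition dotv u v : R := (u^T *m v) 0 0.
Definition psd P := P^T = P /\ forall v, 0 <= qf P v v.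

Lemma dotvE u v : dotv u v = \sum_i u i 0 * v i 0.
Proof. by rewrite /dotv mxE; apply: eq_bigr => i _; rewrite mxE. Qed.

Lemma dotvC u v : dotv u v = dotv v u.
Proof. by rewrite !dotvE; apply: eq_bigr => i _; rewrite mulrC. Qed.

Lemma dotvv_ge0 v : 0 <= dotv v v.
Proof. by rewrite dotvE sumr_ge0// => i _; rewrite -expr2 sqr_ge0. Qed.

Lemma dotvv_eq0 v : (dotv v v == 0) = (v == 0).
Proof.
apply/eqP/eqP => [|->]; last by rewrite dotvE big1// => i _; rewrite mxE mul0r.
rewrite dotvE => /eqP; rewrite psumr_eq0; last by move=> i _; rewrite -expr2 sqr_ge0.
move=> /allP H; apply/matrixP => i j; rewrite ord1 [RHS]mxE; apply/eqP.
by have := H i (mem_index_enum _); rewrite mulf_eq0 orbb.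
Qed.

Lemma dotvv_gt0 v : (0 < dotv v v) = (v != 0).
Proof. by rewrite lt_neqAle dotvv_ge0 andbT eq_sym dotvv_eq0. Qed.

Lemma qfDl P u u' v : qf P (u + u') v = qf P u v + qf P u' v.
Proof. by rewrite /qf linearD /= !mulmxDl mxE. Qed.
Lemma qfDr P u v v' : qf P u (v + v') = qf P u v + qf P u v'.
Proof. by rewrite /qf mulmxDr mxE. Qed.
Lemma qfZl P c u v : qf P (c *: u) v = c * qf P u v.
Proof. by rewrite /qf linearZ /= -!scalemxAl mxE. Qed.
Lemma qfZr P c u v : qf P u (c *: v) = c * qf P u v.
Proof. by rewrite /qf -!scalemxAr mxE. Qed.
Lemma qfC P u v : P^T = P -> qf P u v = qf P v u.
Proof.
move=> sP; rewrite /qf -[in RHS](trmxK (v^T *m P *m u)) [RHS]mxE.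
by rewrite !trmx_mul trmxK sP mulmxA.
Qed.
Lemma qf1 u v : qf 1%:M u v = dotv u v.
Proof. by rewrite /qf mulmx1. Qed.
Lemma qfDm P A u v : qf (P + A) u v = qf P u v + qf A u v.
Proof. by rewrite /qf mulmxDr mulmxDl mxE. Qed.
Lemma qfZm c P u v : qf (c *: P) u v = c * qf P u v.
Proof. by rewrite /qf -scalemxAr -scalemxAl mxE. Qed.

Lemma qf_CauchySchwarz P u v : psd P -> qf P u v ^+ 2 <= qf P u u * qf P v v.
Proof.
move=> [sP P0].
have key a b : 0 <= a ^+ 2 * qf P u u + 2 * a * b * qf P u v + b ^+ 2 * qf P v v.
  have := P0 (a *: u + b *: v).
  rewrite !(qfDl, qfDr, qfZl, qfZr) (qfC v u sP).
  by congr (_ <= _); ring.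
set c := qf P v v; set a := qf P u v; set e := qf P u u.
have c0 : 0 <= c := P0 v; have e0 : 0 <= e := P0 u.
move: c0; rewrite le_eqVlt => /orP[/eqP c0|c0].
  rewrite -c0 mulr0; have [->|an0] := eqVneq a 0; first by rewrite expr0n.
  (* When [qf P v v] vanishes the quadratic is affine in its second argument, and this choice makes
     its value [- a ^+ 2]. *)
  have := key a (- (e + 1) / 2); rewrite -/c -/a -/e -c0.
  have -> : a ^+ 2 * e + 2 * a * (- (e + 1) / 2) * a + (- (e + 1) / 2) ^+ 2 * 0 = - a ^+ 2.
    by field.
  by rewrite oppr_ge0.
have := key c (- a); rewrite -/c -/a -/e.
have -> : c ^+ 2 * e + 2 * c * (- a) * a + (- a) ^+ 2 * c = c * (e * c - a ^+ 2) by ring.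
by rewrite pmulr_rge0// subr_ge0.
Qed.

Lemma psd1 : psd 1%:M.
Proof. by split; [rewrite trmx1|move=> v; rewrite qf1 dotvv_ge0]. Qed.

Lemma dotv_CauchySchwarz u v : dotv u v ^+ 2 <= dotv u u * dotv v v.
Proof. by rewrite -!qf1; exact: qf_CauchySchwarz psd1. Qed.

Lemma qf_bound A v : qf A v v <= (\sum_i \sum_j `|A i j|) * dotv v v.
Proof.
have vle i : v i 0 ^+ 2 <= dotv v v.
  rewrite dotvE (bigD1 i)//= -expr2 lerDl sumr_ge0// => k _.
  by rewrite -expr2 sqr_ge0.
rewrite /qf mxE exchange_big mulr_suml; apply: ler_sum => j _.
rewrite mxE !mulr_suml; apply: ler_sum => i _; rewrite mxE.
have := vle i; have := vle j; set x := v i 0; set y := v j 0; set s := dotv v v.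
move=> ys xs.
have xys : `|x * y| <= s.
  rewrite ler_norml; have := sqr_ge0 (x + y); have := sqr_ge0 (x - y).
  by rewrite !expr2 in ys xs * => ? ?; apply/andP; split; lra.
apply: le_trans (ler_norm _) _.
have -> : x * A i j * y = A i j * (x * y) by ring.
by rewrite normrM; apply: ler_wpM2l.
Qed.

(** Cauchy-Schwarz for the form [P] at [v] and [invmx P *m v] bounds the square of [dotv v v] by
    [qf P v v] times [qf (invmx P) v v], and the last factor is at most a constant times
    [dotv v v]. *)
Lemma psd_unit_coercive P : psd P -> P \in unitmx ->
  exists2 e, 0 < e & forall v, e * dotv v v <= qf P v v.
Proof.
move=> pP uP; set C := 1 + \sum_i \sum_j `|(invmx P) i j|.
have C0 : 0 < C.
  by rewrite ltr_pwDl// sumr_ge0// => i _; rewrite sumr_ge0.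
exists C^-1; first by rewrite invr_gt0.
move=> v; have [->|v0] := eqVneq v 0.
  by rewrite /qf /dotv !mulmx0 mxE mulr0.
have s0 : 0 < dotv v v by rewrite dotvv_gt0.
have := qf_CauchySchwarz v (invmx P *m v) pP.
have -> : qf P v (invmx P *m v) = dotv v v.
  by rewrite /qf /dotv -mulmxA mulKVmx.
have -> : qf P (invmx P *m v) (invmx P *m v) = qf (invmx P) v v.
  by rewrite /qf -!mulmxA mulKVmx// trmx_mul trmx_inv pP.1 -mulmxA.
move=> H; rewrite ler_pdivrMl//.
rewrite -(ler_pM2r s0) -expr2; apply: le_trans H _.
have -> : C * qf P v v * dotv v v = qf P v v * (C * dotv v v) by ring.
apply: ler_wpM2l; first exact: pP.2.
apply: le_trans (qf_bound _ _) _; apply: ler_wpM2r; first exact: ltW.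
by rewrite lerDr.
Qed.

(* The infimum of the Rayleigh quotient is an eigenvalue: otherwise [B - m]
   would be positive semidefinite and invertible, hence coercive. *)
Lemma psd_rayleigh_eigenvalue B : (0 < N)%N -> psd B ->
  exists2 m, eigenvalue B m & forall v, m * dotv v v <= qf B v v.
Proof.
move=> N0 pB; set S := [set t : R | forall v, t * dotv v v <= qf B v v].
have S0 : S 0 by move=> v; rewrite mul0r; exact: pB.2.
pose i0 := Ordinal N0; pose e0 : 'cV[R]_N := delta_mx i0 0.
have e00 : e0 != 0.
  by apply/eqP => /matrixP/(_ i0 0)/eqP; rewrite !mxE !eqxx/= oner_eq0.
have de0 : 0 < dotv e0 e0 by rewrite dotvv_gt0.
have ubS : has_ubound S.
  exists (qf B e0 e0 / dotv e0 e0) => t /(_ e0); by rewrite ler_pdivlMr.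
have hS : has_sup S by split => //; exists 0.
have mS : S (sup S).
  move=> v; have [->|v0] := eqVneq v 0.
    by rewrite /qf /dotv !mulmx0 mxE mulr0.
  rewrite -dotvv_gt0 in v0; rewrite -ler_pdivlMr//.
  apply: ge_sup; first by exists 0.
  by move=> t /(_ v); rewrite ler_pdivlMr.
exists (sup S) => //.
set P := B - (sup S)%:M.
have qP v : qf P v v = qf B v v - sup S * dotv v v.
  by rewrite /P -scalemx1 -scaleN1r scalerA mulN1r qfDm qfZm qf1 mulNr.
have pP : psd P.
  split; first by rewrite linearB /= pB.1 tr_scalar_mx.
  by move=> v; rewrite qP subr_ge0; exact: mS.
have nuP : P \notin unitmx.
  apply/negP => /(psd_unit_coercive pP)[e e_gt0 He].
  have : S (sup S + e).
    by move=> v; have := He v; rewrite qP mulrDl lerBrDl.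
  by move=> /(ub_le_sup ubS); rewrite gerDl leNgt e_gt0.
move: nuP; rewrite unitmxE unitfE negbK => /det0P[v v0 vP].
apply/eigenvalueP; exists v => //.
by move: vP; rewrite /P mulmxBr mul_mx_scalar => /eqP; rewrite subr_eq0 => /eqP.
Qed.

Lemma eigenvalue_qf_ge B a c : (forall v, c * dotv v v <= qf B v v) ->
  eigenvalue B a -> c <= a.
Proof.
move=> H /eigenvalueP[v vB v0].
have := H v^T.
have -> : qf B v^T v^T = a * dotv v^T v^T by rewrite /qf /dotv trmxK vB -scalemxAl mxE.
rewrite ler_pM2r// dotvv_gt0.
by apply: contra_neq v0 => /(congr1 trmx); rewrite trmxK trmx0.
Qed.

(** The existence of an eigenvalue matters here, since [inf] of the empty set would be a default
    value unrelated to [B]. *)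
Lemma lambda_min_ge B c : (0 < N)%N -> psd B ->
  (forall v, c * dotv v v <= qf B v v) -> c <= lambda_min B.
Proof.
move=> N0 pB H; have [m Em _] := psd_rayleigh_eigenvalue N0 pB.
apply: lb_le_inf; first by exists m.
by move=> a; exact: eigenvalue_qf_ge.
Qed.

Lemma lambda_min_qf B v : (0 < N)%N -> psd B ->
  lambda_min B * dotv v v <= qf B v v.
Proof.
move=> N0 pB; have [m Em Hm] := psd_rayleigh_eigenvalue N0 pB.
apply: le_trans (Hm v); apply: ler_wpM2r; first exact: dotvv_ge0.
apply: ge_inf => //; exists 0 => a; apply: eigenvalue_qf_ge => w.
by rewrite mul0r; exact: pB.2.
Qed.

Lemma coercive_unitmx B c : 0 < c -> (forall v, c * dotv v v <= qf B v v) ->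
  B \in unitmx.
Proof.
move=> c0 H; rewrite unitmxE unitfE; apply/negP => /det0P[v v0 vB].
have := H v^T; rewrite /qf trmxK vB mul0mx mxE pmulr_rle0//.
by rewrite leNgt dotvv_gt0; move/negP; apply; apply: contra_neq v0 => /(congr1 trmx); rewrite trmxK trmx0.
Qed.

(** With [y = invmx B *m a], coercivity gives [c * dotv y y <= qf B y y = dotv y a], so
    Cauchy-Schwarz bounds the norm of [y] by the norm of [a] divided by [c]. *)
Lemma coercive_invmx_bound B c w a : 0 < c ->
  (forall v, c * dotv v v <= qf B v v) ->
  ((w^T *m invmx B *m a) 0 0) ^+ 2 <= dotv w w * dotv a a / c ^+ 2.
Proof.
move=> c0 H; have uB := coercive_unitmx c0 H.
set y := invmx B *m a.
have -> : (w^T *m invmx B *m a) 0 0 = dotv w y by rewrite /dotv /y mulmxA.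
apply: le_trans (dotv_CauchySchwarz _ _) _.
rewrite -mulrA; apply: ler_wpM2l; first exact: dotvv_ge0.
rewrite ler_pdivlMr ?exprn_gt0//.
have [y0|y0] := eqVneq y 0.
  by rewrite y0 /dotv mulmx0 mxE mul0r dotvv_ge0.
have Hy := H y.
have E : qf B y y = dotv y a by rewrite /qf /dotv -mulmxA /y mulKVmx.
have := dotv_CauchySchwarz y a; rewrite -E => CS.
rewrite -(@ler_pM2l _ (dotv y y)) ?dotvv_gt0//.
apply: le_trans CS; rewrite mulrA -expr2 -exprMn [_ * c]mulrC.
have d0 : 0 <= c * dotv y y by rewrite mulr_ge0 ?dotvv_ge0 ?ltW.
by rewrite ler_sqr ?nnegrE// (le_trans d0).
Qed.

End QuadraticForms.

(** * Taylor's formula in one variable with Hölder remainder *)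

Section Taylor1D.
Variable R : realType.

Lemma is_derive_taylor_term (c u s : R) j :
  is_derive s 1 (fun x => c * ((x - u) ^+ j.+1 / (j.+1)`!%:R) : R)
    (c * ((s - u) ^+ j / j`!%:R)).
Proof.
have -> : (fun x => c * ((x - u) ^+ j.+1 / (j.+1)`!%:R) : R) =
   (c / (j.+1)`!%:R) *: (fun x : R => x - u) ^+ j.+1.
  apply/funext => x; rewrite /GRing.scale /=.
  have -> : ((fun x : R => x - u) ^+ j.+1) x = (x - u) ^+ j.+1.
    by elim: j.+1 => [|k IH] //; rewrite !exprS -IH.
  by rewrite mulrA mulrAC.
have H : is_derive s 1 (fun x : R => x - u) 1.
  have -> : (fun x : R => x - u) = id - cst u by [].
  by apply: is_derive_eq; rewrite subr0.
apply: is_derive_eq.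
rewrite /GRing.scale /= mulr1 factS natrM invfM.
have : j.+1%:R != 0 :> R by rewrite pnatr_eq0.
have : (j`!)%:R != 0 :> R by rewrite pnatr_eq0 -lt0n fact_gt0.
by move=> ? ?; field; apply/andP; split.
Qed.

(** The derivative is bounded only at points no farther from [u] than [t] is, so that [B] may itself
    depend on the distance from [t] to [u]; the induction for Taylor's formula relies on this. *)
Lemma derive_bound_dist (f df : R -> R) (B t u : R) :
  0 < t < 1 -> 0 < u < 1 ->
  (forall s : R, 0 < s < 1 -> is_derive s 1 f (df s)) ->
  (forall s : R, 0 < s < 1 -> `|s - u| <= `|t - u| -> `|df s| <= B) ->
  `|f t - f u| <= B * `|t - u|.
Proof.
move=> t01 u01 Hd HB.
have main a b : 0 < a -> b < 1 -> a < b ->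
    exists2 c, a < c < b & f b - f a = df c * (b - a).
  move=> a0 b1 ab; have [||c] := @MVT R f df a b ab.
  - by move=> x; rewrite in_itv /= => /andP[ax xb]; apply: Hd; rewrite (lt_trans a0 ax) (lt_trans xb b1).
  - apply: derivable_within_continuous => x; rewrite in_itv /= => /andP[ax xb].
    have Hx : 0 < x < 1 by rewrite (lt_le_trans a0 ax) (le_lt_trans xb b1).
    exact: (@ex_derive _ _ _ _ _ _ _ (Hd x Hx)).
  by rewrite in_itv /= => cab E; exists c.
move: t01 u01 => /andP[t0 t1] /andP[u0 u1].
have [tu|ut|->] := ltgtP t u.
- have [c /andP[tc cu] E] := main _ _ t0 u1 tu.
  rewrite distrC E normrM (distrC t u); apply: ler_wpM2r => //.
  apply: HB; first by rewrite (lt_trans t0 tc) (lt_trans cu u1).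
  by rewrite !ler0_norm; lra.
- have [c /andP[uc ct] E] := main _ _ u0 t1 ut.
  rewrite E normrM; apply: ler_wpM2r => //.
  apply: HB; first by rewrite (lt_trans u0 uc) (lt_trans ct t1).
  by rewrite !ger0_norm; lra.
- by rewrite !subrr normr0 mulr0.
Qed.

(** The derivative of the remainder is the remainder of one order less for the shifted family
    [phi j.+1]; the mean value inequality turns its bound into one more factor [t - u]. Stating it
    for a family [phi] linked by differentiation lets [phi] be a chain of mixed partial
    derivatives. *)
Lemma taylor1D (phi : nat -> R -> R) (K : nat) (b al u t : R) :
  0 <= al -> 0 <= b -> 0 < u < 1 -> 0 < t < 1 ->
  (forall j (s : R), (j < K)%N -> 0 < s < 1 -> is_derive s 1 (phi j) (phi j.+1 s)) ->
  (forall s : R, 0 < s < 1 -> `|phi K s - phi K u| <= b * `|s - u| `^ al) ->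
  `|phi 0%N t - \sum_(j < K.+1) phi j u * ((t - u) ^+ j / j`!%:R)|
     <= b * `|t - u| `^ al * `|t - u| ^+ K.
Proof.
move=> al0 b0 u01; elim: K phi t => [|K IH] phi t t01 Hd HK.
  by rewrite big_ord1 !expr0 mulr1 divr1 mulr1; exact: HK.
pose f s := phi 0%N s - \sum_(j < K.+2) phi j u * ((s - u) ^+ j / j`!%:R).
pose df s := phi 1%N s - \sum_(j < K.+1) phi j.+1 u * ((s - u) ^+ j / j`!%:R).
have fu : f u = 0.
  rewrite /f big_ord_recl /= expr0 divr1 mulr1 big1 ?addr0 ?subrr// => i _.
  by rewrite ?subrr expr0n mul0r mulr0.
have df' (s : R) : 0 < s < 1 -> is_derive s 1 f (df s).
  move=> s01.
  have -> : f = phi 0%N - (cst (phi 0%N u) +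
     \sum_(j < K.+1) (fun x => phi j.+1 u * ((x - u) ^+ j.+1 / j.+1`!%:R))).
    apply/funext => x; rewrite /f big_ord_recl /= expr0 divr1 mulr1.
    by rewrite !fctE fct_sumE.
  rewrite -[df s]/(phi 1%N s - _); apply: is_deriveB; first exact: Hd.
  rewrite -[X in is_derive _ _ _ X]add0r; apply: is_deriveD.
  by apply: is_derive_sum => i; exact: is_derive_taylor_term.
have := @derive_bound_dist f df (b * `|t - u| `^ al * `|t - u| ^+ K) t u t01 u01 df'.
rewrite fu subr0 exprSr mulrA; apply => s s01 stu.
have := IH (fun j => phi j.+1) s s01 (fun j s jK => Hd j.+1 s jK) HK.
move=> /le_trans; apply.
apply: ler_pM => //.
- by rewrite mulr_ge0// powR_ge0.
- by apply: ler_wpM2l => //; apply: ge0_ler_powR; rewrite ?nnegrE.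
- by apply: lerXn2r; rewrite ?nnegrE.
Qed.

End Taylor1D.

(** * Norms and coordinate changes in R^d *)

Section Points.
Variables (R : realType) (d : nat).
Implicit Types (x y z u w : d.-tuple R).

Lemma tnth_tsub x y i : tnth (tsub x y) i = tnth x i - tnth y i.
Proof. by rewrite tnth_mktuple. Qed.

Lemma tnth_setc x i t j : tnth (setc x i t) j = if j == i then t else tnth x j.
Proof. by rewrite tnth_mktuple. Qed.

Lemma setc_setc x i s t : setc (setc x i s) i t = setc x i t.
Proof. by apply: eq_from_tnth => j; rewrite !tnth_setc; case: eqP. Qed.

Lemma setc_id x i : setc x i (tnth x i) = x.
Proof. by apply: eq_from_tnth => j; rewrite tnth_setc; case: eqP => [->|]. Qed.

Lemma setc_opencube x i t : inopencube x -> 0 < t < 1 -> inopencube (setc x i t).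
Proof. by move=> xo t01 j; rewrite tnth_setc; case: eqP. Qed.

Lemma opencube_cube x : inopencube x -> incube x.
Proof. by move=> xo i; have /andP[? ?] := xo i; rewrite !ltW. Qed.

Lemma enorm_ge0 x : 0 <= enorm x.
Proof. exact: sqrtr_ge0. Qed.

Lemma coord_le_enorm x i : `|tnth x i| <= enorm x.
Proof.
rewrite -sqrtr_sqr; apply: ler_wsqrtr.
by rewrite (bigD1 i)//= lerDl sumr_ge0// => j _; exact: sqr_ge0.
Qed.

Lemma enorm_le x c : 0 <= c -> \sum_i tnth x i ^+ 2 <= c ^+ 2 -> enorm x <= c.
Proof.
by move=> c0 H; rewrite -(ger0_norm c0) -sqrtr_sqr; exact: ler_wsqrtr.
Qed.

Lemma enorm_le_coord x c : 0 <= c -> (forall i, `|tnth x i| <= c) -> enorm x <= d%:R * c.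
Proof.
move=> c0 H; apply: enorm_le; first exact: mulr_ge0.
apply: (@le_trans _ _ (\sum_(i < d) c ^+ 2)).
  by apply: ler_sum => i _; rewrite -real_normK ?num_real// lerXn2r ?nnegrE.
rewrite sumr_const card_ord exprMn -[leLHS]mulr_natl; apply: ler_wpM2r; first exact: sqr_ge0.
by rewrite -natrX ler_nat; case: (d) => // n; rewrite leq_pmull.
Qed.

Lemma enorm_setc x i s t : enorm (tsub (setc x i s) (setc x i t)) = `|s - t|.
Proof.
rewrite -sqrtr_sqr /enorm; congr Num.sqrt; rewrite (bigD1 i)//= big1 ?addr0.
  by rewrite tnth_tsub !tnth_setc eqxx.
by move=> j /negbTE ji; rewrite tnth_tsub !tnth_setc ji subrr expr0n.
Qed.

Lemma enorm_eq0 x : (forall i, tnth x i = 0) -> enorm x = 0.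
Proof. by move=> H; rewrite /enorm big1 ?sqrtr0// => i _; rewrite H expr0n. Qed.

(** The vertices of the staircase path from [u] to [x] that changes one coordinate at a time. *)
Definition mix (m : nat) x u : d.-tuple R :=
  [tuple if (i < m)%N then tnth x i else tnth u i | i < d].

Lemma tnth_mix m x u i : tnth (mix m x u) i = if (i < m)%N then tnth x i else tnth u i.
Proof. by rewrite tnth_mktuple. Qed.

Lemma mix0 x u : mix 0 x u = u.
Proof. by apply: eq_from_tnth => i; rewrite tnth_mix. Qed.

Lemma mix_full x u : mix d x u = x.
Proof. by apply: eq_from_tnth => i; rewrite tnth_mix ltn_ord. Qed.

Lemma mix_opencube m x u : inopencube x -> inopencube u -> inopencube (mix m x u).
Proof. by move=> xo uo i; rewrite tnth_mix; case: ifP. Qed.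

Lemma mixS (i : 'I_d) x u : mix i.+1 x u = setc (mix i x u) i (tnth x i).
Proof.
apply: eq_from_tnth => j; rewrite tnth_setc !tnth_mix ltnS leq_eqVlt.
have [->|ji] := eqVneq j i; first by rewrite eqxx.
by rewrite -val_eqE in ji; rewrite (negbTE ji).
Qed.

Lemma mix_setc (i : 'I_d) x u : mix i x u = setc (mix i x u) i (tnth u i).
Proof.
apply: eq_from_tnth => j; rewrite tnth_setc !tnth_mix.
by case: eqP => // ->; rewrite ltnn.
Qed.

(* Bounds on the open cube pass to the closed cube by letting [t] tend to 0. *)
Definition shrink (t : R) c x : d.-tuple R :=
  [tuple tnth x i + t * (tnth c i - tnth x i) | i < d].

Lemma tnth_shrink t c x i :
  tnth (shrink t c x) i = tnth x i + t * (tnth c i - tnth x i).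
Proof. by rewrite tnth_mktuple. Qed.

Lemma shrink_opencube t c x : 0 < t < 1 -> incube x -> inopencube c ->
  inopencube (shrink t c x).
Proof.
move=> /andP[t0 t1] xc co i; rewrite tnth_shrink.
have /andP[x0 x1] := xc i; have /andP[c0 c1] := co i.
apply/andP; split; nra.
Qed.

Lemma cont_shrink (f : d.-tuple R -> R) c x e : cont_on (@incube R d) f ->
  incube x -> inopencube c -> 0 < e ->
  exists2 t0, 0 < t0 & forall t, 0 < t < t0 -> t < 1 -> `|f (shrink t c x) - f x| < e.
Proof.
move=> cf xc co e0; have [del del0 H] := cf x xc e e0.
have d1 : 0 < d%:R + 1 :> R by rewrite ltr_wpDl.
exists (del / (d%:R + 1)); first by rewrite divr_gt0.
move=> t /andP[t0 td] t1; apply: H.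
  by apply: opencube_cube; apply: shrink_opencube => //; rewrite t0.
apply: (@le_lt_trans _ _ (d%:R * t)).
  apply: enorm_le_coord => [|i]; first exact: ltW.
  rewrite tnth_tsub tnth_shrink addrAC subrr add0r normrM gtr0_norm//.
  rewrite -[leRHS]mulr1; apply: ler_wpM2l; first exact: ltW.
  have /andP[x0 x1] := xc i; have /andP[c0 c1] := co i.
  by rewrite ler_norml; apply/andP; split; lra.
by rewrite ltr_pdivlMr// in td; lra.
Qed.

End Points.

(** * Polynomials of bounded total degree *)

Section Polynomials.
Variables (R : realType) (d : nat).

Definition ispoly (D : nat) (p : d.-tuple R -> R) : Prop :=
  exists L : seq (R * {ffun 'I_d -> nat}),
    all (fun c : R * {ffun 'I_d -> nat} => \sum_(i < d) c.2 i <= D)%N L /\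
    forall w, p w = \sum_(c <- L) c.1 * \prod_(i < d) tnth w i ^+ c.2 i.

Lemma ispoly_cst D a : ispoly D (fun=> a).
Proof.
exists [:: (a, [ffun => 0%N])]; split=> [|w]; rewrite ?big_seq1 /=.
  by rewrite big1// => i _; rewrite ffunE.
by rewrite big1 ?mulr1// => i _; rewrite ffunE expr0.
Qed.

Lemma ispolyD D p q : ispoly D p -> ispoly D q -> ispoly D (fun w => p w + q w).
Proof.
move=> [L [Ld Lp]] [L' [Ld' Lq]]; exists (L ++ L'); split; first by rewrite all_cat Ld.
by move=> w; rewrite big_cat /= Lp Lq.
Qed.

Lemma ispoly_sum D n (p : 'I_n -> d.-tuple R -> R) :
  (forall j, ispoly D (p j)) -> ispoly D (fun w => \sum_j p j w).
Proof.
elim: n p => [|n IH] p H.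
  have -> : (fun w => \sum_(j < 0) p j w) = fun=> 0.
    by apply/funext => w; rewrite big_ord0.
  exact: ispoly_cst.
have -> : (fun w => \sum_(j < n.+1) p j w) =
   fun w => p ord0 w + \sum_(j < n) p (lift ord0 j) w.
  by apply/funext => w; rewrite big_ord_recl.
by apply: ispolyD => //; exact: IH.
Qed.

Lemma ispolyM_coord D E p (i : 'I_d) j a : ispoly D p -> (D + j <= E)%N ->
  ispoly E (fun w => p w * (tnth w i ^+ j * a)).
Proof.
move=> [L [Ld Lp]] DE.
exists [seq (c.1 * a, [ffun k => (c.2 k + (k == i) * j)%N])
  | c : R * {ffun 'I_d -> nat} <- L]; split.
  rewrite all_map; apply: sub_all Ld => c /= cD.
  under eq_bigr do rewrite ffunE.
  rewrite big_split /= [X in (_ + X <= _)%N](bigD1 i)//= eqxx mul1n.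
  rewrite [X in (_ + (_ + X))%N]big1 ?addn0; last by move=> k /negbTE ->.
  by apply: leq_trans DE; rewrite leq_add2r.
move=> w; rewrite big_map Lp mulr_suml; apply: eq_bigr => c _ /=.
under [in RHS]eq_bigr do rewrite ffunE exprD.
rewrite big_split /= [X in _ = _ * (_ * X)](bigD1 i)//= eqxx mul1n.
rewrite [X in _ = _ * (_ * (_ * X))]big1 ?mulr1; last first.
  by move=> k /negbTE ->; rewrite mul0n expr0.
ring.
Qed.

(** A monomial of degree [m] is multiplied by the [m]-th power of [1 - t], which differs from [1] by
    at most [m * t]. This is the continuity along rays that carries Taylor bounds to the boundary of
    the cube. *)
Lemma ispoly_shrink D p w : ispoly D p ->
  exists2 c, 0 <= c & forall t, 0 <= t <= 1 ->
    `|p [tuple (1 - t) * tnth w i | i < d] - p w| <= c * t.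
Proof.
move=> [L [_ Lp]]; elim: L p Lp => [|[a s] L IH] p Lp.
  by exists 0 => // t _; rewrite !Lp !big_nil subrr normr0 mul0r.
have [c c0 Hc] := IH _ (fun w => erefl).
exists (`|a * \prod_(i < d) tnth w i ^+ s i| * (\sum_(i < d) s i)%N%:R + c).
  by rewrite addr_ge0// mulr_ge0.
move=> t t01; have := Hc t t01.
rewrite !Lp !big_cons /=; set q := \sum_(c <- L) _; set q' := \sum_(c <- L) _ => Hq.
rewrite mulrDl opprD addrACA; apply: le_trans (ler_normD _ _) _; apply: lerD => //.
have -> : \prod_(i < d) tnth [tuple (1 - t) * tnth w i0 | i0 < d] i ^+ s i =
    (1 - t) ^+ (\sum_(i < d) s i)%N * \prod_(i < d) tnth w i ^+ s i.
  under eq_bigr do rewrite tnth_mktuple exprMn.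
  by rewrite big_split /= -expr_sum.
have -> : a * ((1 - t) ^+ (\sum_(i < d) s i)%N * \prod_(i < d) tnth w i ^+ s i) -
   a * \prod_(i < d) tnth w i ^+ s i =
   (a * \prod_(i < d) tnth w i ^+ s i) * ((1 - t) ^+ (\sum_(i < d) s i)%N - 1) by ring.
rewrite normrM -mulrA; apply: ler_wpM2l => //.
move: t01 => /andP[t0 t1]; elim: (\sum_(i < d) s i)%N => [|n Hn].
  by rewrite expr0 subrr normr0 mul0r.
have -> : (1 - t) ^+ n.+1 - 1 = (1 - t) * ((1 - t) ^+ n - 1) - t by rewrite exprS; ring.
apply: le_trans (ler_normB _ _) _; rewrite normrM (ger0_norm t0) -natr1 mulrDl mul1r.
apply: lerD => //; apply: le_trans Hn; rewrite -[leRHS]mul1r.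
by apply: ler_wpM2r => //; rewrite ger0_norm; lra.
Qed.

End Polynomials.

(** * Multi-indices and sorted lists of coordinates *)

Section MultiIndices.

Lemma mem_multi_indices d l s :
  (s \in multi_indices d l) =
  [&& size s == d, all (fun j => j <= l)%N s & (sumn s <= l)%N].
Proof.
rewrite mem_sort mem_filter andbC; apply/andP/and3P => -[].
  move=> /mapP[t _ ->] H; split=> //; first by rewrite size_map size_tuple.
  by apply/allP => j /mapP[k _ ->]; rewrite -ltnS.
move=> /eqP ss /allP sl H; split=> //.
have szt : size (map (fun j => inord j : 'I_l.+1) s) == d by rewrite size_map ss.
apply/mapP; exists (Tuple szt); first by rewrite mem_enum.
rewrite /= -map_comp -[LHS]map_id; apply/eq_in_map => j js /=.
by rewrite inordK// ltnS sl.
Qed.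

Lemma uniq_multi_indices d l : uniq (multi_indices d l).
Proof.
rewrite sort_uniq filter_uniq// map_inj_uniq ?enum_uniq//.
by move=> s t /inj_map E; apply: val_inj; apply: E; exact: val_inj.
Qed.

(** Both sides are sorted and are permutations of each other. It identifies the derivatives [Dmulti]
    with the derivatives [Dlist] along sorted lists. *)
Lemma sorted_flatten_nseq d (js : seq 'I_d) :
  sorted (fun i j : 'I_d => i <= j)%N js ->
  flatten [seq nseq (count_mem i js) i | i <- enum 'I_d] = js.
Proof.
move=> sjs; apply: (@sorted_eq _ (fun i j : 'I_d => i <= j)%N).
- by move=> x y z; exact: leq_trans.
- by move=> x y; rewrite -eqn_leq => /eqP/val_inj.
- rewrite sorted_pairwise; last by move=> x y z; exact: leq_trans.
  have : pairwise (fun i j : 'I_d => i < j)%N (enum 'I_d).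
    rewrite -sorted_pairwise; last by move=> x y z; exact: ltn_trans.
    have := iota_ltn_sorted 0 d; rewrite -val_enum_ord sorted_map; exact.
  elim: (enum 'I_d) => //= i r IH /andP[ir pr].
  rewrite pairwise_cat IH// andbT; apply/andP; split; last first.
    by elim: (count_mem i js) => //= n ->; rewrite all_nseq leqnn orbT.
  apply/allrelP => x y /nseqP[-> _] /flattenP[zs /mapP[k kr ->]] /nseqP[-> _].
  by apply: ltnW; exact: (allP ir).
- exact: sjs.
- apply/allP => x _ /=; rewrite count_flatten -map_comp sumnE big_map.
  rewrite big_enum /= (bigD1 x)//= count_nseq /= eqxx mul1n.
  by rewrite big1 ?addn0// => i ix; rewrite count_nseq /= (negbTE ix) mul0n.
Qed.

End MultiIndices.

(** * Consequences of the Hölder condition on the open cube *)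

Section Holder.
Variables (R : realType) (d : nat) (beta C : R).
Hypothesis d_gt0 : (0 < d)%N.
Hypothesis beta_gt0 : 0 < beta.
Local Notation k := (floor_lt beta).

Lemma floor_lt_bounds : k%:R < beta <= k%:R + 1.
Proof.
have c1 : (1 <= Num.ceil beta)%R by rewrite -gtz0_ge1 ceil_gt0.
have E : k%:R = (Num.ceil beta - 1)%:~R :> R.
  by rewrite /floor_lt natr_absz ger0_norm// subr_ge0.
by rewrite E -[X in _ <= _ + X]/(1%:~R) -intrD subrK; exact: ceil_itv.
Qed.

Lemma floor_lt_gap : 0 < beta - k%:R.
Proof. by rewrite subr_gt0; case/andP: floor_lt_bounds. Qed.

Lemma Dmulti_sorted (js : seq 'I_d) (f : d.-tuple R -> R) :
  sorted (fun i j : 'I_d => i <= j)%N js -> (size js <= k)%N ->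
  exists s, [/\ s \in multi_indices d k, sumn s = size js &
     Dmulti s f = Dlist js f].
Proof.
move=> sjs szk; exists [seq count_mem i js | i <- enum 'I_d].
have S : sumn [seq count_mem i js | i <- enum 'I_d] = size js.
  rewrite -[in RHS](sorted_flatten_nseq sjs) size_flatten /shape -[in RHS]map_comp.
  by congr sumn; apply: eq_map => i /=; rewrite size_nseq.
split=> //.
  rewrite mem_multi_indices size_map size_enum_ord eqxx S szk andbT /=.
  apply/allP => _ /mapP[i _ ->]; apply: leq_trans szk; exact: count_size.
rewrite /Dmulti; congr (Dlist _ f); rewrite -[RHS](sorted_flatten_nseq sjs).
congr flatten; apply: eq_map => i.
by rewrite (nth_map i) ?nth_ord_enum ?size_enum_ord.
Qed.

Definition cube_center : d.-tuple R := [tuple 2^-1 | i < d].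

Lemma cube_center_open : inopencube cube_center.
Proof. by move=> i; rewrite tnth_mktuple; apply/andP; split; lra. Qed.

(** The bounds [a] and [b] of the Hölder class only satisfy [a + b <= C]; each is at most [C] once
    both are known to be nonnegative. Evaluation at the center of the cube gives the sign of [a],
    and comparison with a point moved by [4^-1] in one coordinate gives that of [b]. *)
Lemma holder_sorted f : holder_class beta C f -> 0 <= C /\
  forall js : seq 'I_d, sorted (fun i j : 'I_d => i <= j)%N js -> (size js <= k)%N ->
  (forall x, inopencube x -> `|Dlist js f x| <= C) /\
  (size js = k -> forall x z, inopencube x -> inopencube z ->
     `|Dlist js f x - Dlist js f z| <= C * enorm (tsub x z) `^ (beta - k%:R)).
Proof.
move=> [_ _ _ [a [b [abC Ha Hb]]]].
have a0 : 0 <= a.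
  have [s [sm _ _]] := @Dmulti_sorted [::] f isT isT.
  exact: le_trans (Ha s sm _ cube_center_open).
have b0 : 0 <= b.
  pose i0 : 'I_d := Ordinal d_gt0; pose js := nseq k i0.
  have sjs : sorted (fun i j : 'I_d => i <= j)%N js.
    by rewrite /js; case: k => //= n; elim: n => //= n ->; rewrite leqnn.
  have [|s [sm ss _]] := Dmulti_sorted f sjs; first by rewrite size_nseq.
  pose z := setc cube_center i0 4^-1.
  have zo : inopencube z.
    by apply: setc_opencube; [exact: cube_center_open|apply/andP; split; lra].
  have E : enorm (tsub cube_center z) = 4^-1.
    rewrite -{1}(setc_id cube_center i0) enorm_setc tnth_mktuple ger0_norm; lra.
  have cz : cube_center != z.
    apply/eqP => cz; move: E; rewrite -cz enorm_eq0 => [|i]; last by rewrite tnth_tsub subrr.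
    by lra.
  have := Hb s sm _ cube_center z cube_center_open zo cz.
  rewrite ss size_nseq E => /(_ erefl) H.
  have p0 : 0 < 4^-1 `^ (beta - k%:R) :> R by rewrite powR_gt0; lra.
  by rewrite -(pmulr_lge0 _ p0); exact: le_trans H.
split; first by lra.
move=> js sjs szk; have [s [sm ss <-]] := Dmulti_sorted f sjs szk; split.
  by move=> x xo; apply: le_trans (Ha s sm x xo) _; lra.
move=> szE x z xo zo; have [->|xz] := eqVneq x z.
  by rewrite subrr normr0 mulr_ge0 ?powR_ge0//; lra.
apply: le_trans (Hb s sm _ x z xo zo xz) _; first by rewrite ss.
by apply: ler_wpM2r; [exact: powR_ge0|lra].
Qed.

End Holder.

(** * Taylor's formula and modulus of continuity on the cube *)

Section MultivariateTaylor.
Variables (R : realType) (d : nat) (beta C : R) (f : d.-tuple R -> R).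
Hypothesis d_gt0 : (0 < d)%N.
Hypothesis beta_gt0 : 0 < beta.
Hypothesis fH : holder_class beta C f.
Local Notation k := (floor_lt beta).

Lemma is_derive_Dlist (js : seq 'I_d) (i : 'I_d) x (s : R) : (size js < k)%N ->
  inopencube x -> 0 < s < 1 ->
  is_derive s 1 (fun t => Dlist js f (setc x i t)) (Dlist (i :: js) f (setc x i s)).
Proof.
move=> szk xo s01; have [_ Hd _ _] := fH.
have zo := setc_opencube i xo s01.
have E : (fun t => Dlist js f (setc (setc x i s) i t)) = fun t => Dlist js f (setc x i t).
  by apply/funext => t; rewrite setc_setc.
have := Hd js szk i _ zo; rewrite E tnth_setc eqxx => H.
apply: DeriveDef => //.
by rewrite /= /pderiv E tnth_setc eqxx derive1E.
Qed.

(** Each further coordinate adds a one-variable remainder, with constant [C], and at most [k.+1]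
    Taylor coefficients, each known only up to the error of the preceding stage. *)
Definition taylor_const (m : nat) : R := iter m (fun c => C + k.+1%:R * c) 0.

Lemma taylor_const_ge0 m : 0 <= C -> 0 <= taylor_const m.
Proof. by move=> C0; elim: m => //= m IH; rewrite addr_ge0// mulr_ge0. Qed.

(* Coordinates are expanded from the last to the first, so that the mixed
   derivatives met are exactly the sorted ones [Dmulti] controls and no
   symmetry of partial derivatives is needed. *)
Lemma taylor_partial u : inopencube u -> forall m, (m <= d)%N ->
  forall js : seq 'I_d, sorted (fun i j : 'I_d => i <= j)%N js ->
  all (fun i : 'I_d => m <= i)%N js -> (size js <= k)%N ->
  exists p, ispoly (k - size js) p /\ forall x, inopencube x ->
   `|Dlist js f (mix m x u) - p (tsub x u)| <=
     taylor_const m * enorm (tsub x u) `^ (beta - (size js)%:R).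
Proof.
move=> uo; have [C0 HC] := holder_sorted d_gt0 fH.
elim=> [|m IH] md js sjs ajs szk.
  exists (fun=> Dlist js f u); split; first exact: ispoly_cst.
  by move=> x xo; rewrite mix0 subrr normr0 mul0r.
pose i0 := Ordinal md; set K := (k - size js)%N.
(* The expansion in coordinate [m] needs derivatives with [j] further copies of [i0]. Putting them
   in front keeps the list sorted because every entry of [js] exceeds [m]. *)
pose jsj j := nseq j i0 ++ js.
have sz j : size (jsj j) = (j + size js)%N by rewrite size_cat size_nseq.
have [p pP] : exists p : nat -> d.-tuple R -> R, forall j, (j < K.+1)%N ->
   ispoly (k - (j + size js)) (p j) /\ forall x, inopencube x ->
   `|Dlist (jsj j) f (mix m x u) - p j (tsub x u)| <=
     taylor_const m * enorm (tsub x u) `^ (beta - (j + size js)%:R).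
  suff /choice[p pP] : forall j, exists p, (j < K.+1)%N ->
   ispoly (k - (j + size js)) p /\ forall x, inopencube x ->
   `|Dlist (jsj j) f (mix m x u) - p (tsub x u)| <=
     taylor_const m * enorm (tsub x u) `^ (beta - (j + size js)%:R) by exists p.
  move=> j; have [jK|jK] := boolP (j < K.+1)%N; last by exists (fun=> 0).
  have [||||p [p1 p2]] := IH _ (jsj j).
  - exact: ltnW.
  - rewrite /jsj; elim: (j) => //= n; case: n => [|n] /=; last by rewrite leqnn.
    move=> _; case: (js) sjs ajs => //= i r -> /andP[mi _].
    by rewrite andbT (leq_trans _ mi).
  - rewrite all_cat all_nseq leqnn orbT /=.
    by apply: sub_all ajs => i; exact: ltnW.
  - by rewrite sz addnC -leq_subRL.
  by exists p => _; rewrite -sz.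
exists (fun w => \sum_(j < K.+1) p j w * (tnth w i0 ^+ j * (j`!%:R)^-1)); split.
  apply: ispoly_sum => j; have [p1 _] := pP j (ltn_ord j).
  apply: ispolyM_coord p1 _.
  by have := ltn_ord j; rewrite ltnS /K => ?; rewrite [(j + size js)%N]addnC subnDA subnK.
move=> x xo.
set E := enorm (tsub x u).
have E0 : 0 <= E by exact: enorm_ge0.
have yo : inopencube (mix m x u) by exact: mix_opencube.
have gap := floor_lt_gap beta_gt0.
have Kk : k%:R = (size js)%:R + K%:R :> R by rewrite -natrD subnKC.
have xuE : `|tnth x i0 - tnth u i0| <= E.
  by rewrite -tnth_tsub; exact: coord_le_enorm.
pose phi j t := Dlist (jsj j) f (setc (mix m x u) i0 t).
have T := @taylor1D R phi K C (beta - k%:R) (tnth u i0) (tnth x i0).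
have {}T : `|Dlist js f (mix m.+1 x u) -
    \sum_(j < K.+1) Dlist (jsj j) f (mix m x u) *
        ((tnth x i0 - tnth u i0) ^+ j / j`!%:R)|
    <= C * `|tnth x i0 - tnth u i0| `^ (beta - k%:R) * `|tnth x i0 - tnth u i0| ^+ K.
  have -> : mix m.+1 x u = setc (mix m x u) i0 (tnth x i0) by exact: (mixS i0).
  have -> : \sum_(j < K.+1) Dlist (jsj j) f (mix m x u) *
        ((tnth x i0 - tnth u i0) ^+ j / j`!%:R) =
     \sum_(j < K.+1) phi j (tnth u i0) * ((tnth x i0 - tnth u i0) ^+ j / j`!%:R).
    by apply: eq_bigr => j _; rewrite /phi -(mix_setc i0).
  apply: T => //; first exact: ltW.
  - move=> j s jK s01; apply: is_derive_Dlist => //.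
    by rewrite sz addnC -ltn_subRL.
  - move=> s s01; rewrite -(enorm_setc (mix m x u) i0 s (tnth u i0)).
    have szK : size (jsj K) = k by rewrite sz subnK.
    apply: (HC (jsj K) _ _).2 => //.
    + rewrite /jsj; elim: (K) => //= n; case: n => [|n] /=; last by rewrite leqnn.
      move=> _; case: (js) sjs ajs => //= i r -> /andP[mi _].
      by rewrite andbT (leq_trans _ mi).
    + by rewrite szK.
    + exact: setc_opencube.
    + by apply: setc_opencube => //; exact: uo.
(* [S] has the true derivatives as coefficients. The distance to [S] is the one-variable remainder;
   the rest comes from replacing these derivatives by the polynomials [p j]. *)
set S := \sum_(j < K.+1) _ in T.
rewrite -(subrKA S); apply: le_trans (ler_normD _ _) _.
rewrite /taylor_const iterS -/(taylor_const m) mulrDl; apply: lerD.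
  apply: (le_trans T); rewrite -mulrA; apply: ler_wpM2l => //.
  have -> : beta - (size js)%:R = beta - k%:R + K%:R by rewrite Kk; ring.
  (* [E] may be zero, so splitting the exponent requires the total exponent to be nonzero; it is
     positive because [k < beta]. *)
  rewrite [E `^ _]powRD; last by apply/implyP => /eqP; rewrite Kk; have := ler0n R K; lra.
  rewrite powR_mulrn//; apply: ler_pM => //.
    by apply: ge0_ler_powR; rewrite ?nnegrE//; exact: ltW.
  by apply: lerXn2r; rewrite ?nnegrE.
rewrite /S -sumrB; apply: le_trans (ler_norm_sum _ _ _) _.
have Cm0 := taylor_const_ge0 m C0.
apply: (@le_trans _ _ (\sum_(j < K.+1) taylor_const m * E `^ (beta - (size js)%:R))).
  apply: ler_sum => j _; have [_ /(_ x xo) p2] := pP j (ltn_ord j).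
  rewrite -tnth_tsub -mulrBl normrM.
  have jk : j%:R + (size js)%:R <= k%:R :> R.
    by rewrite -natrD ler_nat addnC -leq_subRL// -ltnS.
  have -> : beta - (size js)%:R = beta - (j + size js)%:R + j%:R.
    by rewrite natrD; ring.
  rewrite [E `^ _]powRD; last by apply/implyP => /eqP; rewrite natrD; have := ler0n R j; lra.
  rewrite powR_mulrn// mulrA; apply: ler_pM => //.
  rewrite normrM normrX normfV -[leRHS]mulr1; apply: ler_pM => //.
    by apply: lerXn2r; rewrite ?nnegrE ?tnth_tsub.
  rewrite normr_nat invf_le1 ?ltr0n ?fact_gt0//.
  by rewrite ler1n fact_gt0.
rewrite sumr_const card_ord -[leLHS]mulr_natl -mulrA; apply: ler_wpM2r.
  by rewrite mulr_ge0// powR_ge0.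
by rewrite ler_nat ltnS leq_subr.
Qed.

(** The point is shrunk towards [u] itself, which multiplies [x - u] by [1 - t], so the right-hand
    side does not grow while [f] and the polynomial converge. *)
Lemma taylor_cube u : inopencube u ->
  exists p, ispoly k p /\ forall x, incube x ->
   `|f x - p (tsub x u)| <= taylor_const d * enorm (tsub x u) `^ beta.
Proof.
move=> uo; have [C0 _] := holder_sorted d_gt0 fH.
have [p [pp H]] := taylor_partial uo (leqnn d) (js := [::]) isT isT isT.
rewrite subn0 in pp; exists p; split=> // x xc.
have Cd0 := taylor_const_ge0 d C0.
have Ho z : inopencube z ->
    `|f z - p (tsub z u)| <= taylor_const d * enorm (tsub z u) `^ beta.
  by move=> zo; have := H z zo; rewrite mix_full subr0.
have [c c0 Hc] := ispoly_shrink (tsub x u) pp.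
have [cf _ _ _] := fH.
apply/ler_addgt0Pr => e e0.
have e20 : 0 < e / 2 by lra.
have [t0 t00 Ht] := cont_shrink cf xc uo e20.
have c10 : 0 < c + 1 by lra.
pose t := Num.min (t0 / 2) (Num.min (1 / 2) (e / (2 * (c + 1)))).
have t_gt0 : 0 < t by rewrite !lt_min !divr_gt0//; lra.
have tt0 : t < t0 by rewrite gt_min; apply/orP; left; lra.
have t1 : t < 1 by rewrite !gt_min; apply/orP; right; apply/orP; left; lra.
have te : c * t <= e / 2.
  have : t <= e / (2 * (c + 1)) by rewrite !ge_min lexx !orbT.
  rewrite ler_pdivlMr; last by lra.
  by nra.
have zo : inopencube (shrink t u x) by apply: shrink_opencube; rewrite ?t_gt0.
have E : tsub (shrink t u x) u = [tuple (1 - t) * tnth (tsub x u) i | i < d].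
  by apply: eq_from_tnth => i; rewrite tnth_tsub tnth_shrink [RHS]tnth_mktuple tnth_tsub; ring.
have Hz := Ho _ zo; rewrite E in Hz.
have t01 : 0 <= t <= 1 by rewrite !ltW.
have Hp := Hc t t01.
have Hf : `|f (shrink t u x) - f x| < e / 2 by apply: Ht => //; rewrite t_gt0.
have En : enorm [tuple (1 - t) * tnth (tsub x u) i | i < d] <= enorm (tsub x u).
  apply: ler_wsqrtr; apply: ler_sum => i _; rewrite tnth_mktuple exprMn.
  rewrite -[leRHS]mul1r; apply: ler_wpM2r; first exact: sqr_ge0.
  by rewrite exprn_ile1//; lra.
have Ep : enorm [tuple (1 - t) * tnth (tsub x u) i | i < d] `^ beta <= enorm (tsub x u) `^ beta.
  by apply: ge0_ler_powR; rewrite ?nnegrE ?enorm_ge0//; exact: ltW.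
have := ler_wpM2l Cd0 Ep.
set q := p [tuple _ | i < d] in Hp Hz *; set q' := p (tsub x u) in Hp *.
set X := _ * enorm (tsub x u) `^ beta; set Y := _ * _ `^ _ in Hz *.
move=> YX.
have -> : f x - q' = (f x - f (shrink t u x)) + ((f (shrink t u x) - q) + (q - q')) by ring.
have := ler_normD (f x - f (shrink t u x)) ((f (shrink t u x) - q) + (q - q')).
have := ler_normD (f (shrink t u x) - q) (q - q').
rewrite (distrC (f x)); move: Hf Hp Hz te YX; clear; lra.
Qed.

(** If [beta <= 1] then [floor_lt beta] is [0], also at [beta = 1], and the Hölder condition applies
    to [f] directly. If [beta > 1] the first derivatives are bounded by [C], and the mean value
    inequality along the staircase path costs [C] per coordinate, whence the factor [d]. *)
Lemma holder_dist x z : incube x -> incube z ->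
  `|f x - f z| <= d%:R * C * enorm (tsub x z) `^ Num.min 1 beta.
Proof.
have [C0 HC] := holder_sorted d_gt0 fH.
have [cf Hd _ _] := fH.
have d1 : 1 <= d%:R :> R by rewrite ler1n.
have /andP[kb bk] := floor_lt_bounds beta_gt0.
have min0 : 0 < Num.min 1 beta by rewrite lt_min ltr01.
have Ho a b : inopencube a -> inopencube b ->
    `|f a - f b| <= d%:R * C * enorm (tsub a b) `^ Num.min 1 beta.
  move=> ao bo; have [b1|b1] := leP beta 1.
    have k0 : k = 0%N.
      by apply/eqP; rewrite -leqn0 -ltnS -(ltr_nat R) (lt_le_trans kb).
    have [_ /(_ _ a b ao bo)] := HC [::] isT isT.
    rewrite k0 subr0 => /(_ erefl) /le_trans; apply; apply: ler_wpM2r; first exact: powR_ge0.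
    by rewrite -[leLHS]mul1r ler_wpM2r.
  rewrite powRr1 ?enorm_ge0//.
  have k1 : (0 < k)%N.
    by rewrite lt0n; apply/eqP => k0; move: bk; rewrite k0 add0r leNgt b1.
  have step m : (m <= d)%N -> `|f (mix m a b) - f b| <= m%:R * C * enorm (tsub a b).
    elim: m => [|m IH] md; first by rewrite mix0 subrr normr0 !mul0r.
    pose i0 := Ordinal md.
    have mo : inopencube (mix m a b) by exact: mix_opencube.
    have : `|f (mix m.+1 a b) - f (mix m a b)| <= C * enorm (tsub a b).
      have -> : mix m.+1 a b = setc (mix m a b) i0 (tnth a i0) by exact: (mixS i0).
      have E2 : mix m a b = setc (mix m a b) i0 (tnth b i0) by exact: (mix_setc i0).
      rewrite [X in _ - f X]E2.
      have := @derive_bound_dist R (fun t => f (setc (mix m a b) i0 t))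
        (fun t => Dlist [:: i0] f (setc (mix m a b) i0 t)) C (tnth a i0) (tnth b i0) (ao i0) (bo i0).
      move=> H; apply: le_trans (H _ _) _.
      - by move=> s s01; apply: (is_derive_Dlist (js := [::])).
      - move=> s s01 _; apply: (HC [:: i0] isT k1).1; exact: setc_opencube.
      - by apply: ler_wpM2l => //; rewrite -tnth_tsub; exact: coord_le_enorm.
    have := IH (ltnW md); rewrite -natr1 mulrDl mulrDl mul1r => H1 H2.
    have := ler_normD (f (mix m.+1 a b) - f (mix m a b)) (f (mix m a b) - f b).
    by rewrite subrKA; lra.
  by have := step d (leqnn d); rewrite mix_full.
move=> xc zc; apply/ler_addgt0Pr => e e0.
have e20 : 0 < e / 2 by lra.
have co := @cube_center_open R d.
have [t1 t10 H1] := cont_shrink cf xc co e20.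
have [t2 t20 H2] := cont_shrink cf zc co e20.
pose t := Num.min (t1 / 2) (Num.min (1 / 2) (t2 / 2)).
have t_gt0 : 0 < t by rewrite !lt_min !divr_gt0//; lra.
have tt1 : t < t1 by rewrite gt_min; apply/orP; left; lra.
have t_lt1 : t < 1 by rewrite !gt_min; apply/orP; right; apply/orP; left; lra.
have tt2 : t < t2 by rewrite !gt_min; apply/orP; right; apply/orP; right; lra.
have {}H1 : `|f (shrink t (cube_center R d) x) - f x| < e / 2 by apply: H1 => //; rewrite t_gt0.
have {}H2 : `|f (shrink t (cube_center R d) z) - f z| < e / 2 by apply: H2 => //; rewrite t_gt0.
set x' := shrink t _ x in H1; set z' := shrink t _ z in H2.
have xo : inopencube x' by apply: shrink_opencube; rewrite ?t_gt0.
have zo : inopencube z' by apply: shrink_opencube; rewrite ?t_gt0.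
have En : enorm (tsub x' z') <= enorm (tsub x z).
  apply: ler_wsqrtr; apply: ler_sum => i _; rewrite !tnth_tsub !tnth_shrink.
  have -> : tnth x i + t * (tnth (cube_center R d) i - tnth x i) -
    (tnth z i + t * (tnth (cube_center R d) i - tnth z i)) = (1 - t) * (tnth x i - tnth z i) by ring.
  rewrite exprMn -[leRHS]mul1r; apply: ler_wpM2r; first exact: sqr_ge0.
  by rewrite exprn_ile1//; lra.
have Ep : enorm (tsub x' z') `^ Num.min 1 beta <= enorm (tsub x z) `^ Num.min 1 beta.
  by apply: ge0_ler_powR; rewrite ?nnegrE ?enorm_ge0//; exact: ltW.
have dC : 0 <= d%:R * C by rewrite mulr_ge0.
have := ler_wpM2l dC Ep; have := Ho _ _ xo zo.
have := ler_normD (f x - f x') (f x' - f z' + (f z' - f z)).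
have := ler_normD (f x' - f z') (f z' - f z).
rewrite (distrC (f x)) (_ : f x - f x' + (f x' - f z' + (f z' - f z)) = f x - f z); last by ring.
move: H1 H2; clear; lra.
Qed.

(** The bound [C] is available on the open cube; the additional [1] is the continuity tolerance with
    which the boundary is reached. *)
Lemma holder_bound x : incube x -> `|f x| <= C + 1.
Proof.
have [C0 HC] := holder_sorted d_gt0 fH; have [cf _ _ _] := fH.
move=> xc; have [t0 t00 H] := cont_shrink cf xc (@cube_center_open R d) (@ltr01 R).
pose t := Num.min (t0 / 2) (1 / 2).
have t_gt0 : 0 < t by rewrite !lt_min !divr_gt0//; lra.
have tt0 : t < t0 by rewrite gt_min; apply/orP; left; lra.
have t1 : t < 1 by rewrite !gt_min; apply/orP; right; lra.
have := H t; rewrite t_gt0 tt0 => /(_ isT t1) H1.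
have H2 : `|f (shrink t (cube_center R d) x)| <= C.
  apply: (HC [::] isT isT).1; apply: shrink_opencube => //; last exact: cube_center_open.
  by rewrite t_gt0.
have := ler_normB (f (shrink t (cube_center R d) x)) (f (shrink t (cube_center R d) x) - f x).
rewrite (_ : _ - (_ - _) = f x); last by ring.
lra.
Qed.

End MultivariateTaylor.

(** * Coercivity from a tensor grid of cells *)

Section Unisolvence.
Variables (R : realType) (d l : nat) (dlt : R).
Hypothesis dlt_gt0 : 0 < dlt.
Hypothesis dlt_le1 : dlt <= 1.
Local Notation N := (Ndim d l).
Local Notation sidx j := (nth [::] (multi_indices d l) j).
Implicit Types (z : d.-tuple R) (v : 'cV[R]_N).

Lemma sidxP (j : 'I_N) : size (sidx j) = d /\ forall i, (nth 0%N (sidx j) i < l.+1)%N.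
Proof.
have := mem_nth [::] (ltn_ord j); rewrite mem_multi_indices => /and3P[/eqP sz /allP al _].
split=> // i; have [isz|isz] := ltnP i (size (sidx j)).
  by rewrite ltnS; apply: al; exact: mem_nth.
by rewrite nth_default.
Qed.

Lemma Ndim_gt0 : (0 < N)%N.
Proof.
have : nseq d 0%N \in multi_indices d l.
  by rewrite mem_multi_indices size_nseq eqxx all_nseq orbT sumn_nseq mul0n.
by rewrite /Ndim; case: multi_indices.
Qed.

(** The midpoints of the [l.+1] equal subintervals of [[0, dlt]]; a cell of half-width
    [dlt / (2 * l.+1)%:R] around a node stays within that interval. *)
Definition node1 (k : 'I_l.+1) : R := dlt * ((2 * k + 1)%:R / (2 * l.+1)%:R).

Lemma node1_bounds k : dlt / (2 * l.+1)%:R <= node1 k <= dlt - dlt / (2 * l.+1)%:R.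
Proof.
have L0 : 0 < (2 * l.+1)%:R :> R by rewrite ltr0n.
rewrite /node1; apply/andP; split.
  apply: ler_wpM2l; first exact: ltW.
  by rewrite ler_pdivlMr// mulVf ?gt_eqF// ler1n addn1.
rewrite -{2}(mulr1 dlt) -mulrBr; apply: ler_wpM2l; first exact: ltW.
rewrite ler_pdivrMr// mulrBl mul1r mulVf ?gt_eqF// lerBrDr natr1 ler_nat.
by rewrite addn1 -addn2 -mulnSr leq_mul2l /=; exact: ltn_ord.
Qed.

Lemma node1_inj : injective node1.
Proof.
move=> j k; rewrite /node1 => /(mulfI (lt0r_neq0 dlt_gt0)) E.
have {}E := mulIf _ E.
have /E /eqP : (2 * l.+1)%:R^-1 != 0 :> R by rewrite invr_eq0 pnatr_eq0.
by rewrite eqr_nat eqn_add2r eqn_mul2l /= => /eqP /ord_inj.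
Qed.

Definition Vmx : 'M[R]_l.+1 := Vandermonde l.+1 (\row_k node1 k).

Lemma Vmx_unit : Vmx \in unitmx.
Proof.
rewrite unitmxE unitfE /Vmx det_Vandermonde; apply/prodf_neq0 => i _.
apply/prodf_neq0 => j ij; rewrite !mxE subr_eq0; apply/eqP => /node1_inj E.
by rewrite E ltnn in ij.
Qed.

Definition node (sg : 'I_d -> bool) (ka : {ffun 'I_d -> 'I_l.+1}) : d.-tuple R :=
  [tuple (-1) ^+ sg i * node1 (ka i) | i < d].

Lemma tnth_node sg ka i : tnth (node sg ka) i = (-1) ^+ sg i * node1 (ka i).
Proof. by rewrite tnth_mktuple. Qed.

Lemma dotv_Uvec v z : dotv v (Uvec l z) = \sum_j v j 0 * monom (sidx j) z.
Proof. by rewrite dotvE; apply: eq_bigr => j _; rewrite !mxE. Qed.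

Definition dualw (sg : 'I_d -> bool) (j : 'I_N) (ka : {ffun 'I_d -> 'I_l.+1}) : R :=
  \prod_(i < d) (((-1) ^+ sg i) ^+ nth 0%N (sidx j) i
      * invmx Vmx (ka i) (Ordinal ((sidxP j).2 i))).

(* The inverse Vandermonde matrix, tensorised, extracts coefficients. *)
Lemma dualwP sg (j j0 : 'I_N) :
  \sum_ka dualw sg j0 ka * monom (sidx j) (node sg ka) =
  (j == j0)%:R * \prod_(i < d) ((nth 0%N (sidx j0) i)`!%:R)^-1.
Proof.
transitivity (\prod_(i < d) \sum_(k < l.+1)
   ((-1) ^+ sg i) ^+ nth 0%N (sidx j0) i * invmx Vmx k (Ordinal ((sidxP j0).2 i)) *
   (((-1) ^+ sg i * node1 k) ^+ nth 0%N (sidx j) i / ((nth 0%N (sidx j) i)`!%:R))).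
  rewrite bigA_distr_bigA; apply: eq_bigr => ka _.
  by rewrite /dualw /monom -big_split /=; apply: eq_bigr => i _; rewrite tnth_node.
have main (i : 'I_d) : \sum_(k < l.+1)
   ((-1) ^+ sg i) ^+ nth 0%N (sidx j0) i * invmx Vmx k (Ordinal ((sidxP j0).2 i)) *
   (((-1) ^+ sg i * node1 k) ^+ nth 0%N (sidx j) i / ((nth 0%N (sidx j) i)`!%:R)) =
   (nth 0%N (sidx j) i == nth 0%N (sidx j0) i)%:R / ((nth 0%N (sidx j0) i)`!%:R) :> R.
  set e0 := Ordinal ((sidxP j0).2 i); pose e := Ordinal ((sidxP j).2 i).
  have : (Vmx *m invmx Vmx) e e0 = (1%:M : 'M[R]_l.+1) e e0 by rewrite mulmxV// Vmx_unit.
  rewrite !mxE -val_eqE /= => E.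
  transitivity (((-1) ^+ sg i) ^+ nth 0%N (sidx j0) i * ((-1) ^+ sg i) ^+ nth 0%N (sidx j) i
     / ((nth 0%N (sidx j) i)`!%:R) * \sum_(k < l.+1) Vmx e k * invmx Vmx k e0).
    rewrite mulr_sumr; apply: eq_bigr => k _; rewrite !mxE exprMn /=; ring.
  rewrite E; case: eqP => [->|_]; last by rewrite mulr0 mul0r.
  by rewrite mulr1 -exprMn -expr2 sqrr_sign expr1n.
rewrite (eq_bigr _ (fun i _ => main i)) big_split /=; congr (_ * _).
have [->|jj] := eqVneq j j0; first by rewrite big1// => i _; rewrite eqxx.
have : exists i : 'I_d, nth 0%N (sidx j) i != nth 0%N (sidx j0) i.
  apply/existsP; rewrite -negb_forall; apply: contra jj => /forallP H.
  have /eqP : sidx j = sidx j0.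
    apply: (@eq_from_nth _ 0%N); first by rewrite !(sidxP _).1.
    move=> i; rewrite (sidxP j).1 => id; exact: (eqP (H (Ordinal id))).
  by rewrite nth_uniq ?uniq_multi_indices// => /eqP /ord_inj ->.
by move=> [i /negbTE Hi]; rewrite (bigD1 i)//= Hi mul0r.
Qed.

Definition Wmax : R := 1 + \sum_k \sum_e `|invmx Vmx k e|.

Lemma Wmax_ge1 : 1 <= Wmax.
Proof. by rewrite lerDl sumr_ge0// => k _; rewrite sumr_ge0. Qed.

Lemma dualw_le sg j ka : `|dualw sg j ka| <= Wmax ^+ d.
Proof.
rewrite /dualw normr_prod -[in leRHS](card_ord d) -prodr_const.
apply: ler_prod => i _; rewrite normr_ge0 normrM !normrX normrN1 !expr1n mul1r /=.
rewrite /Wmax (bigD1 (ka i))//= (bigD1 (Ordinal ((sidxP j).2 i)))//=.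
set a := `|_|; set s1 := \sum_(_ | _) _; set s2 := \sum_(_ | _) _.
have : 0 <= s1 by apply: sumr_ge0.
have : 0 <= s2 by apply: sumr_ge0 => k _; apply: sumr_ge0.
lra.
Qed.

Definition coefF : R := (Wmax * (l`!)%:R) ^+ d.

Lemma coefF_ge1 : 1 <= coefF.
Proof.
rewrite exprn_ege1// -[leLHS]mulr1; apply: ler_pM; rewrite ?Wmax_ge1//.
by rewrite ler1n fact_gt0.
Qed.

(** The dual weights recover the coefficient divided by the factorials in [Uvec]. Hence the two
    parts of [coefF]: [Wmax] bounds the one-dimensional weights and the factorial of [l] undoes the
    normalisation. *)
Lemma coef_le_nodes sg v j :
  `|v j 0| <= coefF * \sum_ka `|dotv v (Uvec l (node sg ka))|.
Proof.
have E : \sum_ka dualw sg j ka * dotv v (Uvec l (node sg ka)) =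
    v j 0 * \prod_(i < d) ((nth 0%N (sidx j) i)`!%:R)^-1.
  under eq_bigr do rewrite dotv_Uvec mulr_sumr.
  rewrite exchange_big /= (bigD1 j)//= [X in _ + X]big1 => [|j' jj].
    under eq_bigr do rewrite mulrCA.
    by rewrite -mulr_sumr dualwP eqxx mul1r addr0.
  under eq_bigr do rewrite mulrCA.
  by rewrite -mulr_sumr dualwP (negbTE jj) mul0r mulr0.
have -> : v j 0 = \prod_(i < d) ((nth 0%N (sidx j) i)`!%:R) *
    \sum_ka dualw sg j ka * dotv v (Uvec l (node sg ka)).
  rewrite E mulrCA -big_split /= big1 ?mulr1// => i _.
  by rewrite divff// pnatr_eq0 -lt0n fact_gt0.
rewrite normrM /coefF exprMn [_ ^+ d * _]mulrC -mulrA; apply: ler_pM => //.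
  rewrite normr_prod -[in leRHS](card_ord d) -prodr_const.
  apply: ler_prod => i _; rewrite normr_ge0 /= normr_nat ler_nat leq_fact//.
  by rewrite -ltnS (sidxP j).2.
apply: le_trans (ler_norm_sum _ _ _) _; rewrite mulr_sumr; apply: ler_sum => ka _.
by rewrite normrM; apply: ler_wpM2r => //; exact: dualw_le.
Qed.

Lemma dist_prod_le n (a b : 'I_n -> R) e : (forall i, `|a i| <= 1) ->
  (forall i, `|b i| <= 1) -> (forall i, `|a i - b i| <= e) ->
  `|\prod_i a i - \prod_i b i| <= n%:R * e.
Proof.
elim: n a b => [|n IH] a b a1 b1 ab; first by rewrite !big_ord0 subrr normr0 mul0r.
rewrite !big_ord_recl.
set p := \prod_(i < n) _; set q := \prod_(i < n) _.
have -> : a ord0 * p - b ord0 * q = a ord0 * (p - q) + (a ord0 - b ord0) * q by ring.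
apply: le_trans (ler_normD _ _) _; rewrite -natr1 [leRHS]mulrDl mul1r; apply: lerD.
  rewrite normrM -[leRHS]mul1r; apply: ler_pM => //; exact: IH.
rewrite normrM -[leRHS]mulr1; apply: ler_pM => //.
by rewrite normr_prod; apply: prodr_ile1 => i _; rewrite normr_ge0 b1.
Qed.

Lemma dist_expr_le (x y e : R) n : `|x| <= 1 -> `|y| <= 1 -> `|x - y| <= e ->
  `|x ^+ n - y ^+ n| <= n%:R * e.
Proof.
move=> x1 y1 xy; rewrite -[X in _ ^+ X](card_ord n) -[in y ^+ n](card_ord n) -!prodr_const.
exact: dist_prod_le.
Qed.

Lemma monom_le1 (s : seq nat) z : (forall i, `|tnth z i| <= 1) -> `|monom s z| <= 1.
Proof.
move=> z1; rewrite normr_prod; apply: prodr_ile1 => i _; rewrite normr_ge0 /=.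
rewrite normrM normrX normfV normr_nat -[leRHS]mulr1; apply: ler_pM => //.
- by apply: exprn_ile1.
- by rewrite invf_le1 ?ltr0n ?fact_gt0// ler1n fact_gt0.
Qed.

Lemma monom_dist (j : 'I_N) z w e : (forall i, `|tnth z i| <= 1) -> (forall i, `|tnth w i| <= 1) ->
  (forall i, `|tnth z i - tnth w i| <= e) ->
  `|monom (sidx j) z - monom (sidx j) w| <= d%:R * (l%:R * e).
Proof.
move=> z1 w1 H; have [_ sj] := sidxP j.
have q1 (n : nat) (x : R) : `|x| <= 1 -> `|x ^+ n / n`!%:R| <= 1.
  move=> x1; rewrite normrM normrX normfV normr_nat -[leRHS]mulr1; apply: ler_pM => //.
  - by apply: exprn_ile1.
  - by rewrite invf_le1 ?ltr0n ?fact_gt0// ler1n fact_gt0.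
apply: dist_prod_le => [i|i|i]; [exact: q1|exact: q1|].
rewrite -mulrBl normrM normfV normr_nat -[leRHS]mulr1; apply: ler_pM => //.
  apply: le_trans (dist_expr_le _ (z1 i) (w1 i) (H i)) _.
  apply: ler_wpM2r; first exact: le_trans (H i).
  by rewrite ler_nat -ltnS; exact: sj.
by rewrite invf_le1 ?ltr0n ?fact_gt0// ler1n fact_gt0.
Qed.

Lemma sqr_sum_le I (s : seq I) (a : I -> R) :
  (\sum_(i <- s) a i) ^+ 2 <= (size s)%:R * \sum_(i <- s) a i ^+ 2.
Proof.
elim: s => [|i s IH]; first by rewrite !big_nil expr0n mul0r.
rewrite !big_cons /=; set A := \sum_(_ <- _) a _ in IH *; set B := \sum_(_ <- _) _ in IH *.
have B0 : 0 <= B by apply: sumr_ge0 => k _; exact: sqr_ge0.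
rewrite -natr1; set n : R := (size s)%:R in IH *.
have [n0|n0] := eqVneq n 0.
  have A0 : A = 0 by apply/eqP; rewrite -sqrf_eq0 eq_le sqr_ge0 andbT; rewrite n0 mul0r in IH.
  by rewrite A0 n0; nra.
have n_gt0 : 0 < n by rewrite lt_neqAle eq_sym n0 /n ler0n.
have : 0 <= (n * a i - A) ^+ 2 by exact: sqr_ge0.
move=> H.
have H2 : 2 * (a i * A) * n <= (n * a i ^+ 2 + B) * n by nra.
have {}H2 := H2; rewrite ler_pM2r// in H2; nra.
Qed.

Definition incell sg ka e z := [forall i, `|tnth z i - tnth (node sg ka) i| <= e].

Lemma node_le1 sg ka i : `|tnth (node sg ka) i| <= 1 - dlt / (2 * l.+1)%:R.
Proof.
have /andP[a b] := node1_bounds (ka i).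
have p : 0 < dlt / (2 * l.+1)%:R by rewrite divr_gt0// ltr0n.
rewrite tnth_node normrMsign.
move: (node1 _) (dlt / _) a b p => n q a b p.
rewrite ger0_norm; last by apply: le_trans a; exact: ltW.
by apply: (le_trans b); rewrite lerD2r.
Qed.

Lemma incell_le sg ka e z i : e <= dlt / (2 * l.+1)%:R -> incell sg ka e z ->
  0 <= (-1) ^+ sg i * tnth z i <= dlt.
Proof.
move=> el /forallP/(_ i); rewrite tnth_node.
have /andP[a b] := node1_bounds (ka i).
rewrite -(normrMsign (sg i)) mulrBr signrMK ler_norml => /andP[].
move: (node1 _) (dlt / _) a b el (_ * tnth z i) => n q a b el t H1 H2.
by apply/andP; split; lra.
Qed.

(** Moving a point by [e] in each coordinate changes every monomial by at most [d%:R * (l%:R * e)].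
    The factor [N] comes from Cauchy-Schwarz over the [N] monomials, and the [2] from comparing
    squares as in [a^2 <= 2 b^2 + 2 (a - b)^2]. *)
Definition perturb (e : R) : R := 2 * (N%:R * (d%:R * (l%:R * e)) ^+ 2).

Lemma incell_dotv sg ka e z v : 0 <= e -> e <= dlt / (2 * l.+1)%:R -> incell sg ka e z ->
  dotv v (Uvec l (node sg ka)) ^+ 2 <=
    2 * dotv v (Uvec l z) ^+ 2 + perturb e * dotv v v.
Proof.
move=> e0 el zc; have z1 i : `|tnth z i| <= 1.
  have /andP[a b] := incell_le i el zc.
  rewrite -(normrMsign (sg i)) ger0_norm//.
  exact: le_trans b dlt_le1.
have p : 0 < dlt / (2 * l.+1)%:R by rewrite divr_gt0// ltr0n.
have w1 i : `|tnth (node sg ka) i| <= 1.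
  by apply: (le_trans (node_le1 _ _ _)); rewrite gerBl ltW.
set g := dotv v (Uvec l (node sg ka)); set g' := dotv v (Uvec l z).
have H : (g - g') ^+ 2 <= N%:R * (d%:R * (l%:R * e)) ^+ 2 * dotv v v.
  rewrite /g /g' !dotv_Uvec -sumrB.
  apply: le_trans (sqr_sum_le _ _) _.
  rewrite /index_enum -enumT size_enum_ord -[leRHS]mulrA; apply: ler_wpM2l => //.
  rewrite dotvE mulr_sumr big_enum; apply: ler_sum => j _.
  rewrite -mulrBr exprMn -expr2 mulrC; apply: ler_wpM2r; first exact: sqr_ge0.
  rewrite -real_normK ?num_real//; apply: lerXn2r; rewrite ?nnegrE//.
    by rewrite !mulr_ge0.
  by apply: monom_dist => // i; rewrite distrC; exact: (forallP zc i).
rewrite /perturb -mulrA; have := sqr_ge0 (g - 2 * g'); rewrite !expr2 in H *; nra.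
Qed.

Lemma coercive_nodes sg v : dotv v v <=
  N%:R * coefF ^+ 2 * (l.+1 ^ d)%:R * \sum_ka dotv v (Uvec l (node sg ka)) ^+ 2.
Proof.
set S := \sum_ka `|dotv v (Uvec l (node sg ka))|.
have S0 : 0 <= S by apply: sumr_ge0.
have F0 : 0 <= coefF by apply: le_trans coefF_ge1.
have vS : dotv v v <= N%:R * (coefF * S) ^+ 2.
  rewrite dotvE; apply: (@le_trans _ _ (\sum_(j < N) (coefF * S) ^+ 2)).
    apply: ler_sum => j _; rewrite -expr2 -real_normK ?num_real//.
    by apply: lerXn2r; rewrite ?nnegrE ?mulr_ge0//; exact: coef_le_nodes.
  by rewrite sumr_const card_ord mulr_natl.
apply: (le_trans vS); rewrite exprMn mulrA -[leRHS]mulrA; apply: ler_wpM2l.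
  by rewrite mulr_ge0// sqr_ge0.
apply: le_trans (sqr_sum_le _ _) _.
have -> : size (index_enum {ffun 'I_d -> 'I_l.+1}) = (l.+1 ^ d)%N.
  by rewrite /index_enum -enumT -cardE card_ffun !card_ord.
apply: ler_wpM2l => //; apply: ler_sum => ka _.
by rewrite real_normK ?num_real.
Qed.

(** A polynomial is controlled by its values at the nodes; letting each node vary within its cell
    loses a multiple of [perturb e], which is absorbed into the left side for small [e]. The
    constants depend neither on the signs nor on the points, so one pair serves every grid point and
    every sample. *)
Lemma cells_coercive : exists e c : R,
  [/\ 0 < e, e <= dlt / (2 * l.+1)%:R, 0 < c &
  forall sg I (s : seq I) (zf : I -> d.-tuple R) (n0 : R), 0 < n0 ->
  (forall ka, n0 <= (count (fun p => incell sg ka e (zf p)) s)%:R) ->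
  forall v, c * n0 * dotv v v <=
    \sum_(p <- s | [forall i, `|tnth (zf p) i| <= dlt]) dotv v (Uvec l (zf p)) ^+ 2].
Proof.
pose L : R := (l.+1 ^ d)%:R; pose A : R := N%:R * coefF ^+ 2 * L.
have L1 : 1 <= L by rewrite ler1n expn_gt0.
have L0 : 0 < L by exact: lt_le_trans L1.
have A0 : 0 < A.
  have F0 : 0 < coefF by apply: lt_le_trans coefF_ge1.
  apply: mulr_gt0 => //; apply: mulr_gt0; last exact: exprn_gt0.
  by rewrite ltr0n; exact: Ndim_gt0.
set q := dlt / (2 * l.+1)%:R.
have q0 : 0 < q by rewrite divr_gt0// ltr0n.
have q1 : q <= 1.
  rewrite ler_pdivrMr ?ltr0n// mul1r; apply: (le_trans dlt_le1).
  by rewrite ler1n.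
pose B : R := A * L * (N%:R * (d%:R * l%:R) ^+ 2).
have B0 : 0 <= B.
  apply: mulr_ge0; first by rewrite mulr_ge0// ltW.
  by apply: mulr_ge0 => //; exact: sqr_ge0.
(* Chosen so that at [e = q / D] the loss [2 * B * e ^+ 2] is at most one half: [e <= 1] and
   [e * D <= 1] give [4 * B * e <= 1]. *)
pose D := 1 + 4 * B.
have D1 : 1 <= D by rewrite lerDl mulr_ge0.
have D0 : 0 < D by exact: lt_le_trans D1.
have AL0 : 0 < 4 * A * L.
  by apply: mulr_gt0 => //; exact: mulr_gt0.
have e0 : 0 < q / D by rewrite divr_gt0.
have eq : q / D <= q by rewrite ler_pdivrMr// ler_peMr// ltW.
exists (q / D), (4 * A * L)^-1; split; rewrite ?invr_gt0//.
have half : A * L * perturb (q / D) <= 2^-1.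
  have -> : A * L * perturb (q / D) = 2 * B * (q / D) ^+ 2 by rewrite /perturb /B; ring.
  have e1 : q / D <= 1 by exact: le_trans q1.
  have : (q / D) * D <= 1 by rewrite divfK ?gt_eqF.
  rewrite /D mulrDr mulr1 expr2 => H; set e := q / D in e0 e1 H *.
  have : B * e * e <= B * e.
    by rewrite -[leRHS]mulr1; apply: ler_wpM2l => //; rewrite mulr_ge0// ltW.
  rewrite -[2 * B * _]mulrA; have := ltW e0; lra.
move=> sg I s zf n0 n00 Hn v.
set e := q / D in e0 eq half Hn *.
rewrite -mulrA mulrC ler_pdivrMr//.
set S := dotv v v; set T := \sum_(p <- s | _) _.
have S0 : 0 <= S by exact: dotvv_ge0.
set P := perturb e * S.
have cellT ka : n0 * dotv v (Uvec l (node sg ka)) ^+ 2 <= n0 * P + 2 * T.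
  set g := dotv v _ ^+ 2.
  have T0 : 0 <= T by apply: sumr_ge0 => p _; exact: sqr_ge0.
  (* A node value below the perturbation level needs no data. Otherwise each of the at least [n0]
     points in the cell contributes at least [(g - P) / 2] to [T]. *)
  have [gP|Pg] := leP g P.
    by rewrite -[leLHS]addr0; apply: lerD; rewrite ?mulr_ge0// ler_wpM2l// ltW.
  suff : n0 * (g - P) <= 2 * T by lra.
  have gP0 : 0 <= g - P by rewrite subr_ge0 ltW.
  apply: le_trans (ler_wpM2r gP0 (Hn ka)) _.
  rewrite -sum1_count natr_sum mulr_suml mulr_sumr.
  rewrite big_mkcond [leRHS]big_mkcond /=; apply: ler_sum => p _.
  case: (boolP (incell sg ka e (zf p))) => pc; last first.
    by case: ifP => // _; rewrite mulr_ge0// sqr_ge0.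
  have -> : [forall i, `|tnth (zf p) i| <= dlt].
    apply/forallP => i; have /andP[? ?] := incell_le i eq pc.
    by rewrite -(normrMsign (sg i)) ger0_norm.
  rewrite mul1r lerBlDr; exact: (incell_dotv v (ltW e0) eq pc).
have H1 : n0 * S <= A * \sum_(ka : {ffun 'I_d -> 'I_l.+1}) (n0 * P + 2 * T).
  have := coercive_nodes sg v; rewrite -/L -/A => H.
  apply: (@le_trans _ _ (n0 * (A * \sum_ka dotv v (Uvec l (node sg ka)) ^+ 2))).
    by apply: ler_wpM2l => //; exact: ltW.
  rewrite mulrCA; apply: ler_wpM2l; first exact: ltW.
  by rewrite mulr_sumr; apply: ler_sum => ka _; exact: cellT.
rewrite sumr_const card_ffun !card_ord -[_ *+ _]mulr_natl -/L in H1.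
have H2 : n0 * S * (A * L * perturb e) <= n0 * S * 2^-1.
  by apply: ler_wpM2l => //; rewrite mulr_ge0// ltW.
have H3 : A * (L * (n0 * P + 2 * T)) = n0 * S * (A * L * perturb e) + 2 * A * L * T.
  by rewrite /P; ring.
rewrite H3 in H1; rewrite [leRHS]mulrC.
have -> : 4 * A * L * T = 2 * (2 * A * L * T) by ring.
move: H1 H2; set x := n0 * S * (A * L * _); set y := n0 * S; set z := 2 * A * L * T.
by clearbody x y z; lra.
Qed.

End Unisolvence.

(** * Deterministic error bounds for the local estimator *)

Section Estimator.
Variables (R : realType) (d l : nat).
Local Notation N := (Ndim d l).
Local Notation sidx j := (nth [::] (multi_indices d l) j).

Lemma tnth_tscale c (x : d.-tuple R) i : tnth (tscale c x) i = c * tnth x i.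
Proof. by rewrite tnth_mktuple. Qed.

Lemma enorm_tscale c (x : d.-tuple R) : 0 <= c -> enorm (tscale c x) = c * enorm x.
Proof.
move=> c0; rewrite /enorm -[c in RHS]ger0_norm// -sqrtr_sqr -sqrtrM ?sqr_ge0//.
congr Num.sqrt; rewrite mulr_sumr; apply: eq_bigr => i _.
by rewrite tnth_tscale exprMn.
Qed.

Lemma ispoly_Uvec D p (h : R) : ispoly D p -> (D <= l)%N -> 0 < h ->
  exists th : 'cV[R]_N, forall w, p w = dotv th (Uvec l (tscale h^-1 w)).
Proof.
move=> [L [+ Lp]] Dl h0; elim: L p Lp => [|[c s] L IH] p Lp /=.
  by exists 0 => w; rewrite Lp big_nil dotvE big1// => i _; rewrite mxE mul0r.
move=> /andP[sD LD]; have [th Hth] := IH _ (fun w => erefl) LD.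
pose ss := [seq s i | i <- enum 'I_d].
have nss i : nth 0%N ss (nat_of_ord i) = s i.
  by rewrite (nth_map i) ?nth_ord_enum ?size_enum_ord.
have sum_ss : sumn ss = (\sum_i s i)%N by rewrite sumnE big_map big_enum.
have ssm : ss \in multi_indices d l.
  rewrite mem_multi_indices size_map size_enum_ord eqxx /= sum_ss.
  have sl : (\sum_i s i <= l)%N by exact: leq_trans Dl.
  rewrite sl andbT; apply/allP => _ /mapP[i _ ->]; apply: leq_trans sl.
  by rewrite (bigD1 i)//= leq_addr.
have jN : (index ss (multi_indices d l) < N)%N by rewrite index_mem.
pose j := Ordinal jN.
(* [cc] undoes the factorials and the scaling by [h] that [Uvec] introduces at the rescaled
   point. *)
pose cc := c * \prod_(i < d) (h ^+ s i * (s i)`!%:R).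
exists (th + \col_k (cc * (k == j)%:R)) => w.
rewrite Lp big_cons Hth !dotvE addrC.
under [RHS]eq_bigr do rewrite mxE mulrDl.
rewrite big_split /=; congr (_ + _).
rewrite (bigD1 j)//= [X in _ = _ + X]big1 ?addr0; last first.
  by move=> k /negbTE kj; rewrite !mxE kj mulr0 mul0r.
rewrite !mxE eqxx mulr1 nth_index// /cc /monom -mulrA -big_split /=; congr (_ * _).
apply: eq_bigr => i _; rewrite nss tnth_tscale exprMn exprVn.
have h1 : h ^+ s i != 0 by rewrite expf_neq0// gt_eqF.
have f0 : (s i)`!%:R != 0 :> R by rewrite pnatr_eq0 -lt0n fact_gt0.
by field; rewrite h1 f0.
Qed.

Lemma monom_bound (c : R) (s : seq nat) (z : d.-tuple R) : 1 <= c -> (forall i : 'I_d, (nth 0%N s i <= l)%N) ->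
  (forall i, `|tnth z i| <= c) -> `|monom s z| <= (c ^+ l) ^+ d.
Proof.
move=> c1 sl zc; rewrite normr_prod -[in leRHS](card_ord d) -prodr_const.
apply: ler_prod => i _; rewrite normr_ge0 normrM normrX normfV normr_nat /=.
rewrite -[leRHS]mulr1; apply: ler_pM => //.
- apply: (@le_trans _ _ (c ^+ nth 0%N s i)).
    by apply: lerXn2r; rewrite ?nnegrE// (le_trans ler01).
  by apply: ler_weXn2l.
- by rewrite invf_le1 ?ltr0n ?fact_gt0// ler1n fact_gt0.
Qed.

Lemma dotvv_le (v : 'cV[R]_N) c : (forall j, `|v j 0| <= c) -> dotv v v <= (N%:R * c) ^+ 2.
Proof.
move=> vc; have c0 : 0 <= c by apply: le_trans (vc (Ordinal (Ndim_gt0 d l))).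
rewrite dotvE; apply: (@le_trans _ _ (\sum_(j < N) c ^+ 2)).
  apply: ler_sum => j _; rewrite -expr2 -real_normK ?num_real//.
  by apply: lerXn2r; rewrite ?nnegrE.
rewrite sumr_const card_ord -[leLHS]mulr_natl exprMn; apply: ler_wpM2r; first exact: sqr_ge0.
by rewrite -natrX ler_nat leq_pmull// Ndim_gt0.
Qed.

Lemma dotvv_le_sum (v : 'cV[R]_N) : dotv v v <= (\sum_j `|v j 0|) ^+ 2.
Proof.
rewrite dotvE expr2 mulr_suml; apply: ler_sum => j _.
apply: le_trans (ler_norm _) _; rewrite normrM; apply: ler_wpM2l => //.
by rewrite (bigD1 j)//= lerDl sumr_ge0.
Qed.

Variables (h tau : R) (K : d.-tuple R -> R) (Z : seq (d.-tuple R * R)) (u : d.-tuple R).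
Variables (Kmin Kmax Delta : R).
Hypothesis h0 : 0 < h.
Hypothesis Z0 : (0 < size Z)%N.
Hypothesis Kmin0 : 0 < Kmin.
Hypothesis Kmax0 : 0 < Kmax.
Hypothesis KP : forall w, (if enorm w <= Delta then Kmin else 0) <= K w /\
              K w <= (if enorm w <= 1 then Kmax else 0).

Definition zpt (p : d.-tuple R * R) := tscale h^-1 (tsub p.1 u).
Definition mass : R := (size Z)%:R * h ^+ d.

Lemma mass_gt0 : 0 < mass.
Proof. by rewrite mulr_gt0 ?ltr0n ?exprn_gt0. Qed.

Lemma K_ge0 w : 0 <= K w.
Proof. by have [+ _] := KP w; apply: le_trans; case: ifP => // _; exact: ltW. Qed.

Lemma K_le w : K w <= Kmax.
Proof. by have [_ H] := KP w; apply: (le_trans H); case: ifP => // _; exact: ltW. Qed.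

Lemma K_eq0 w : ~~ (enorm w <= 1) -> K w = 0.
Proof.
move=> /negbTE H; have [_] := KP w; rewrite H => K0.
by apply/eqP; rewrite eq_le K0 K_ge0.
Qed.

Lemma BmatE : Bmat l h K Z u = mass^-1 *:
  \sum_(p <- Z) (K (zpt p) *: (Uvec l (zpt p) *m (Uvec l (zpt p))^T)).
Proof. by []. Qed.

Lemma qf_sum I (s : seq I) (F : I -> 'M[R]_N) v w :
  qf (\sum_(i <- s) F i) v w = \sum_(i <- s) qf (F i) v w.
Proof.
elim: s => [|i s IH]; last by rewrite !big_cons qfDm IH.
by rewrite !big_nil /qf mulmx0 mul0mx mxE.
Qed.

Lemma qf_outer (w v v' : 'cV[R]_N) : qf (w *m w^T) v v' = dotv v w * dotv v' w.
Proof.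
rewrite /qf mulmxA -mulmxA mxE big_ord1; congr (_ * _).
exact: (dotvC w v').
Qed.

Lemma qf_Bmat v w : qf (Bmat l h K Z u) v w = mass^-1 *
  \sum_(p <- Z) K (zpt p) * (dotv v (Uvec l (zpt p)) * dotv w (Uvec l (zpt p))).
Proof.
rewrite BmatE qfZm qf_sum; congr (_ * _).
by apply: eq_bigr => p _; rewrite qfZm qf_outer.
Qed.

Lemma psd_Bmat : psd (Bmat l h K Z u).
Proof.
split.
  rewrite BmatE linearZ linear_sum /=; congr (_ *: _); apply: eq_bigr => p _.
  by rewrite linearZ /= trmx_mul trmxK.
move=> v; rewrite qf_Bmat mulr_ge0 ?invr_ge0 ?(ltW mass_gt0)//.
by apply: sumr_ge0 => p _; rewrite mulr_ge0 ?K_ge0// -expr2 sqr_ge0.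
Qed.

Lemma Btilde_good c0 : tau <= c0 ->
  (forall v, c0 * dotv v v <= qf (Bmat l h K Z u) v v) ->
  Btilde l h tau K Z u = Bmat l h K Z u.
Proof.
move=> tc H; rewrite /Btilde ltNge (le_trans tc) ?addr0//.
exact: (lambda_min_ge (Ndim_gt0 d l) psd_Bmat H).
Qed.

(** Either [tau] times the identity is added to a positive semidefinite matrix, or nothing is added
    because the smallest eigenvalue already reaches [tau]. *)
Lemma Btilde_coercive v : 0 < tau ->
  tau * dotv v v <= qf (Btilde l h tau K Z u) v v.
Proof.
move=> tau0; rewrite /Btilde; case: ifPn => [_|].
  rewrite qfDm -scalemx1 qfZm qf1 -[leLHS]add0r lerD2r; exact: psd_Bmat.2.
rewrite -leNgt addr0 => H.
apply: le_trans (lambda_min_qf v (Ndim_gt0 d l) psd_Bmat).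
by apply: ler_wpM2r => //; exact: dotvv_ge0.
Qed.

(** With no design point in the ball all kernel weights vanish, and so does the Gram matrix,
    contrary to coercivity. This excludes the default value [0] of [ftilde]. *)
Lemma nball_gt0 c0 : 0 < c0 ->
  (forall v, c0 * dotv v v <= qf (Bmat l h K Z u) v v) -> (0 < nball h Z u)%N.
Proof.
move=> c00 H; rewrite /nball -has_count; apply: contraT => /hasPn Hn.
pose j0 := Ordinal (Ndim_gt0 d l); pose e0 : 'cV[R]_N := delta_mx j0 0.
have e00 : e0 != 0.
  by apply/eqP => /matrixP/(_ j0 0)/eqP; rewrite !mxE !eqxx/= oner_eq0.
have := H e0; rewrite qf_Bmat big1_seq ?mulr0.
  by rewrite pmulr_rle0// leNgt dotvv_gt0 e00.
move=> p /= pZ; rewrite K_eq0 ?mul0r//.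
have -> : enorm (zpt p) = h^-1 * enorm (tsub p.1 u).
  by rewrite enorm_tscale// invr_ge0 ltW.
apply: contra (Hn p pZ) => /= H1; apply/asboolP; rewrite /inball.
by move: H1; rewrite mulrC ler_pdivrMr// mul1r.
Qed.

Variable f : d.-tuple R -> R.

Definition noise (p : d.-tuple R * R) := p.2 - f p.1.
Definition score (j : 'I_N) := mass^-1 * \sum_(p <- Z) noise p * K (zpt p) * monom (sidx j) (zpt p).
(** The box circumscribed about the ball is counted in place of the ball, since boxes have an
    explicit volume under [intRd]. *)
Definition nbox : R := (count (fun p => inbox [tuple tnth u i - h | i < d]
    [tuple tnth u i + h | i < d] p.1) Z)%:R.

Lemma zpt_inbox p : enorm (zpt p) <= 1 ->
  inbox [tuple tnth u i - h | i < d] [tuple tnth u i + h | i < d] p.1.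
Proof.
move=> H; apply/forallP => i; rewrite !tnth_mktuple.
have := le_trans (coord_le_enorm (zpt p) i) H.
rewrite tnth_tscale tnth_tsub normrM gtr0_norm ?invr_gt0// mulrC ler_pdivrMr// mul1r.
by rewrite ler_norml => /andP[? ?]; apply/andP; split; lra.
Qed.

Lemma monom_sidx_le1 (j : 'I_N) p : enorm (zpt p) <= 1 -> `|monom (sidx j) (zpt p)| <= 1.
Proof. by move=> H; apply: monom_le1 => i; exact: le_trans (coord_le_enorm _ _) H. Qed.

Lemma avecE j : avec l h K Z u j 0 =
  mass^-1 * \sum_(p <- Z) p.2 * K (zpt p) * monom (sidx j) (zpt p).
Proof.
rewrite /avec mxE summxE; congr (_ * _); apply: eq_bigr => p _.
by rewrite !mxE.
Qed.

Lemma BmatM j (th : 'cV[R]_N) : (Bmat l h K Z u *m th) j 0 =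
  mass^-1 * \sum_(p <- Z) dotv th (Uvec l (zpt p)) * K (zpt p) * monom (sidx j) (zpt p).
Proof.
rewrite BmatE -scalemxAl mxE mulmx_suml summxE; congr (_ * _); apply: eq_bigr => p _.
rewrite -scalemxAl mxE -mulmxA mxE big_ord1 !mxE /=.
have -> : \sum_j (Uvec l (zpt p))^T 0 j * th j 0 = dotv th (Uvec l (zpt p)).
  by rewrite dotvE; apply: eq_bigr => i _; rewrite mxE mulrC.
ring.
Qed.

Lemma normr_le_sqr (x c : R) : 0 <= c -> x ^+ 2 <= c ^+ 2 -> `|x| <= c.
Proof. by move=> c0 H; rewrite -[leRHS]ger0_norm// -ler_sqr ?nnegrE// !real_normK ?num_real. Qed.

Lemma invmx_bound (B : 'M[R]_N) (c c3 : R) x (a : 'cV[R]_N) : 0 < c -> 1 <= c3 ->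
  (forall v, c * dotv v v <= qf B v v) ->
  (forall i, `|tnth (tscale h^-1 (tsub x u)) i| <= c3) ->
  `|((Uvec l (tscale h^-1 (tsub x u)))^T *m invmx B *m a) 0 0| <=
   c^-1 * (N%:R * (c3 ^+ l) ^+ d) * \sum_j `|a j 0|.
Proof.
move=> c0 c31 HB Hx; have s0 : 0 <= \sum_j `|a j 0| by apply: sumr_ge0.
have c30 : 0 <= c3 by exact: le_trans c31.
apply: normr_le_sqr.
  by rewrite !mulr_ge0 ?invr_ge0 ?(ltW c0)// !exprn_ge0.
apply: le_trans (coercive_invmx_bound _ _ c0 HB) _.
rewrite !exprMn exprVn -[leRHS]mulrA [leRHS]mulrC; apply: ler_wpM2r.
  by rewrite invr_ge0 exprn_ge0// ltW.
apply: ler_pM; rewrite ?dotvv_ge0//.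
  rewrite -!exprMn; apply: dotvv_le => j; rewrite mxE; apply: monom_bound => // i.
  by rewrite -ltnS; exact: (sidxP j).2.
exact: dotvv_le_sum.
Qed.

(** Local polynomial estimators reproduce polynomials: [Bmat *m th] is what [avec] would be if the
    responses were the values of [p]. The error is thus the inverse Gram matrix applied to
    [avec - Bmat *m th], whose entries are a kernel-weighted Taylor residual plus a score. *)
Lemma ftilde_good (c0 c3 eta : R) p x : 0 < c0 -> tau <= c0 -> 1 <= c3 ->
  (forall v, c0 * dotv v v <= qf (Bmat l h K Z u) v v) ->
  ispoly l p -> 0 <= eta ->
  (forall q, q \in Z -> enorm (zpt q) <= 1 -> `|f q.1 - p (tsub q.1 u)| <= eta) ->
  (forall i, `|tnth (tscale h^-1 (tsub x u)) i| <= c3) ->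
  `|ftilde l h tau K Z u x - p (tsub x u)| <=
   c0^-1 * (N%:R * (c3 ^+ l) ^+ d) * \sum_j (eta * Kmax * (mass^-1 * nbox) + `|score j|).
Proof.
move=> c00 tc c31 HB pp eta0 Heta Hx.
have [th Hth] := ispoly_Uvec pp (leqnn l) h0.
rewrite /ftilde (nball_gt0 c00 HB) (Btilde_good tc HB) Hth.
set B := Bmat l h K Z u in HB *; set U := Uvec l _.
have -> : dotv th U = (U^T *m invmx B *m (B *m th)) 0 0.
  rewrite -mulmxA mulKmx; last exact: coercive_unitmx c00 HB.
  exact: dotvC.
have -> : (U^T *m invmx B *m avec l h K Z u) 0 0 - (U^T *m invmx B *m (B *m th)) 0 0 =
  (U^T *m invmx B *m (avec l h K Z u - B *m th)) 0 0.
  by rewrite mulmxBr [RHS]mxE [X in _ = _ + X]mxE.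
apply: le_trans (invmx_bound _ c00 c31 HB Hx) _.
apply: ler_wpM2l.
  by rewrite !mulr_ge0 ?invr_ge0 ?(ltW c00)// !exprn_ge0// (le_trans ler01).
apply: ler_sum => j _.
have -> : (avec l h K Z u - B *m th) j 0 = mass^-1 * (\sum_(q <- Z)
     (f q.1 - p (tsub q.1 u)) * K (zpt q) * monom (sidx j) (zpt q)) + score j.
  rewrite mxE [X in _ + X]mxE avecE BmatM /score -mulrBr -mulrDr; congr (_ * _).
  rewrite -sumrB -big_split /=; apply: eq_bigr => q _; rewrite Hth /noise; ring.
apply: le_trans (ler_normD _ _) _; rewrite lerD2r.
have m0 := mass_gt0.
rewrite normrM normfV (gtr0_norm m0) [leRHS]mulrCA; apply: ler_wpM2l; first by rewrite invr_ge0 ltW.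
apply: le_trans (ler_norm_sum _ _ _) _.
rewrite /nbox -sum1_count natr_sum mulr_sumr [leRHS]big_mkcond /=.
rewrite big_seq [leRHS]big_seq; apply: ler_sum => q qZ.
have [q1|q1] := boolP (enorm (zpt q) <= 1); last first.
  by rewrite K_eq0// mulr0 mul0r normr0; case: ifP => // _; rewrite mulr1 mulr_ge0// ltW.
rewrite zpt_inbox// mulr1 !normrM (ger0_norm (K_ge0 _)) -[leRHS]mulr1.
apply: ler_pM => //; [exact: mulr_ge0 (K_ge0 _)| |exact: monom_sidx_le1].
by apply: ler_pM => //; [exact: K_ge0|exact: Heta|exact: K_le].
Qed.

(** Holds for every sample with bounded regression values, whatever the Gram matrix, at the price of
    [tau^-1] and of the average absolute noise; it is the bound for the bad event. *)
Lemma ftilde_bound (c3 Cf : R) x : 0 < tau -> 1 <= c3 ->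
  (forall q, q \in Z -> `|f q.1| <= Cf) ->
  (forall i, `|tnth (tscale h^-1 (tsub x u)) i| <= c3) ->
  `|ftilde l h tau K Z u x| <=
   tau^-1 * (N%:R * (c3 ^+ l) ^+ d) * (N%:R * (Kmax * (h ^+ d)^-1 *
     (Cf + (size Z)%:R^-1 * \sum_(q <- Z) `|noise q|))).
Proof.
move=> tau0 c31 Hf Hx.
have n0 : 0 < (size Z)%:R :> R by rewrite ltr0n.
have hd0 : 0 < h ^+ d by rewrite exprn_gt0.
have Cf0 : 0 <= Cf.
  by case: (Z) Z0 Hf => // q Z' _ H; apply: le_trans (H q _); rewrite ?inE ?eqxx.
have sum0 : 0 <= \sum_(q <- Z) `|noise q| by apply: sumr_ge0.
have pre0 : 0 <= tau^-1 * (N%:R * (c3 ^+ l) ^+ d).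
  by rewrite !mulr_ge0 ?invr_ge0 ?(ltW tau0)// !exprn_ge0// (le_trans ler01).
rewrite /ftilde; case: ifP => _; last first.
  rewrite normr0 mulr_ge0// mulr_ge0// mulr_ge0//.
    by rewrite mulr_ge0 ?invr_ge0 ?ltW.
  by rewrite addr_ge0// mulr_ge0// invr_ge0 ltW.
apply: le_trans (invmx_bound _ tau0 c31 (fun v => Btilde_coercive v tau0) Hx) _.
apply: ler_wpM2l => //.
rewrite mulr_natl -[X in _ *+ X](card_ord N) -sumr_const; apply: ler_sum => j _.
rewrite avecE normrM normfV (gtr0_norm mass_gt0) /mass invfM.
have -> : Kmax * (h ^+ d)^-1 * (Cf + (size Z)%:R^-1 * \sum_(q <- Z) `|noise q|) =
  (size Z)%:R^-1 / h ^+ d * (\sum_(q <- Z) Kmax * (Cf + `|noise q|)).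
  rewrite -mulr_sumr big_split /= big_const_seq count_predT iter_addr_0 -mulr_natl.
  by field; rewrite !gt_eqF.
apply: ler_wpM2l; first by rewrite mulr_ge0 ?invr_ge0 ?ltW.
apply: le_trans (ler_norm_sum _ _ _) _; rewrite big_seq [leRHS]big_seq; apply: ler_sum => q qZ.
have [q1|q1] := boolP (enorm (zpt q) <= 1); last first.
  by rewrite K_eq0// mulr0 mul0r normr0 mulr_ge0 ?addr_ge0// ltW.
rewrite !normrM (ger0_norm (K_ge0 _)) -[leRHS]mulr1.
apply: ler_pM => //; [exact: mulr_ge0 (K_ge0 _)| |exact: monom_sidx_le1].
rewrite mulrC; apply: ler_pM => //; [exact: K_ge0|exact: K_le|].
have := ler_normD (f q.1) (noise q); rewrite /noise addrC subrK.
by have := Hf q qZ; move: (`|q.2|) (`|f q.1|) (`|q.2 - f q.1|) => a b c; lra.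
Qed.

(** The condition [d%:R * dlt <= Delta] places the box of points with all coordinates at most [dlt]
    in the ball where [K] is at least [Kmin]; points outside the box contribute nonnegative
    terms. *)
Lemma cells_Bmat (dlt e c n0 : R) sg : 0 < c -> 0 < n0 ->
  d%:R * dlt <= Delta ->
  (forall I (s : seq I) (zf : I -> d.-tuple R) (n0 : R), 0 < n0 ->
  (forall ka : {ffun 'I_d -> 'I_l.+1},
     n0 <= (count (fun p => incell dlt sg ka e (zf p)) s)%:R) ->
  forall v, c * n0 * dotv v v <=
    \sum_(p <- s | [forall i, `|tnth (zf p) i| <= dlt]) dotv v (Uvec l (zf p)) ^+ 2) ->
  (forall ka : {ffun 'I_d -> 'I_l.+1}, n0 <= (count (fun p => incell dlt sg ka e (zpt p)) Z)%:R) ->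
  forall v, Kmin * c * (mass^-1 * n0) * dotv v v <= qf (Bmat l h K Z u) v v.
Proof.
move=> c0 n00 dD Hc Hka v; have := Hc _ Z zpt n0 n00 Hka v => H.
have m0 := mass_gt0.
rewrite qf_Bmat (_ : Kmin * c * _ * _ = mass^-1 * (Kmin * (c * n0 * dotv v v))); last by ring.
apply: ler_wpM2l; first by rewrite invr_ge0 ltW.
apply: le_trans (ler_wpM2l (ltW Kmin0) H) _.
rewrite mulr_sumr big_mkcond /=; apply: ler_sum => p _; rewrite -expr2.
case: ifP => [/forallP Hp|_]; last by rewrite mulr_ge0 ?K_ge0 ?sqr_ge0.
apply: ler_wpM2r; first exact: sqr_ge0.
have [+ _] := KP (zpt p); rewrite ifT//; apply: le_trans dD.
case: (posnP d) => [d0|d0].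
  rewrite enorm_eq0 => [|i]; first by rewrite {1}d0 mul0r.
  by move: (ltn_ord i); rewrite {2}d0.
by apply: enorm_le_coord => //; apply: le_trans (Hp (Ordinal d0)).
Qed.

End Estimator.

(** * Elementary inequalities for exponentials and powers *)

Section ExpInequalities.
Variable R : realType.

Lemma expR_sub1_le (a : R) : expR a - 1 <= a * expR a.
Proof.
have := expR_ge1Dx (- a); rewrite expRN => H.
have e0 := expR_gt0 a.
have : (1 - a) * expR a <= 1 by rewrite -ler_pdivlMr// div1r.
by rewrite mulrBl mul1r; lra.
Qed.

Lemma bernoulli_le (e : R) n : 1 <= e -> n%:R * (e - 1) <= e ^+ n - 1.
Proof.
move=> e1; elim: n => [|n IH]; first by rewrite mul0r expr0 subrr.
rewrite exprS -natr1 mulrDl mul1r.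
have : 0 <= n%:R * (e - 1) by rewrite mulr_ge0// subr_ge0.
by move: IH; set a := n%:R * _; set b := e ^+ n; nra.
Qed.

(** Bernoulli's inequality for the [n]-th power of [expR (n%:R^-1 * x)]. It shows that a tilt of
    size [n%:R^-1] changes one factor by [O(1/n)] only. *)
Lemma expR_div_nat_le (x : R) n : 0 <= x -> (0 < n)%N ->
  expR (n%:R^-1 * x) <= 1 + n%:R^-1 * expR x.
Proof.
move=> x0 n0; have m0 : 0 < n%:R :> R by rewrite ltr0n.
set y := n%:R^-1 * x.
have xE : x = n%:R * y by rewrite /y mulrA divff ?mul1r ?gt_eqF.
have y0 : 0 <= y by rewrite mulr_ge0// invr_ge0 ltW.
have e1 : 1 <= expR y by rewrite -expR0 ler_expR.
rewrite [X in _ + _ * expR X]xE expRM_natl -lerBlDl mulrC ler_pdivlMr// mulrC.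
by apply: le_trans (bernoulli_le n e1) _; rewrite gerBl.
Qed.

(** Apply [ln y <= y - 1] at [y = x / p]; the constant is [p] to the power [p]. *)
Lemma powR_le_expR (p : R) : 0 < p -> exists2 C, 0 < C & forall x, 0 <= x -> x `^ p <= C * expR x.
Proof.
move=> p0; exists (expR (p * ln p)); first exact: expR_gt0.
move=> x; rewrite le_eqVlt => /orP[/eqP <-|x0].
  by rewrite powR0 ?gt_eqF// mulr_ge0 ?expR_ge0.
rewrite /powR gt_eqF// -expRD ler_expR.
have xp : 0 < x / p by rewrite divr_gt0.
have H : ln (x / p) <= x / p - 1.
  rewrite -[X in ln X](addrNK 1) addrC; apply: le_ln1Dx.
  by rewrite ltrBrDr addrC subrr.
rewrite ln_div ?posrE// in H.
have := ler_wpM2l (ltW p0) H; rewrite mulrBr mulrBr mulr1 mulrCA divff ?gt_eqF// mulr1; lra.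
Qed.

(** Every term is at most the [p]-th root of the sum of the [p]-th powers, an argument valid for all
    [p > 0], convex or not. *)
Lemma powR_sum_le I (s : seq I) (a : I -> R) (p : R) : 0 < p -> (forall i, 0 <= a i) ->
  (\sum_(i <- s) a i) `^ p <= (size s)%:R `^ p * \sum_(i <- s) a i `^ p.
Proof.
move=> p0 a0; set T := \sum_(i <- s) a i `^ p.
have T0 : 0 <= T by apply: sumr_ge0 => i _; exact: powR_ge0.
have H : \sum_(i <- s) a i <= (size s)%:R * T `^ p^-1.
  have le i (s' : seq I) : a i `^ p <= \sum_(k <- i :: s') a k `^ p.
    by rewrite big_cons lerDl sumr_ge0// => k _; exact: powR_ge0.
  have root i T' : a i `^ p <= T' -> a i <= T' `^ p^-1.
    move=> H; have -> : a i = (a i `^ p) `^ p^-1.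
      by rewrite -powRrM divff ?gt_eqF// powRr1.
    apply: ge0_ler_powR => //; rewrite ?nnegrE ?powR_ge0//; first by rewrite invr_ge0 ltW.
    by apply: le_trans H; exact: powR_ge0.
  rewrite /T; elim: s {T T0} => [|i s IH]; first by rewrite big_nil mul0r.
  rewrite big_cons /= -natr1 mulrDl mul1r addrC; apply: lerD.
    apply: (le_trans IH); apply: ler_wpM2l => //; apply: ge0_ler_powR.
    - by rewrite invr_ge0 ltW.
    - by rewrite nnegrE sumr_ge0// => k _; exact: powR_ge0.
    - by rewrite nnegrE sumr_ge0// => k _; exact: powR_ge0.
    - by rewrite big_cons lerDr powR_ge0.
  by apply: root; exact: le.
have s0 : 0 <= \sum_(i <- s) a i by apply: sumr_ge0.
apply: (@le_trans _ _ (((size s)%:R * T `^ p^-1) `^ p)).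
  by apply: ge0_ler_powR => //; rewrite ?nnegrE ?mulr_ge0 ?powR_ge0// ltW.
rewrite powRM ?powR_ge0// -powRrM mulVf ?gt_eqF// powRr1//.
Qed.

Lemma exprn_le_expR (x : R) n : 0 <= 1 + x -> (1 + x) ^+ n <= expR (n%:R * x).
Proof.
move=> x0; rewrite expRM_natl; apply: lerXn2r; rewrite ?nnegrE ?expR_ge0//.
exact: expR_ge1Dx.
Qed.

End ExpInequalities.

(** * Single-observation factors and their means *)

Section Factors.
Variables (R : realType) (d : nat) (mu : d.-tuple R -> R).
Variables (kappa : R.-pker (d.-tuple R) ~> R) (f : d.-tuple R -> R).
Variables (mumin mumax sigma : R).
Hypothesis mmu : measurable_fun [set: d.-tuple R] mu.
Hypothesis mu_out : forall x, ~ incube x -> mu x = 0.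
Hypothesis mumin0 : 0 < mumin.
Hypothesis mu_in : forall x, incube x -> mumin < mu x < mumax.
Hypothesis mu_prob : intRd (fun x => (mu x)%:E) = 1%E.
Hypothesis subgauss : forall x, incube x -> forall t : R,
  (\int[kappa x]_(y in [set: R]) (expR (t * (y - f x)))%:E
           <= (expR (t ^+ 2 * sigma ^+ 2 / 2))%:E)%E.

Lemma mu_ge0 x : 0 <= mu x.
Proof.
have [/mu_in /andP[+ _]|/mu_out ->//] := pselect (incube x).
by move=> /ltW; apply: le_trans; exact: ltW.
Qed.

Lemma mumax_ge0 : 0 <= mumax.
Proof.
have c0 : incube (@cube_center R d) by apply: opencube_cube; exact: cube_center_open.
by have /andP[a b] := mu_in c0; apply: ltW (lt_trans mumin0 (lt_trans a b)).
Qed.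

Lemma mu_le x : incube x -> mu x <= mumax.
Proof. by move=> /mu_in /andP[_ /ltW]. Qed.

Lemma mu_ge x : incube x -> mumin <= mu x.
Proof. by move=> /mu_in /andP[/ltW]. Qed.

Lemma measurable_affine_inbox (A c : R) a b :
  measurable_fun [set: d.-tuple R] (fun x => A * (1 + c * (inbox a b x)%:R)).
Proof.
apply: measurable_funM; first exact: measurable_cst.
apply: measurable_funD; first exact: measurable_cst.
by apply: measurable_funM; [exact: measurable_cst|exact: measurable_inbox].
Qed.

(** The conditional means of all factors below are dominated by an affine function of one box
    indicator. This supplies the measurable majorant required by [tame_factor]; the condition
    [-1 <= c] keeps it nonnegative. *)
Lemma tame_factor_box (g : d.-tuple R * R -> R) (A c rho : R) a b :
  (forall z, 0 <= g z) -> 0 <= A -> -1 <= c ->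
  (forall x, incube x -> measurable_fun [set: R] (fun y => g (x, y)) /\
    (\int[kappa x]_(y in [set: R]) (g (x, y))%:E <= (A * (1 + c * (inbox a b x)%:R))%:E)%E) ->
  (intRd (fun x => (mu x * (1 + c * (inbox a b x)%:R))%:E) <= rho%:E)%E ->
  tame_factor mu kappa g (A * rho).
Proof.
move=> g0 A0 c1 gP Hrho; split=> //.
have B0 x : 0 <= 1 + c * (inbox a b x)%:R by case: inbox; rewrite ?mulr1 ?mulr0; lra.
exists (fun x => A * (1 + c * (inbox a b x)%:R)); split=> //.
- exact: measurable_affine_inbox.
- by move=> x; exact: mulr_ge0.
have -> : (fun x => (mu x * (A * (1 + c * (inbox a b x)%:R)))%:E) =
   (fun x => A%:E * (mu x * (1 + c * (inbox a b x)%:R))%:E)%E.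
  by apply/funext => x; rewrite -EFinM; congr EFin; ring.
rewrite intRdZl//.
- by rewrite EFinM; apply: lee_wpmul2l; rewrite ?lee_fin.
- apply/measurable_EFinP; apply: measurable_funM => //.
  have -> : (fun x => 1 + c * (inbox a b x)%:R) = (fun x => 1 * (1 + c * (inbox a b x)%:R)).
    by apply/funext => x; rewrite mul1r.
  exact: measurable_affine_inbox.
- by move=> x; rewrite lee_fin mulr_ge0// mu_ge0.
Qed.

Lemma tame_factor_box_up (g : d.-tuple R * R -> R) (A c : R) a b :
  (forall z, 0 <= g z) -> 0 <= A -> 0 <= c -> (forall i, tnth a i <= tnth b i) ->
  (forall x, incube x -> measurable_fun [set: R] (fun y => g (x, y)) /\
    (\int[kappa x]_(y in [set: R]) (g (x, y))%:E <= (A * (1 + c * (inbox a b x)%:R))%:E)%E) ->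
  tame_factor mu kappa g (A * (1 + c * mumax * \prod_i (tnth b i - tnth a i))).
Proof.
move=> g0 A0 c0 ab gP; apply: tame_factor_box g0 A0 _ gP _; first by lra.
apply: intRd_mu_boxD => //; [exact: mu_ge0|exact: mumax_ge0|exact: mu_le].
Qed.

Lemma tame_factor_box_dn (g : d.-tuple R * R -> R) (A c : R) a b :
  (forall z, 0 <= g z) -> 0 <= A -> 0 <= c <= 1 -> (forall i, tnth a i <= tnth b i) ->
  (forall x, inbox a b x -> incube x) ->
  (forall x, incube x -> measurable_fun [set: R] (fun y => g (x, y)) /\
    (\int[kappa x]_(y in [set: R]) (g (x, y))%:E <= (A * (1 - c * (inbox a b x)%:R))%:E)%E) ->
  tame_factor mu kappa g (A * (1 - c * mumin * \prod_i (tnth b i - tnth a i))).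
Proof.
move=> g0 A0 c01 ab bc gP; apply: (@tame_factor_box g A (- c) _ a b g0 A0).
- by move/andP: c01 => [? ?]; lra.
- by move=> x /gP; rewrite mulNr.
under eq_intRd do rewrite mulNr.
apply: intRd_mu_boxB => //; [exact: mu_ge0|exact: ltW|exact: mu_ge].
Qed.

Lemma measurable_exp_affine (t c : R) :
  measurable_fun [set: R] (fun y : R => expR (t * (y - c))).
Proof.
apply: (measurableT_comp (@measurable_expR R)).
apply: measurable_funM; first exact: measurable_cst.
by apply: measurable_funB; [exact: measurable_id|exact: measurable_cst].
Qed.

Lemma measurable_exp_abs (t s c : R) :
  measurable_fun [set: R] (fun y : R => expR (s + t * `|y - c|)).
Proof.
apply: (measurableT_comp (@measurable_expR R)).
apply: measurable_funD; first exact: measurable_cst.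
apply: measurable_funM; first exact: measurable_cst.
apply: (measurableT_comp (@normr_measurable R setT)).
by apply: measurable_funB; [exact: measurable_id|exact: measurable_cst].
Qed.

(** Off the box the exponent is zero and the factor equals [1]; on the box the sub-Gaussian bound
    applies. The mean thus exceeds [1] only by a multiple of the volume of the box. *)
Lemma tame_mgf (k : d.-tuple R -> R) (B : R) a b : (forall i, tnth a i <= tnth b i) ->
  (forall x, `|k x| <= B) -> (forall x, ~~ inbox a b x -> k x = 0) ->
  tame_factor mu kappa (fun z => expR (k z.1 * (z.2 - f z.1)))
    (1 * (1 + (expR (B ^+ 2 * sigma ^+ 2 / 2) - 1) * mumax * \prod_i (tnth b i - tnth a i))).
Proof.
move=> ab kB k0; apply: tame_factor_box_up => //.
- rewrite subr_ge0 -expR0 ler_expR; apply: divr_ge0 => //.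
  by apply: mulr_ge0; exact: sqr_ge0.
move=> x xc /=; split; first exact: measurable_exp_affine.
apply: (le_trans (subgauss xc (k x))); rewrite lee_fin mul1r.
have [xb|xb] := boolP (inbox a b x); last by rewrite k0// expr0n !mul0r expR0 mulr0 addr0.
rewrite mulr1 addrC subrK ler_expR; apply: ler_wpM2r => //; apply: ler_wpM2r; first exact: sqr_ge0.
by rewrite -real_normK ?num_real//; apply: lerXn2r; rewrite ?nnegrE ?(le_trans (normr_ge0 (k x))).
Qed.

(** The exponential of the absolute noise is at most the sum of the exponentials of the noise and of
    its opposite, each of conditional mean at most [expR (sigma ^+ 2 / 2)]. *)
Definition noise_const : R := 2 * expR (sigma ^+ 2 / 2).

Lemma noise_exp x n : incube x -> (0 < n)%N ->
  (\int[kappa x]_(y in [set: R]) (expR (n%:R^-1 * `|y - f x|))%:E <=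
     (1 + n%:R^-1 * noise_const)%:E)%E.
Proof.
move=> xc n0; have ni0 : 0 <= n%:R^-1 :> R by rewrite invr_ge0.
apply: (@le_trans _ _ (\int[kappa x]_(y in [set: R])
   (1%:E + n%:R^-1%:E * ((expR (1 * (y - f x)))%:E + (expR (-1 * (y - f x)))%:E))%E)%E).
  apply: ge0_le_integral_nonmeas => y; first by rewrite lee_fin expR_ge0.
  rewrite [leRHS](_ : _ = (1 + n%:R^-1 * (expR (1 * (y - f x)) + expR (-1 * (y - f x))))%:E)// lee_fin.
  apply: le_trans (expR_div_nat_le (normr_ge0 _) n0) _.
  rewrite lerD2l; apply: ler_wpM2l => //; rewrite mul1r mulN1r.
  have := expR_ge0 (y - f x); have := expR_ge0 (- (y - f x)).
  by case: (ger0P (y - f x)) => _; lra.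
have m1 := measurable_exp_affine 1 (f x); have m2 := measurable_exp_affine (-1) (f x).
have e0 (z : R) : (0%E <= (expR z)%:E)%E by rewrite lee_fin expR_ge0.
rewrite ge0_integralD//; last 2 first.
- by move=> y _; rewrite mule_ge0// ?lee_fin// adde_ge0.
- apply: measurable_funeM; apply: emeasurable_funD; exact/measurable_EFinP.
rewrite integral_cst// mul1e prob_kernel ge0_integralZl_EFin//; last 2 first.
- by move=> y _; rewrite adde_ge0.
- by apply: emeasurable_funD; exact/measurable_EFinP.
rewrite ge0_integralD//; last 2 first.
- exact/measurable_EFinP.
- exact/measurable_EFinP.
rewrite EFinD leeD2lE// EFinM; apply: lee_wpmul2l; first by rewrite lee_fin.
have h1 := subgauss xc 1; have h2 := subgauss xc (-1).
apply: le_trans (leeD h1 h2) _; rewrite -EFinD lee_fin /noise_const sqrrN expr1n mul1r; lra.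
Qed.

Lemma tame_exp_noise (s : bool -> R) a b n x : (0 < n)%N -> incube x ->
  measurable_fun [set: R] (fun y => expR (s (inbox a b x) + n%:R^-1 * `|y - f x|)) /\
  (\int[kappa x]_(y in [set: R]) (expR (s (inbox a b x) + n%:R^-1 * `|y - f x|))%:E <=
     ((1 + n%:R^-1 * noise_const) * expR (s (inbox a b x)))%:E)%E.
Proof.
move=> n0 xc; split; first exact: measurable_exp_abs.
have -> : (fun y => (expR (s (inbox a b x) + n%:R^-1 * `|y - f x|))%:E) =
  (fun y => (expR (s (inbox a b x)))%:E * (expR (n%:R^-1 * `|y - f x|))%:E)%E.
  by apply/funext => y; rewrite -EFinM expRD.
rewrite ge0_integralZl_EFin//.
- by rewrite mulrC EFinM; apply: lee_wpmul2l; [rewrite lee_fin expR_ge0|exact: noise_exp].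
- apply/measurable_EFinP; have := measurable_exp_abs n%:R^-1 0 (f x).
  by under eq_fun do rewrite add0r.
Qed.

Lemma noise_const_ge0 n : 0 <= 1 + n%:R^-1 * noise_const.
Proof. by rewrite addr_ge0// mulr_ge0 ?invr_ge0// mulr_ge0 ?expR_ge0. Qed.

(** One factor of a Chernoff bound for too few points in a box, tilted by the noise. The noise bound
    holds conditionally on [x], so the two effects multiply. *)
Lemma tame_cell a b n : (0 < n)%N -> (forall i, tnth a i <= tnth b i) ->
  (forall x, inbox a b x -> incube x) ->
  tame_factor mu kappa
    (fun z => expR (- (inbox a b z.1)%:R + n%:R^-1 * `|z.2 - f z.1|))
    ((1 + n%:R^-1 * noise_const) *
      (1 - (1 - expR (-1)) * mumin * \prod_i (tnth b i - tnth a i))).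
Proof.
move=> n0 ab bc; apply: tame_factor_box_dn => //.
- exact: noise_const_ge0.
- have := expR_ge0 (-1 : R); have : expR (-1) <= 1 :> R by rewrite -[leRHS]expR0 ler_expR lerN10.
  by move=> ? ?; apply/andP; split; lra.
move=> x xc /=; have [m1 m2] := tame_exp_noise (fun t => - t%:R) a b n0 xc; split=> //.
apply: (le_trans m2); rewrite lee_fin; apply: ler_wpM2l; first exact: noise_const_ge0.
by case: inbox; rewrite ?mulr1 ?mulr0 ?oppr0 ?expR0; lra.
Qed.

Lemma tame_count a b n : (0 < n)%N -> (forall i, tnth a i <= tnth b i) ->
  tame_factor mu kappa
    (fun z => expR ((inbox a b z.1)%:R + n%:R^-1 * `|z.2 - f z.1|))
    ((1 + n%:R^-1 * noise_const) *
      (1 + (expR 1 - 1) * mumax * \prod_i (tnth b i - tnth a i))).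
Proof.
move=> n0 ab; apply: tame_factor_box_up => //.
- exact: noise_const_ge0.
move=> x xc /=; have [m1 m2] := tame_exp_noise (fun t => t%:R) a b n0 xc; split=> //.
apply: (le_trans m2); rewrite lee_fin; apply: ler_wpM2l; first exact: noise_const_ge0.
by case: inbox; rewrite ?mulr1 ?mulr0 ?expR0; lra.
Qed.

End Factors.

Lemma natr_count (R : realType) T (P : pred T) (s : seq T) :
  (count P s)%:R = \sum_(z <- s) (P z)%:R :> R.
Proof.
by rewrite -sum1_count natr_sum big_mkcond; apply: eq_bigr => z _; case: ifP.
Qed.

(** * Error bound around one grid point *)

Section LocalBound.
Variables (R : realType) (d l : nat) (beta Cb mumin mumax sigma : R).
Variables (K : d.-tuple R -> R) (Kmin Kmax Delta hmax c3 pw : R).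
Hypothesis d_gt0 : (0 < d)%N.
Hypothesis beta_gt0 : 0 < beta.
Hypothesis Cb_gt0 : 0 < Cb.
Hypothesis mumin_gt0 : 0 < mumin.
Hypothesis mumin_lt : mumin < mumax.
Hypothesis sigma_gt0 : 0 < sigma.
Hypothesis Kmin_gt0 : 0 < Kmin.
Hypothesis Kmax_gt0 : 0 < Kmax.
Hypothesis Delta_gt0 : 0 < Delta.
Hypothesis KP : forall w, (if enorm w <= Delta then Kmin else 0) <= K w /\
              K w <= (if enorm w <= 1 then Kmax else 0).
Hypothesis lbeta : (floor_lt beta <= l)%N.
Hypothesis hmax_gt0 : 0 < hmax.
Hypothesis c3_ge1 : 1 <= c3.
Hypothesis pw_ge1 : 1 <= pw.
Local Notation N := (Ndim d l).
Local Notation sidx j := (nth [::] (multi_indices d l) j).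
Local Notation cellidx := {ffun 'I_d -> 'I_l.+1}.

(** The three caps have separate purposes: [1] keeps monomials bounded by one, [Delta / d%:R] keeps
    the cells where the kernel is at least [Kmin], and the last one gives [h * dlt <= 2^-1], so that
    the cells fit into the cube on the roomier side of [u]. *)
Definition dlt : R := Num.min 1 (Num.min (Delta / d%:R) (2 * hmax)^-1).

Lemma dlt_gt0 : 0 < dlt.
Proof. by rewrite !lt_min ltr01 divr_gt0 ?ltr0n// invr_gt0 mulr_gt0. Qed.

Lemma dlt_le1 : dlt <= 1.
Proof. by rewrite ge_min lexx. Qed.

Lemma dlt_Delta : d%:R * dlt <= Delta.
Proof. by rewrite mulrC -ler_pdivlMr ?ltr0n// !ge_min lexx orbT. Qed.

Lemma dlt_hmax h : 0 < h <= hmax -> h * dlt <= 2^-1.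
Proof.
move=> /andP[h0 hm]; have : dlt <= (2 * hmax)^-1 by rewrite !ge_min lexx !orbT.
have dp := dlt_gt0.
rewrite invfM => H; apply: (@le_trans _ _ (hmax * (2^-1 * hmax^-1))).
  by apply: ler_pM => //; exact: ltW.
by rewrite mulrCA divff ?gt_eqF// mulr1.
Qed.

(* The nodes are reflected into the orthant around [u] that stays inside the cube. *)
Definition sgn_of (u : d.-tuple R) (i : 'I_d) : bool := 2^-1 < tnth u i.
Definition cell_lo (u : d.-tuple R) h e (ka : cellidx) : d.-tuple R :=
  [tuple tnth u i + h * (tnth (node dlt (sgn_of u) ka) i - e) | i < d].
Definition cell_hi (u : d.-tuple R) h e (ka : cellidx) : d.-tuple R :=
  [tuple tnth u i + h * (tnth (node dlt (sgn_of u) ka) i + e) | i < d].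

Lemma inbox_cell u h e ka x : 0 < h ->
  inbox (cell_lo u h e ka) (cell_hi u h e ka) x =
  incell dlt (sgn_of u) ka e (tscale h^-1 (tsub x u)).
Proof.
move=> h0; apply: eq_forallb => i; rewrite !tnth_mktuple.
set a := (-1) ^+ _ * _; set w := h^-1 * _.
have -> : tnth x i = tnth u i + h * w by rewrite /w mulrA divff ?gt_eqF// mul1r addrC subrK.
rewrite !lerD2l !ler_pM2l// ler_norml.
by apply/idP/idP => /andP[? ?]; apply/andP; split; lra.
Qed.

Lemma cell_cube u h e ka x : inopencube u -> 0 < h <= hmax -> 0 < e ->
  e <= dlt / (2 * l.+1)%:R -> inbox (cell_lo u h e ka) (cell_hi u h e ka) x -> incube x.
Proof.
move=> uo hh e0 el; have /andP[h0 hm] := hh; rewrite inbox_cell// => xc i.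
have := incell_le dlt_gt0 i el xc; rewrite tnth_tscale tnth_tsub.
have /andP[u0 u1] := uo i; have := dlt_hmax hh.
set D := dlt; set y := tnth x i; rewrite /sgn_of => hd.
have E s : 0 <= s * (h^-1 * (y - tnth u i)) <= D -> 0 <= s * (y - tnth u i) <= h * D.
  have -> : s * (y - tnth u i) = h * (s * (h^-1 * (y - tnth u i))).
    by rewrite mulrCA (mulrA h) divff ?gt_eqF// mul1r.
  by move=> /andP[a b]; rewrite mulr_ge0 ?(ltW h0)//= ler_wpM2l// ltW.
case: ltP => us; rewrite ?expr1 ?expr0 => /E /andP[a b]; apply/andP; split; lra.
Qed.

Lemma cell_volume u h e ka : \prod_i (tnth (cell_hi u h e ka) i - tnth (cell_lo u h e ka) i) =
  (2 * e * h) ^+ d.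
Proof.
rewrite -[in RHS](card_ord d) -prodr_const; apply: eq_bigr => i _; rewrite !tnth_mktuple; ring.
Qed.

Definition ball_lo (u : d.-tuple R) h : d.-tuple R := [tuple tnth u i - h | i < d].
Definition ball_hi (u : d.-tuple R) h : d.-tuple R := [tuple tnth u i + h | i < d].

Lemma ball_volume u h : \prod_i (tnth (ball_hi u h) i - tnth (ball_lo u h) i) = (2 * h) ^+ d.
Proof.
rewrite -[in RHS](card_ord d) -prodr_const; apply: eq_bigr => i _; rewrite !tnth_mktuple; ring.
Qed.

Lemma ispoly_le D E (p : d.-tuple R -> R) : (D <= E)%N -> ispoly D p -> ispoly E p.
Proof.
move=> DE [L [LD Lp]]; exists L; split=> //; apply: sub_all LD => c cD.
exact: leq_trans DE.
Qed.

Lemma powR_sum_le1 n (x : R) (y : 'I_n -> R) : 0 <= x -> (forall j, 0 <= y j) ->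
  (x + \sum_j y j) `^ pw <= n.+1%:R `^ pw * (x `^ pw + \sum_j y j `^ pw).
Proof.
move=> x0 y0.
pose a (i : 'I_n.+1) := if unlift ord0 i is Some j then y j else x.
have a0 i : 0 <= a i by rewrite /a; case: unlift.
have := powR_sum_le (index_enum 'I_n.+1) (lt_le_trans ltr01 pw_ge1) a0.
have aE j : a (lift ord0 j) = y j by rewrite /a liftK.
have sz : size (index_enum 'I_n.+1) = n.+1 by rewrite /index_enum -enumT size_enum_ord.
rewrite sz !big_ord_recl {1 3}/a !unlift_none.
by rewrite (eq_bigr _ (fun j _ => aE j)) (eq_bigr _ (fun j _ => congr1 (fun r => r `^ pw) (aE j))).
Qed.

(** Half of the exponent that the Chernoff bound yields for a cell, per unit of [H]: one half pays
    for the threshold [rate_k e * H], the other remains as decay. *)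
Definition rate_k (e : R) : R := (1 - expR (-1)) * mumin * (2 * e) ^+ d / 2.
(** The Chernoff exponent for the box of half-width [h], increased by [rate_k e] so that an overfull
    box is as improbable as an underfull cell. *)
Definition count_max (e : R) : R := (expR 1 - 1) * mumax * 2 ^+ d + rate_k e.
(** [am] is the largest sub-Gaussian exponent met when [t <= H]. The factor [am * expR am] comes
    from [expR a - 1 <= a * expR a], and [mumax * 2 ^+ d] from the mass of the box. *)
Definition mgf_const : R :=
  let am := Kmax ^+ 2 * sigma ^+ 2 / 2 in am * expR am * mumax * 2 ^+ d.

Lemma rate_k_gt0 e : 0 < e -> 0 < rate_k e.
Proof.
by move=> e0; rewrite divr_gt0// !mulr_gt0 ?exprn_gt0 ?mulr_gt0.
Qed.

Lemma mumax_gt0 : 0 < mumax. Proof. exact: lt_trans mumin_lt. Qed.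

Lemma mgf_const_gt0 : 0 < mgf_const.
Proof.
by rewrite /mgf_const !mulr_gt0 ?expR_gt0 ?exprn_gt0 ?divr_gt0 ?mulr_gt0 ?exprn_gt0// mumax_gt0.
Qed.

Lemma count_max_gt0 e : 0 < e -> 0 < count_max e.
Proof.
move=> e0; apply: addr_gt0; last exact: rate_k_gt0.
by rewrite !mulr_gt0 ?mumax_gt0 ?exprn_gt0// subr_gt0 -[ltLHS]expR0 ltr_expR ltr01.
Qed.

Section Sample.
Variables (n : nat) (h : R) (mu : d.-tuple R -> R).
Variables (kappa : R.-pker (d.-tuple R) ~> R) (f : d.-tuple R -> R) (u : d.-tuple R).
Hypothesis n_gt0 : (0 < n)%N.
Hypothesis hh : 0 < h <= hmax.
Hypothesis fclass : in_class beta Cb mumin mumax sigma mu kappa f.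
Hypothesis uo : inopencube u.
Local Notation H := (n%:R * h ^+ d).
Implicit Types Z : seq (d.-tuple R * R).

Let h_gt0 : 0 < h. Proof. by case/andP: hh. Qed.
Let H_gt0 : 0 < H. Proof. by rewrite mulr_gt0 ?ltr0n ?exprn_gt0. Qed.

(** The restriction [t <= H] keeps the exponent of each factor bounded, so that each factor is [1]
    plus a term quadratic in [t / H]. Over [n] observations, of which a fraction of order [h ^+ d]
    matters, this gives [t ^+ 2 / H]. *)
Lemma tame_score (s t : R) (j : 'I_N) : 0 < t <= H -> `|s| <= t ->
  tame mu kappa n (fun Z => expR (s * score h K Z u f j)) (expR (mgf_const * t ^+ 2 / H)).
Proof.
move=> /andP[t0 tH] st; have [fH [[mmu mu_out mu_in mu_prob] [_ sg]]] := fclass.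
pose k x := s * H^-1 * (K (tscale h^-1 (tsub x u)) * monom (sidx j) (tscale h^-1 (tsub x u))).
have Hi0 : 0 < H^-1 by rewrite invr_gt0.
have Kge0 := K_ge0 Kmin_gt0 KP; have Kle := K_le Kmax_gt0 KP.
have k0 x : ~~ inbox (ball_lo u h) (ball_hi u h) x -> k x = 0.
  move=> xb; rewrite /k (K_eq0 Kmin_gt0 KP) ?mul0r ?mulr0//.
  by apply: contra xb => /(@zpt_inbox _ _ h u h_gt0 (x, 0)).
have kB x : `|k x| <= t * H^-1 * Kmax.
  rewrite /k !normrM (gtr0_norm Hi0) (ger0_norm (Kge0 _)).
  apply: ler_pM; rewrite ?mulr_ge0 ?(ltW Hi0)//.
    by rewrite ler_wpM2r// ltW.
  have [x1|x1] := boolP (enorm (tscale h^-1 (tsub x u)) <= 1).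
    rewrite -[leRHS]mulr1; apply: ler_pM => //.
    by apply: monom_le1 => i; exact: le_trans (coord_le_enorm _ _) x1.
  by rewrite (K_eq0 Kmin_gt0 KP x1) mul0r ltW.
have bb i : tnth (ball_lo u h) i <= tnth (ball_hi u h) i by rewrite !tnth_mktuple; have := h_gt0; lra.
have T := tame_prod n (tame_mgf mmu mu_out mumin_gt0 mu_in mu_prob sg bb kB k0).
apply: le_tame T _ _ => [Z sZ ZC|].
  rewrite -expR_sum ler_expR /score /mass sZ mulr_sumr mulr_sumr.
  apply: ler_sum => p _; rewrite /k /noise /zpt le_eqVlt; apply/orP; left; apply/eqP; ring.
rewrite ball_volume mul1r.
set am := Kmax ^+ 2 * sigma ^+ 2 / 2.
have aE : (t * H^-1 * Kmax) ^+ 2 * sigma ^+ 2 / 2 = (t * H^-1) ^+ 2 * am.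
  by rewrite /am !exprMn; ring.
have am0 : 0 <= am by rewrite divr_ge0// mulr_ge0// sqr_ge0.
have r1 : (t * H^-1) ^+ 2 <= 1.
  apply: exprn_ile1; first by apply: mulr_ge0; exact: ltW.
  by rewrite ler_pdivrMr// mul1r.
have mm0 := ltW mumax_gt0.
have h2 : 0 <= (2 * h) ^+ d by rewrite exprn_ge0// mulr_ge0// ltW.
rewrite aE; set a := (t * H^-1) ^+ 2 * am.
have a0 : 0 <= a by rewrite mulr_ge0// sqr_ge0.
have ea : expR a - 1 <= (t * H^-1) ^+ 2 * (am * expR am).
  apply: le_trans (expR_sub1_le a) _; rewrite /a -mulrA; apply: ler_wpM2l; first exact: sqr_ge0.
  by apply: ler_wpM2l => //; rewrite ler_expR -[leRHS]mul1r ler_wpM2r.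
have ea0 : 0 <= expR a - 1 by rewrite subr_ge0 -expR0 ler_expR.
apply: le_trans (exprn_le_expR _ _) _; first by rewrite addr_ge0// !mulr_ge0.
rewrite ler_expR; apply: (@le_trans _ _ (n%:R * ((t * H^-1) ^+ 2 * (am * expR am) * mumax * (2 * h) ^+ d))).
  by apply: ler_wpM2l => //; rewrite ler_wpM2r// ler_wpM2r.
rewrite le_eqVlt; apply/orP; left; apply/eqP.
rewrite /mgf_const -/am [(2 * h) ^+ d]exprMn.
have : h ^+ d != 0 by rewrite expf_neq0// gt_eqF.
have : n%:R != 0 :> R by rewrite pnatr_eq0 -lt0n.
move=> ? ?; field.
by apply/andP; split.
Qed.

Definition wnoise Z := n%:R^-1 * \sum_(q <- Z) `|noise f q|.
Definition cellcount e ka Z : R :=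
  (count (fun p => inbox (cell_lo u h e ka) (cell_hi u h e ka) p.1) Z)%:R.

Lemma noise_growth : (1 + n%:R^-1 * noise_const sigma) ^+ n <= expR (noise_const sigma).
Proof.
apply: le_trans (exprn_le_expR _ _) _; first exact: noise_const_ge0.
by rewrite mulrA divff ?mul1r// pnatr_eq0 -lt0n.
Qed.

(** A cell holding fewer than [rate_k e * H] points makes [rate_k e * H - cellcount e ka Z]
    positive, so this exponential dominates the indicator of that event times the tilt. The tilt
    costs the constant [expR (noise_const sigma)]. *)
Lemma tame_bad_cell e ka : 0 < e -> e <= dlt / (2 * l.+1)%:R ->
  tame mu kappa n (fun Z => expR (rate_k e * H - cellcount e ka Z + wnoise Z))
    (expR (noise_const sigma) * expR (- rate_k e * H)).
Proof.
move=> e0 el; have [fH [[mmu mu_out mu_in mu_prob] [_ sg]]] := fclass.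
have bb i : tnth (cell_lo u h e ka) i <= tnth (cell_hi u h e ka) i.
  by rewrite !tnth_mktuple lerD2l; apply: ler_wpM2l; [exact: ltW|lra].
have bc x := @cell_cube u h e ka x uo hh e0 el.
have T := tame_prod n (tame_cell mmu mu_out mumin_gt0 mu_in mu_prob sg n_gt0 bb bc).
apply: le_tame (tameZ (expR_ge0 (rate_k e * H)) T) _ _ => [Z sZ ZC|].
  rewrite -expR_sum -expRD ler_expR -addrA lerD2l /cellcount /wnoise.
  by rewrite big_split /= sumrN mulr_sumr natr_count.
have c1 : expR (-1) <= 1 :> R by rewrite -[leRHS]expR0 ler_expR lerN10.
have c2 := expR_ge0 (-1 : R).
rewrite cell_volume; set A := 1 + n%:R^-1 * _.
set v := (1 - expR (-1)) * mumin * (2 * e * h) ^+ d.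
(* Passing from powers of [1 - v] to an exponential needs [1 - v] to be nonnegative, which holds
   because [1 - v] bounds the integral of a nonnegative function from above. *)
have v1 : 0 <= 1 - v.
  have mm : (intRd (fun x => (mu x * (1 - (1 - expR (-1)) *
     (inbox (cell_lo u h e ka) (cell_hi u h e ka) x)%:R))%:E) <= (1 - v)%:E)%E.
    rewrite /v -(cell_volume u h e ka); apply: intRd_mu_boxB => //.
    - exact: mu_ge0 mu_out mumin_gt0 mu_in.
    - by apply/andP; split; lra.
    - exact: ltW.
    - by move=> x /mu_in /andP[/ltW].
  rewrite -lee_fin; apply: le_trans mm; apply: intRd_ge0 => x; rewrite lee_fin mulr_ge0//.
    exact: mu_ge0 mu_out mumin_gt0 mu_in x.
  by case: inbox; rewrite ?mulr1 ?mulr0; lra.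
rewrite exprMn; apply: (@le_trans _ _ (expR (rate_k e * H) *
    (expR (noise_const sigma) * expR (n%:R * - v)))).
  apply: ler_wpM2l; first exact: expR_ge0.
  apply: ler_pM; rewrite ?exprn_ge0 ?noise_const_ge0//; first exact: noise_growth.
  exact: exprn_le_expR.
rewrite mulrCA; apply: ler_wpM2l; first exact: expR_ge0.
rewrite -expRD ler_expR /v /rate_k [(2 * e * h) ^+ d]exprMn.
rewrite le_eqVlt; apply/orP; left; apply/eqP; by field.
Qed.

Lemma tame_bad_count e : 0 < e ->
  tame mu kappa n (fun Z => expR (nbox h Z u - count_max e * H + wnoise Z))
    (expR (noise_const sigma) * expR (- rate_k e * H)).
Proof.
move=> e0; have [fH [[mmu mu_out mu_in mu_prob] [_ sg]]] := fclass.
have bb i : tnth (ball_lo u h) i <= tnth (ball_hi u h) i by rewrite !tnth_mktuple; have := h_gt0; lra.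
have T := tame_prod n (tame_count mmu mu_out mumin_gt0 mu_in mu_prob sg n_gt0 bb).
apply: le_tame (tameZ (expR_ge0 (- count_max e * H)) T) _ _ => [Z sZ ZC|].
  rewrite -expR_sum -expRD ler_expR /nbox /wnoise.
  by rewrite big_split /= mulr_sumr natr_count mulNr addrA [X in _ <= X + _]addrC.
rewrite ball_volume; set A := 1 + n%:R^-1 * _.
set v := (expR 1 - 1) * mumax * (2 * h) ^+ d.
have v0 : 0 <= v.
  have e1 : 0 <= expR 1 - 1 :> R by rewrite subr_ge0 -[leLHS]expR0 ler_expR.
  have h2 : 0 <= (2 * h) ^+ d by rewrite exprn_ge0// mulr_ge0// ltW.
  by rewrite mulr_ge0// mulr_ge0// ltW// mumax_gt0.
rewrite exprMn; apply: (@le_trans _ _ (expR (- count_max e * H) *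
    (expR (noise_const sigma) * expR (n%:R * v)))).
  apply: ler_wpM2l; first exact: expR_ge0.
  apply: ler_pM; rewrite ?exprn_ge0 ?noise_const_ge0 ?addr_ge0//; first exact: noise_growth.
  by apply: exprn_le_expR; rewrite addr_ge0.
rewrite mulrCA; apply: ler_wpM2l; first exact: expR_ge0.
rewrite -expRD ler_expR /v /count_max [(2 * h) ^+ d]exprMn.
rewrite le_eqVlt; apply/orP; left; apply/eqP; ring.
Qed.

Section Pointwise.
Variables (e c tau : R).
Hypothesis e_gt0 : 0 < e.
Hypothesis e_le : e <= dlt / (2 * l.+1)%:R.
Hypothesis c_gt0 : 0 < c.
Hypothesis cellP : forall sg I (s : seq I) (zf : I -> d.-tuple R) (n0 : R), 0 < n0 ->
  (forall ka : cellidx, n0 <= (count (fun p => incell dlt sg ka e (zf p)) s)%:R) ->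
  forall v, c * n0 * dotv v v <=
    \sum_(p <- s | [forall i, `|tnth (zf p) i| <= dlt]) dotv v (Uvec l (zf p)) ^+ 2.
Hypothesis tau_gt0 : 0 < tau.
Hypothesis tau_le : tau <= Kmin * c * rate_k e.

Definition invc : R := (Kmin * c * rate_k e)^-1 * (N%:R * (c3 ^+ l) ^+ d).
Definition taylorC : R := taylor_const beta Cb d.
(** The first summand is the Taylor residual at the design points propagated through the inverse
    Gram matrix; the second is the Taylor residual at the evaluation point. *)
Definition goodC : R :=
  invc * (N%:R * (taylorC * Kmax * count_max e)) + taylorC * (d%:R * c3) `^ beta.
Definition badC : R := (N%:R * (c3 ^+ l) ^+ d * (N%:R * Kmax) + 1) * (Cb + 1).

Lemma invc_ge0 : 0 <= invc.
Proof.
have r0 := ltW (rate_k_gt0 e_gt0).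
rewrite mulr_ge0 ?invr_ge0 ?(mulr_ge0 (mulr_ge0 (ltW Kmin_gt0) (ltW c_gt0)))//.
by rewrite mulr_ge0// !exprn_ge0// (le_trans ler01).
Qed.

Lemma taylorC_ge0 : 0 <= taylorC.
Proof. by apply: taylor_const_ge0; exact: ltW. Qed.

Lemma goodC_ge0 : 0 <= goodC.
Proof.
have T0 := taylorC_ge0; have I0 := invc_ge0; have M0 := ltW (count_max_gt0 e_gt0).
apply: addr_ge0; last by apply: mulr_ge0 => //; exact: powR_ge0.
by apply: mulr_ge0 => //; rewrite mulr_ge0// mulr_ge0// mulr_ge0// ltW.
Qed.

Lemma badC_ge0 : 0 <= badC.
Proof.
have A0 : 0 <= N%:R * (c3 ^+ l) ^+ d by rewrite mulr_ge0 ?exprn_ge0// (le_trans ler01).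
apply: mulr_ge0; apply: addr_ge0 => //; last exact: ltW.
by apply: mulr_ge0 => //; rewrite mulr_ge0// ltW.
Qed.

Variables (Z : seq (d.-tuple R * R)) (x' : d.-tuple R).
Hypothesis sZ : size Z = n.
Hypothesis ZC : incubeZ Z.
Hypothesis x'C : incube x'.
Hypothesis x'u : forall i, `|tnth x' i - tnth u i| <= c3 * h.

Let Z_gt0 : (0 < size Z)%N. Proof. by rewrite sZ. Qed.

Let x'c3 i : `|tnth (tscale h^-1 (tsub x' u)) i| <= c3.
Proof.
by rewrite tnth_tscale tnth_tsub normrM gtr0_norm ?invr_gt0// mulrC ler_pdivrMr.
Qed.

Lemma error_good :
  (forall ka, rate_k e * H <= cellcount e ka Z) -> nbox h Z u <= count_max e * H ->
  `|ftilde l h tau K Z u x' - f x'| <=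
    goodC * h `^ beta + \sum_(j < N) invc * `|score h K Z u f j|.
Proof.
move=> Hcell Hbox; have [fH _] := fclass.
have [p [pp Hp]] := taylor_cube d_gt0 beta_gt0 fH uo.
have massE : mass h Z = H by rewrite /mass sZ.
have r0 := rate_k_gt0 e_gt0.
have coer v : Kmin * c * rate_k e * dotv v v <= qf (Bmat l h K Z u) v v.
  have n0 : 0 < rate_k e * H by rewrite mulr_gt0.
  have := cells_Bmat h_gt0 Z_gt0 Kmin_gt0 KP (sg := sgn_of u) c_gt0 n0 dlt_Delta (@cellP (sgn_of u)).
  rewrite massE (_ : H^-1 * (rate_k e * H) = rate_k e); last first.
    by rewrite mulrCA mulVf ?mulr1// gt_eqF.
  apply => ka; apply: (le_trans (Hcell ka)); rewrite /cellcount ler_nat.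
  by apply: sub_count => q /=; rewrite inbox_cell.
have c00 : 0 < Kmin * c * rate_k e by apply: mulr_gt0 => //; exact: mulr_gt0.
have hb0 : 0 <= h `^ beta by exact: powR_ge0.
have Ct0 := taylorC_ge0.
have eta q : q \in Z -> enorm (zpt h u q) <= 1 -> `|f q.1 - p (tsub q.1 u)| <= taylorC * h `^ beta.
  move=> qZ q1; apply: le_trans (Hp _ (ZC qZ)) _; apply: ler_wpM2l => //.
  apply: ge0_ler_powR; [exact: ltW|by rewrite nnegrE enorm_ge0|by rewrite nnegrE ltW|].
  move: q1; rewrite /zpt enorm_tscale; last by rewrite invr_ge0 ltW.
  by rewrite mulrC ler_pdivrMr// mul1r.
have G := ftilde_good h_gt0 Z_gt0 Kmin_gt0 Kmax_gt0 KP c00 tau_le c3_ge1 coer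
  (ispoly_le lbeta pp) (mulr_ge0 Ct0 hb0) eta x'c3.
have T : `|f x' - p (tsub x' u)| <= taylorC * (d%:R * c3) `^ beta * h `^ beta.
  apply: le_trans (Hp _ x'C) _; rewrite -mulrA; apply: ler_wpM2l => //.
  have dc : 0 <= d%:R * c3 by rewrite mulr_ge0// (le_trans ler01).
  rewrite -powRM ?(ltW h_gt0)//; apply: ge0_ler_powR.
  - exact: ltW.
  - by rewrite nnegrE enorm_ge0.
  - by rewrite nnegrE mulr_ge0// ltW.
  rewrite -mulrA; apply: enorm_le_coord => [|i]; last by rewrite tnth_tsub.
  by rewrite mulr_ge0 ?(ltW h_gt0)// (le_trans ler01).
have -> : ftilde l h tau K Z u x' - f x' =
  (ftilde l h tau K Z u x' - p (tsub x' u)) - (f x' - p (tsub x' u)) by ring.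
apply: le_trans (ler_normB _ _) _.
apply: le_trans (lerD G T) _.
have B : (mass h Z)^-1 * nbox h Z u <= count_max e.
  by rewrite massE mulrC ler_pdivrMr.
rewrite -/invc -mulr_sumr big_split /= mulrDr sumr_const card_ord -[_ *+ _]mulr_natl.
rewrite -[leLHS]addrA [X in _ + X]addrC addrA; apply: lerD => //.
rewrite /goodC mulrDl; apply: lerD => //.
rewrite -[leRHS]mulrA; apply: ler_wpM2l; first exact: invc_ge0.
rewrite -[leRHS]mulrA; apply: ler_wpM2l => //.
have -> : taylorC * Kmax * count_max e * h `^ beta = taylorC * h `^ beta * Kmax * count_max e by ring.
by apply: ler_wpM2l => //; rewrite !mulr_ge0// ltW.
Qed.

Lemma error_bad : `|ftilde l h tau K Z u x' - f x'| <=
  badC * (tau^-1 * (h ^+ d)^-1 + 1) * (1 + wnoise Z).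
Proof.
have [fH _] := fclass.
have Hf q : q \in Z -> `|f q.1| <= Cb + 1.
  by move=> qZ; have := holder_bound d_gt0 fH (ZC qZ).
have := ftilde_bound l h_gt0 Z_gt0 Kmin_gt0 Kmax_gt0 KP tau_gt0 c3_ge1 Hf x'c3.
have := holder_bound d_gt0 fH x'C.
rewrite sZ -/(wnoise Z) => H1 H2.
have w0 : 0 <= wnoise Z by rewrite mulr_ge0 ?invr_ge0// sumr_ge0.
apply: le_trans (ler_normB _ _) _; apply: le_trans (lerD H2 H1) _.
set A := N%:R * (c3 ^+ l) ^+ d in H2 *.
have A0 : 0 <= A by rewrite mulr_ge0 ?exprn_ge0// (le_trans ler01).
rewrite /badC -/A; set B := A * (N%:R * Kmax).
have B0 : 0 <= B by rewrite mulr_ge0// mulr_ge0// ltW.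
set v := tau^-1 * (h ^+ d)^-1.
have v0 : 0 <= v by rewrite mulr_ge0// invr_ge0 ?exprn_ge0// ltW.
have -> : tau^-1 * A * (N%:R * (Kmax / h ^+ d * (Cb + 1 + wnoise Z))) =
  B * v * (Cb + 1 + wnoise Z) by rewrite /B /v; ring.
set w := wnoise Z in w0 *.
have Bv : 0 <= B * v by rewrite mulr_ge0.
have step1 : Cb + 1 + w <= (Cb + 1) * (1 + w) by have := mulr_ge0 (ltW Cb_gt0) w0; rewrite mulrDr mulr1 mulrDl; lra.
have step2 : B * v * (Cb + 1 + w) <= B * v * ((Cb + 1) * (1 + w)) by apply: ler_wpM2l.
have C1 : 0 <= (Cb + 1) * (1 + w) by rewrite mulr_ge0 ?addr_ge0// ltW.
have step3 : Cb + 1 <= (Cb + 1) * (1 + w).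
  by rewrite -[leLHS]mulr1; apply: ler_wpM2l; rewrite ?addr_ge0 ?(ltW Cb_gt0)// lerDl.
have -> : (B + 1) * (Cb + 1) * (v + 1) * (1 + w) =
  B * v * ((Cb + 1) * (1 + w)) + (Cb + 1) * (1 + w) + (B + v) * ((Cb + 1) * (1 + w)) by ring.
have := mulr_ge0 (addr_ge0 B0 v0) C1; lra.
Qed.

End Pointwise.

Section Functional.
Variables (e tau Ce t a b A : R).
Hypothesis e_gt0 : 0 < e.
Hypothesis e_le : e <= dlt / (2 * l.+1)%:R.
Hypothesis Ce_gt0 : 0 < Ce.
Hypothesis CeP : forall x, 0 <= x -> x `^ pw <= Ce * expR x.
Hypothesis tH : 0 < t <= H.
Hypothesis a_ge0 : 0 <= a.
Hypothesis b_ge0 : 0 <= b.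

Hypothesis tabP : forall s, `|s| `^ pw <= a + b * (expR (t * s) + expR (- t * s)).

Definition badlevel : R := (tau^-1 * (h ^+ d)^-1 + 1) `^ pw.

(** The random part of the error bound. If a cell or the box violates its count, the exponent of the
    corresponding summand is at least [wnoise Z], so that summand alone dominates the crude error;
    its weight is the worst-case error level. *)
Definition locE Z : R :=
  N.+1%:R `^ pw * A `^ pw * b *
    (\sum_(j < N) (expR (t * score h K Z u f j) + expR (- t * score h K Z u f j))) +
  badC `^ pw * badlevel * (Ce * expR 1) *
    (\sum_(ka : cellidx) expR (rate_k e * H - cellcount e ka Z + wnoise Z) +
     expR (nbox h Z u - count_max e * H + wnoise Z)).

Lemma locE_ge0 Z : 0 <= locE Z.
Proof.
have eS : 0 <= \sum_(j < N) (expR (t * score h K Z u f j) + expR (- t * score h K Z u f j)).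
  by apply: sumr_ge0 => j _; rewrite addr_ge0 ?expR_ge0.
have eB : 0 <= \sum_(ka : cellidx) expR (rate_k e * H - cellcount e ka Z + wnoise Z).
  by apply: sumr_ge0 => j _; rewrite expR_ge0.
apply: addr_ge0; apply: mulr_ge0.
- by rewrite !mulr_ge0 ?powR_ge0.
- exact: eS.
- by rewrite !mulr_ge0 ?powR_ge0 ?expR_ge0 ?(ltW Ce_gt0).
- by rewrite addr_ge0 ?expR_ge0.
Qed.

Lemma tame_locE : tame mu kappa n locE
  (N.+1%:R `^ pw * A `^ pw * b * (N%:R * (2 * expR (mgf_const * t ^+ 2 / H))) +
   badC `^ pw * badlevel * (Ce * expR 1) *
    ((#|{: cellidx}|.+1)%:R * (expR (noise_const sigma) * expR (- rate_k e * H)))).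
Proof.
apply: tameD; apply: tameZ.
- by rewrite !mulr_ge0 ?powR_ge0.
- have := @tame_sum R d mu kappa n 'I_N (index_enum 'I_N)
    (fun j Z => expR (t * score h K Z u f j) + expR (- t * score h K Z u f j))
    (fun=> 2 * expR (mgf_const * t ^+ 2 / H)).
  move=> T; apply: le_tame (T _) _ _ => // [j|].
    have t0 : `|t| <= t by rewrite gtr0_norm//; case/andP: tH.
    have nt0 : `|- t| <= t by rewrite normrN.
    apply: le_tame (tameD (tame_score j tH t0) (tame_score j tH nt0)) _ _ => //.
    by rewrite [leRHS]mulr_natl [leRHS]mulr2n.
  by rewrite sumr_const card_ord -[leLHS]mulr_natl.
- by rewrite !mulr_ge0 ?powR_ge0 ?expR_ge0 ?(ltW Ce_gt0).
- have := @tame_sum R d mu kappa n cellidx (index_enum cellidx) _ _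
    (fun ka => tame_bad_cell ka e_gt0 e_le).
  move=> T; apply: le_tame (tameD T (tame_bad_count e_gt0)) _ _ => //.
  by rewrite sumr_const -[_ *+ _]mulr_natl -[#|_|.+1%:R]natr1 mulrDl mul1r.
Qed.

End Functional.

(** On a good sample the power of a bias plus [N] scores is split, which costs the power of [N.+1].
    On a bad one the crude bound is a multiple of the power [pw] of [1 + wnoise Z], hence of
    [expR (1 + wnoise Z)], which is exactly the tilt carried by the failing summand. *)
Lemma local_error (e c tau Ce t a b : R) Z x' :
  0 < e -> e <= dlt / (2 * l.+1)%:R -> 0 < c ->
  (forall sg I (s : seq I) (zf : I -> d.-tuple R) (n0 : R), 0 < n0 ->
  (forall ka : cellidx, n0 <= (count (fun p => incell dlt sg ka e (zf p)) s)%:R) ->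
  forall v, c * n0 * dotv v v <=
    \sum_(p <- s | [forall i, `|tnth (zf p) i| <= dlt]) dotv v (Uvec l (zf p)) ^+ 2) ->
  0 < tau -> tau <= Kmin * c * rate_k e -> 0 < Ce ->
  (forall x, 0 <= x -> x `^ pw <= Ce * expR x) ->
  0 <= a -> 0 <= b ->
  (forall s, `|s| `^ pw <= a + b * (expR (t * s) + expR (- t * s))) ->
  size Z = n -> incubeZ Z -> incube x' ->
  (forall i, `|tnth x' i - tnth u i| <= c3 * h) ->
  `|ftilde l h tau K Z u x' - f x'| `^ pw <=
    N.+1%:R `^ pw * (goodC e c `^ pw * (h `^ beta) `^ pw + N%:R * invc e c `^ pw * a) +
    locE e tau Ce t b (invc e c) Z.
Proof.
move=> e0 el c0 cellP tau0 tau_le Ce0 CeP a0 b0 tabP sZ ZC x'C x'u.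
have pw0 : 0 < pw by exact: lt_le_trans pw_ge1.
have r0 := rate_k_gt0 e0.
have I0 : 0 <= invc e c by exact: invc_ge0.
have G0 : 0 <= goodC e c by exact: goodC_ge0.
have hb0 : 0 <= h `^ beta by exact: powR_ge0.
have locB : 0 <= badC `^ pw * badlevel tau * (Ce * expR 1).
  by rewrite !mulr_ge0 ?powR_ge0 ?expR_ge0 ?(ltW Ce0).
have locS : 0 <= N.+1%:R `^ pw * invc e c `^ pw * b *
    (\sum_(j < N) (expR (t * score h K Z u f j) + expR (- t * score h K Z u f j))).
  apply: mulr_ge0; first by rewrite !mulr_ge0 ?powR_ge0.
  by apply: sumr_ge0 => j _; rewrite addr_ge0 ?expR_ge0.
have const0 : 0 <= N.+1%:R `^ pw *
    (goodC e c `^ pw * (h `^ beta) `^ pw + N%:R * invc e c `^ pw * a).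
  by rewrite mulr_ge0 ?addr_ge0 ?mulr_ge0 ?powR_ge0.
have sumB : 0 <= \sum_(ka : cellidx) expR (rate_k e * H - cellcount e ka Z + wnoise Z).
  by apply: sumr_ge0 => ka _; rewrite expR_ge0.
have bad w : 0 <= w -> `|ftilde l h tau K Z u x' - f x'| `^ pw <=
      badC `^ pw * badlevel tau * (Ce * expR 1) * expR (w + wnoise Z).
  move=> w0; have w1 : 0 <= wnoise Z by rewrite mulr_ge0 ?invr_ge0// sumr_ge0.
  have EB := error_bad tau0 sZ ZC x'C x'u.
  have lev0 : 0 <= tau^-1 * (h ^+ d)^-1 + 1.
    by rewrite addr_ge0// mulr_ge0// invr_ge0 ?exprn_ge0 ?ltW.
  have bC := badC_ge0.
  apply: (@le_trans _ _ ((badC * (tau^-1 * (h ^+ d)^-1 + 1) * (1 + wnoise Z)) `^ pw)).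
    apply: ge0_ler_powR => //; rewrite ?nnegrE ?(ltW pw0)//.
    by apply: le_trans EB; exact: normr_ge0.
  rewrite (powRM _ (mulr_ge0 bC lev0) (addr_ge0 ler01 w1)) (powRM _ bC lev0).
  rewrite -/(badlevel tau).
  rewrite -[leRHS]mulrA; apply: ler_wpM2l; first by rewrite mulr_ge0 ?powR_ge0.
  apply: (le_trans (CeP _ _)); first by rewrite addr_ge0.
  rewrite -mulrA; apply: ler_wpM2l; first exact: ltW.
  by rewrite -expRD ler_expR; lra.
have [Hcell|] := boolP [forall ka, rate_k e * H <= cellcount e ka Z]; last first.
  rewrite negb_forall => /existsP[ka]; rewrite -ltNge => Hka.
  have w0 : 0 <= rate_k e * H - cellcount e ka Z by rewrite subr_ge0 ltW.
  apply: (le_trans (bad _ w0)).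
  rewrite -[leLHS]add0r; apply: lerD => //; rewrite -[leLHS]add0r; apply: lerD => //.
  apply: ler_wpM2l => //.
  rewrite (bigD1 ka)//= -[leRHS]addrA lerDl addr_ge0 ?expR_ge0//.
  by apply: sumr_ge0 => k _; rewrite expR_ge0.
have [Hbox|Hbox] := leP (nbox h Z u) (count_max e * H); last first.
  have w0 : 0 <= nbox h Z u - count_max e * H by rewrite subr_ge0 ltW.
  apply: (le_trans (bad _ w0)).
  rewrite -[leLHS]add0r; apply: lerD => //; rewrite -[leLHS]add0r; apply: lerD => //.
  by apply: ler_wpM2l => //; rewrite lerDr.
have EG := error_good e0 c0 cellP tau_le sZ ZC x'C x'u (forallP Hcell) Hbox.
apply: (@le_trans _ _ ((goodC e c * h `^ beta +
   \sum_(j < N) invc e c * `|score h K Z u f j|) `^ pw)).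
  apply: ge0_ler_powR => //; rewrite ?nnegrE ?(ltW pw0)//.
  by rewrite addr_ge0 ?mulr_ge0// sumr_ge0// => j _; rewrite mulr_ge0.
apply: le_trans (powR_sum_le1 _ _) _.
- exact: mulr_ge0.
- by move=> j; rewrite mulr_ge0.
rewrite powRM//.
have S1 : \sum_(j < N) (invc e c * `|score h K Z u f j|) `^ pw <=
   N%:R * invc e c `^ pw * a + invc e c `^ pw * b *
    (\sum_(j < N) (expR (t * score h K Z u f j) + expR (- t * score h K Z u f j))).
  have -> : N%:R * invc e c `^ pw * a = \sum_(j < N) invc e c `^ pw * a.
    by rewrite sumr_const card_ord -[RHS]mulr_natl mulrA.
  rewrite mulr_sumr -big_split /=; apply: ler_sum => j _.
  rewrite powRM// -mulrA -mulrDr; apply: ler_wpM2l; first exact: powR_ge0.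
  exact: tabP.
have N0 : 0 <= N.+1%:R `^ pw :> R by exact: powR_ge0.
have := ler_wpM2l N0 (lerD (lexx (goodC e c `^ pw * (h `^ beta) `^ pw)) S1).
move=> /le_trans; apply; rewrite addrA mulrDr lerD2l.
rewrite /locE -[leLHS]addr0; apply: lerD.
  by rewrite !mulrA.
by rewrite mulr_ge0// addr_ge0// expR_ge0.
Qed.

End Sample.

(** The constants precede [n], [h], [tau], the law and the grid point, which gives the uniformity
    over the class. The condition on [a], [b] and [t] stays abstract so that finite exponents, with
    [a = 0], and the supremum loss, with [a] of the size of the rate, share one argument. A single
    [E] serves all [x'] near [u], so an adversarial choice of [x'] in that neighbourhood is free. *)
Lemma local_bound : exists C kap Lam tau0 : R,
  [/\ 0 < C, 0 < kap, 0 < Lam, 0 < tau0 &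
  forall n h tau mu (kappa : R.-pker (d.-tuple R) ~> R) f u t a b,
  (0 < n)%N -> 0 < h <= hmax -> in_class beta Cb mumin mumax sigma mu kappa f ->
  inopencube u -> 0 < tau <= tau0 -> 0 < t <= n%:R * h ^+ d -> 0 <= a -> 0 <= b ->
  (forall s, `|s| `^ pw <= a + b * (expR (t * s) + expR (- t * s))) ->
  exists E : seq (d.-tuple R * R) -> R, [/\ (forall Z, 0 <= E Z),
    tame mu kappa n E (C * (b * expR (Lam * t ^+ 2 / (n%:R * h ^+ d)) +
      (tau^-1 * (h ^+ d)^-1 + 1) `^ pw * expR (- kap * (n%:R * h ^+ d)))) &
    forall Z x', size Z = n -> incubeZ Z -> incube x' ->
      (forall i, `|tnth x' i - tnth u i| <= c3 * h) ->
      `|ftilde l h tau K Z u x' - f x'| `^ pw <= C * ((h `^ beta) `^ pw + a) + E Z]].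
Proof.
have [e [c [e0 el c0 cellP]]] := cells_coercive d l dlt_gt0 dlt_le1.
have pw0 : 0 < pw by exact: lt_le_trans pw_ge1.
have [Ce Ce0 CeP] := powR_le_expR pw0.
have I0 : 0 <= invc e c by exact: invc_ge0.
have G0 : 0 <= goodC e c by exact: goodC_ge0.
pose C1 := N.+1%:R `^ pw * goodC e c `^ pw.
pose C2 := N.+1%:R `^ pw * (N%:R * invc e c `^ pw).
pose C4 := badC `^ pw * (Ce * expR 1) * ((#|{: cellidx}|.+1)%:R * expR (noise_const sigma)).
have C10 : 0 <= C1 by rewrite mulr_ge0 ?powR_ge0.
have C20 : 0 <= C2 by rewrite !mulr_ge0 ?powR_ge0.
have C40 : 0 <= C4.
  apply: mulr_ge0; first by rewrite !mulr_ge0 ?powR_ge0 ?expR_ge0 ?(ltW Ce0).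
  by rewrite mulr_ge0 ?expR_ge0.
exists (1 + C1 + 2 * C2 + C4), (rate_k e), mgf_const, (Kmin * c * rate_k e); split.
- by move: C10 C20 C40; lra.
- exact: rate_k_gt0.
- exact: mgf_const_gt0.
- by apply: mulr_gt0; [exact: mulr_gt0|exact: rate_k_gt0].
move=> n h tau mu kappa f u t a b n0 hh cl uo /andP[tau1 tau2] tH a0 b0 tabP.
exists (locE n h f u e tau Ce t b (invc e c)); split.
- by move=> Z; exact: locE_ge0.
- have T := tame_locE n0 hh cl uo tau (invc e c) e0 el Ce0 tH b0.
  apply: le_tame T _ _ => //.
  set X := expR _; set Y := expR (- _ * _).
  have X0 : 0 <= b * X by rewrite mulr_ge0 ?expR_ge0.
  have Y0 : 0 <= badlevel h tau * Y by rewrite mulr_ge0 ?powR_ge0 ?expR_ge0.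
  rewrite -/(badlevel h tau).
  have -> : N.+1%:R `^ pw * invc e c `^ pw * b * (N%:R * (2 * X)) = 2 * C2 * (b * X).
    by rewrite /C2; ring.
  have -> : badC `^ pw * badlevel h tau * (Ce * expR 1) *
     (#|{: cellidx}|.+1%:R * (expR (noise_const sigma) * Y)) = C4 * (badlevel h tau * Y).
    by rewrite /C4; ring.
  rewrite mulrDr; apply: lerD; apply: ler_wpM2r => //; move: C10 C20 C40; lra.
move=> Z x' sZ ZC x'C x'u.
apply: le_trans (local_error n0 hh cl uo e0 el c0 (@cellP) tau1 tau2 Ce0 CeP a0 b0 tabP sZ ZC x'C x'u) _.
rewrite lerD2r.
have -> : N.+1%:R `^ pw * (goodC e c `^ pw * (h `^ beta) `^ pw + N%:R * invc e c `^ pw * a) =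
   C1 * (h `^ beta) `^ pw + C2 * a by rewrite /C1 /C2; ring.
rewrite [leRHS]mulrDr.
by apply: lerD; apply: ler_wpM2r; rewrite ?powR_ge0//; clearbody C1 C2 C4; lra.
Qed.

End LocalBound.

(** * The grid and its closest points *)

Section Grid.
Variables (R : realType) (d M : nat).
Hypothesis M_gt0 : (0 < M)%N.
Local Notation gidx := {ffun 'I_d -> 'I_M}.

Definition gridpt (k : gidx) : d.-tuple R :=
  [tuple (2 * k i + 1)%:R / (2 * M)%:R | i < d].

Lemma gridpt_in k : in_grid M (gridpt k).
Proof. by move=> i; exists (k i); [exact: ltn_ord|rewrite tnth_mktuple]. Qed.

Lemma in_gridP u : in_grid M u -> exists k, u = gridpt k.
Proof.
move=> uM; have /choice[k kP] : forall i, exists k : 'I_M, tnth u i = (2 * k + 1)%:R / (2 * M)%:R.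
  by move=> i; have [k kM E] := uM i; exists (Ordinal kM).
exists [ffun i => k i]; apply: eq_from_tnth => i.
by rewrite tnth_mktuple ffunE kP.
Qed.

Lemma gridpt_open k : inopencube (gridpt k).
Proof.
move=> i; rewrite tnth_mktuple.
have M0 : 0 < (2 * M)%:R :> R by rewrite ltr0n muln_gt0.
apply/andP; split; first by rewrite divr_gt0// ltr0n addn1.
rewrite ltr_pdivrMr// mul1r ltr_nat -addn1 -addnA addnC -mulnS.
by rewrite leq_mul2l /=; exact: ltn_ord.
Qed.

Lemma nat_interval (y : R) m : 0 <= y -> y <= m.+1%:R ->
  exists k : 'I_m.+1, k%:R <= y <= k%:R + 1.
Proof.
move=> y0; elim: m => [|m IH] ym.
  by exists ord0; rewrite /= y0 add0r.
have [/IH[k kP]|my] := leP y m.+1%:R.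
  by exists (widen_ord (leqnSn _) k).
by exists ord_max; rewrite /= ltW// natr1.
Qed.

Lemma near_gridpt (x : d.-tuple R) : incube x ->
  exists k, forall i, `|tnth (gridpt k) i - tnth x i| <= (2 * M)%:R^-1.
Proof.
move=> xc; have M0 : 0 < M%:R :> R by rewrite ltr0n.
have /choice[k kP] : forall i, exists k : 'I_M, k%:R <= M%:R * tnth x i <= k%:R + 1.
  move=> i; have /andP[x0 x1] := xc i.
  case: M M_gt0 M0 => // m _ M0; apply: nat_interval; first exact: mulr_ge0.
  by rewrite -[leRHS]mulr1 ler_wpM2l.
exists [ffun i => k i] => i; rewrite tnth_mktuple ffunE; have := kP i.
move: (tnth x i) (k i) => y j /andP[a b].
rewrite !natrM natrD natrM ler_norml.
have E : (2 * j%:R + 1) / (2 * M%:R) - y = (2 * M%:R)^-1 * (2 * j%:R + 1 - 2 * (M%:R * y)).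
  by field; rewrite gt_eqF.
have i0 : 0 < (2 * M%:R)^-1 :> R by rewrite invr_gt0 mulr_gt0.
rewrite E -[in X in X && _]mulrN1 -[X in _ && (_ <= X)]mulr1 !ler_pM2l//.
by apply/andP; split; lra.
Qed.

(** [xget] returns its default value unless the set is inhabited. A member is obtained by minimising
    over the finite grid twice: the distance to [x], then the norm among the minimisers. *)
Lemma closest_gridP (x : d.-tuple R) : incube x ->
  exists k, closest_grid M x = gridpt k /\
    forall i, `|tnth x i - tnth (gridpt k) i| <= d%:R / (2 * M)%:R.
Proof.
move=> xc.
have [k0 k0P] := near_gridpt xc.
pose g k := enorm (tsub (gridpt k) x).
have [k1 k1P] : exists k1, forall k, g k1 <= g k.
  by case: (@arg_minP _ _ _ k0 predT g isT) => k1 _ H; exists k1 => k; exact: H.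
have [k2 g2 k2P] : exists2 k2, g k2 = g k1 & forall k, g k = g k1 ->
    enorm (gridpt k2) <= enorm (gridpt k).
  case: (@arg_minP _ _ _ k1 (fun k => g k == g k1) (fun k => enorm (gridpt k)) (eqxx _)).
  move=> k2 /eqP E H; exists k2 => // k Ek; apply: H; exact/eqP.
have [ug [umin _]] := @xgetPex _ (tzero R d) [set u | in_grid M u /\
    (forall v, in_grid M v -> enorm (tsub u x) <= enorm (tsub v x)) /\
    (forall v, in_grid M v -> enorm (tsub v x) = enorm (tsub u x) ->
        enorm u <= enorm v)] (ex_intro _ (gridpt k2) (conj (gridpt_in k2) (conj
    (fun v vM => let: ex_intro k E := in_gridP vM in
       eq_ind_r (fun v => enorm (tsub (gridpt k2) x) <= enorm (tsub v x))
         (eq_ind_r (fun r => r <= g k) (k1P k) g2) E)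
    (fun v vM => let: ex_intro k E := in_gridP vM in
       eq_ind_r (fun v => enorm (tsub v x) = enorm (tsub (gridpt k2) x) ->
          enorm (gridpt k2) <= enorm v) (fun Ek => k2P k (etrans Ek g2)) E)))).
rewrite -/(closest_grid M x) in ug umin.
have [k kE] := in_gridP ug; exists k; split=> // i.
rewrite -kE -tnth_tsub -[tnth (tsub _ _) i]opprK normrN tnth_tsub opprB -tnth_tsub.
apply: le_trans (coord_le_enorm _ _) _.
apply: le_trans (umin _ (gridpt_in k0)) _.
by apply: enorm_le_coord => // j; rewrite tnth_tsub; exact: k0P.
Qed.

End Grid.

(** * From local error bounds to adversarial risk *)

Section Risk.
Variables (R : realType) (d l M n : nat) (beta Cb mumin mumax sigma : R).
Variables (K : d.-tuple R -> R) (h tau r c3 c5 B0 B1 pw : R).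
Variables (mu : d.-tuple R -> R) (kappa : R.-pker (d.-tuple R) ~> R) (f : d.-tuple R -> R).
Variable A : d.-tuple R -> set (d.-tuple R).
Local Notation gidx := {ffun 'I_d -> 'I_M}.
Variable E : gidx -> seq (d.-tuple R * R) -> R.
Hypothesis d_gt0 : (0 < d)%N.
Hypothesis beta_gt0 : 0 < beta.
Hypothesis Cb_gt0 : 0 < Cb.
Hypothesis mumin_gt0 : 0 < mumin.
Hypothesis M_gt0 : (0 < M)%N.
Hypothesis h_gt0 : 0 < h.
Hypothesis cl : in_class beta Cb mumin mumax sigma mu kappa f.
Hypothesis advA : adv_class r A.
Hypothesis gridh : d%:R / (2 * M)%:R <= c3 * h.
Hypothesis rh : r <= c5 * h.
Hypothesis c3_ge0 : 0 <= c3.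
Hypothesis r_ge0 : 0 <= r.
Hypothesis B0_ge0 : 0 <= B0.
Hypothesis pw_gt0 : 0 < pw.
Hypothesis E_ge0 : forall k Z, 0 <= E k Z.
Hypothesis E_tame : forall k, tame mu kappa n (E k) B1.
Hypothesis E_err : forall k Z x', size Z = n -> incubeZ Z -> incube x' ->
  (forall i, `|tnth x' i - tnth (gridpt R k) i| <= c3 * h) ->
  `|ftilde l h tau K Z (gridpt R k) x' - f x'| `^ pw <= B0 + E k Z.
Local Notation fhat := (fPP M l h tau K).
Local Notation lipr := (d%:R * Cb * r `^ Num.min 1 beta).

Lemma lipr_ge0 : 0 <= lipr.
Proof. by rewrite mulr_ge0 ?powR_ge0// mulr_ge0// ltW. Qed.

Lemma f_dist x x' : incube x -> A x x' -> `|f x' - f x| <= lipr.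
Proof.
move=> xc Axx'; have [_ _ Ac Ar] := advA xc; have [fH _] := cl.
apply: le_trans (holder_dist d_gt0 beta_gt0 fH (Ac _ Axx') xc) _.
apply: ler_wpM2l; first by rewrite mulr_ge0// ltW.
apply: ge0_ler_powR; rewrite ?nnegrE ?enorm_ge0//; last exact: Ar.
by rewrite le_min ler01 ltW.
Qed.

Lemma fhat_err Z x' : size Z = n -> incubeZ Z -> incube x' -> exists2 k,
  (forall i, `|tnth x' i - tnth (gridpt R k) i| <= c3 * h) &
  `|fhat Z x' - f x'| `^ pw <= B0 + E k Z.
Proof.
move=> sZ ZC x'c; have [k [kE kP]] := closest_gridP M_gt0 x'c; exists k.
  by move=> i; apply: le_trans gridh; exact: kP.
by rewrite /fPP kE; apply: E_err => // i; apply: le_trans gridh; exact: kP.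
Qed.

Lemma card_gidx : #|{: gidx}| = (M ^ d)%N.
Proof. by rewrite card_ffun !card_ord. Qed.

Lemma tame_total c w : 0 <= c -> 0 <= w ->
  tame mu kappa n (fun Z => c + w * \sum_(k : gidx) E k Z) (c + w * ((M ^ d)%:R * B1)).
Proof.
move=> c0 w0; have [_ [[mmu mu_out mu_in mu_prob] _]] := cl.
apply: tameD; first exact: tame_cst.
apply: tameZ => //.
apply: le_tame (tame_sum (index_enum gidx) E_tame) _ _ => //.
by rewrite sumr_const -[leLHS]mulr_natl -card_gidx.
Qed.

Lemma adv_risk_oo : pw = 1 ->
  (adv_risk +oo%E mu kappa n fhat f A <= (B0 + lipr + (M ^ d)%:R * B1)%:E)%E.
Proof.
move=> pw1; have [_ [[mmu mu_out mu_in mu_prob] _]] := cl.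
have T := tame_total (addr_ge0 B0_ge0 lipr_ge0) ler01; rewrite mul1r in T.
rewrite /adv_risk; apply: (tame_sampleE mmu mu_out (mu_ge0 mu_out mumin_gt0 mu_in) T).
- move=> Z _ _.
  (* The supremum over an empty set would be [-oo]; the center of the cube, paired with itself,
     shows that it is nonnegative. *)
  have cc : incube (cube_center R d) by apply: opencube_cube; exact: cube_center_open.
  apply: (@le_trans _ _ (`|fhat Z (cube_center R d) - f (cube_center R d)|)%:E).
    by rewrite lee_fin.
  apply: ereal_sup_ubound; exists (cube_center R d, cube_center R d) => //.
  by split=> //=; have [] := advA cc.
- move=> Z sZ ZC; apply: ge_ereal_sup => _ [[x x'] /= [xc Axx'] <-].
  have [_ _ Ac _] := advA xc; rewrite lee_fin.
  have [k _] := fhat_err sZ ZC (Ac _ Axx'); rewrite pw1 powRr1// => Hk.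
  have -> : fhat Z x' - f x = (fhat Z x' - f x') + (f x' - f x) by ring.
  apply: le_trans (ler_normD _ _) _.
  apply: le_trans (lerD Hk (f_dist xc Axx')) _.
  rewrite mul1r addrAC lerD2l (bigD1 k)//= lerDl sumr_ge0//.
Qed.

Lemma intRd_mu_boxes (c : R) (e : gidx -> R) (lo hi : gidx -> d.-tuple R) v :
  0 <= c -> (forall k, 0 <= e k) -> (forall k i, tnth (lo k) i <= tnth (hi k) i) ->
  (forall k, \prod_i (tnth (hi k) i - tnth (lo k) i) = v) ->
  (intRd (fun x => (mu x * (c + \sum_k e k * (inbox (lo k) (hi k) x)%:R))%:E) <=
    (c + mumax * v * \sum_k e k)%:E)%E.
Proof.
move=> c0 e0 lohi Hv; have [_ [[mmu mu_out mu_in mu_prob] _]] := cl.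
have mu0 := mu_ge0 mu_out mumin_gt0 mu_in.
have -> : (fun x => (mu x * (c + \sum_k e k * (inbox (lo k) (hi k) x)%:R))%:E) =
  (fun x => c%:E * (mu x)%:E +
     \sum_k (e k)%:E * (mu x * (inbox (lo k) (hi k) x)%:R)%:E)%E.
  apply/funext => x; rewrite sumEFin -EFinM -EFinD mulrDr mulr_sumr [mu x * c]mulrC.
  by congr (_ + _)%:E; apply: eq_bigr => k _; ring.
have mb k : measurable_fun [set: d.-tuple R] (fun x => mu x * (inbox (lo k) (hi k) x)%:R).
  by apply: measurable_funM => //; exact: measurable_inbox.
rewrite intRdD; last 4 first.
- by apply: measurable_funeM; exact/measurable_EFinP.
- by apply: emeasurable_sum => k; apply: measurable_funeM; exact/measurable_EFinP.
- by move=> x; rewrite mule_ge0// lee_fin.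
- by move=> x; apply: sume_ge0 => k _; rewrite mule_ge0// lee_fin// mulr_ge0.
rewrite intRdZl; last 3 first.
- exact/measurable_EFinP.
- by move=> x; rewrite lee_fin.
- exact: c0.
rewrite mu_prob mule1 EFinD leeD2lE// intRd_sum; last 2 first.
- by move=> k; apply: measurable_funeM; exact/measurable_EFinP.
- by move=> k x; rewrite mule_ge0// lee_fin// mulr_ge0.
rewrite mulr_sumr -sumEFin; apply: lee_sum => k _.
rewrite intRdZl; last 3 first.
- exact/measurable_EFinP.
- by move=> x; rewrite lee_fin mulr_ge0.
- exact: e0.
rewrite mulrC EFinM; apply: lee_wpmul2l; first by rewrite lee_fin.
rewrite -(Hv k) -intRd_inbox//; last exact: mumax_ge0 mumin_gt0 mu_in.
apply: le_intRd => x; rewrite lee_fin; first by rewrite mulr_ge0.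
apply: ler_wpM2r => //.
have [/mu_in /andP[_ /ltW]//|/mu_out ->] := pselect (incube x).
exact: mumax_ge0 mumin_gt0 mu_in.
Qed.

(** The grid point serving [x'] varies with the attack, but [x] always lies in the box of half-width
    [(c3 + c5) * h] around it. The supremum is therefore at most a sum over all grid points of
    [E k Z] times a box indicator in [x], a function that is measurable in [x] and linear in the
    [E k]. *)
Lemma adv_risk_fin : 0 <= c5 ->
  (adv_risk pw%:E mu kappa n fhat f A <=
   (2 `^ pw * (B0 + lipr `^ pw) +
    mumax * (2 * ((c3 + c5) * h)) ^+ d * 2 `^ pw * ((M ^ d)%:R * B1))%:E)%E.
Proof.
move=> c50; have [_ [[mmu mu_out mu_in mu_prob] _]] := cl.
have mu0 := mu_ge0 mu_out mumin_gt0 mu_in.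
have mm0 := mumax_ge0 mumin_gt0 mu_in.
have ch0 : 0 <= (c3 + c5) * h by rewrite mulr_ge0 ?addr_ge0// ltW.
have p20 : 0 <= 2 `^ pw :> R by exact: powR_ge0.
have lp0 : 0 <= lipr `^ pw by exact: powR_ge0.
have cst0 : 0 <= 2 `^ pw * (B0 + lipr `^ pw) by rewrite mulr_ge0 ?addr_ge0.
set v := (2 * ((c3 + c5) * h)) ^+ d.
have v0 : 0 <= v by rewrite exprn_ge0// mulr_ge0.
have w0 : 0 <= mumax * v * 2 `^ pw by rewrite mulr_ge0// mulr_ge0.
have T := tame_total cst0 w0.
rewrite /adv_risk; apply: (tame_sampleE mmu mu_out mu0 T).
- move=> Z _ _; apply: intRd_ge0 => x.
  have [xc|/mu_out ->] := pselect (incube x); last by rewrite mul0e.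
  rewrite mule_ge0 ?lee_fin//.
  apply: (@le_trans _ _ (`|fhat Z x - f x| `^ pw)%:E); first by rewrite lee_fin powR_ge0.
  by apply: ereal_sup_ubound; exists x => //; have [] := advA xc.
move=> Z sZ ZC.
pose lo (k : gidx) := ball_lo (gridpt R k) ((c3 + c5) * h).
pose hi (k : gidx) := ball_hi (gridpt R k) ((c3 + c5) * h).
have lohi k i : tnth (lo k) i <= tnth (hi k) i by rewrite !tnth_mktuple; lra.
have e0 k : 0 <= 2 `^ pw * E k Z by rewrite mulr_ge0.
have B := intRd_mu_boxes cst0 e0 lohi (fun k => ball_volume (gridpt R k) _).
apply: (@le_trans _ _ _ _ _ _ (le_trans B _)); last first.
  by rewrite lee_fin -mulr_sumr mulrA.
apply: le_intRd => x.
  have [xc|/mu_out ->] := pselect (incube x); last by rewrite mul0e.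
  rewrite mule_ge0 ?lee_fin//.
  apply: (@le_trans _ _ (`|fhat Z x - f x| `^ pw)%:E); first by rewrite lee_fin powR_ge0.
  by apply: ereal_sup_ubound; exists x => //; have [] := advA xc.
have [xc|/mu_out ->] := pselect (incube x); last by rewrite mul0e mul0r.
rewrite EFinM; apply: lee_wpmul2l; first by rewrite lee_fin.
apply: ge_ereal_sup => _ [x' Axx' <-]; rewrite lee_fin.
have [_ _ Ac Ar] := advA xc.
have [k kx Hk] := fhat_err sZ ZC (Ac _ Axx').
have inb : inbox (lo k) (hi k) x.
  apply/forallP => i.
  have -> : tnth (lo k) i = tnth (gridpt R k) i - (c3 + c5) * h by rewrite tnth_mktuple.
  have -> : tnth (hi k) i = tnth (gridpt R k) i + (c3 + c5) * h by rewrite tnth_mktuple.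
  have := kx i; have := le_trans (coord_le_enorm (tsub x' x) i) (Ar _ Axx').
  rewrite tnth_tsub !ler_norml => /andP[a1 a2] /andP[b1 b2].
  move: a1 a2 b1 b2 rh; move: (tnth x i) (tnth x' i) (tnth (gridpt R k) i) => y y' g a1 a2 b1 b2 H.
  by apply/andP; split; lra.
have tri : `|fhat Z x' - f x| `^ pw <=
    2 `^ pw * (`|fhat Z x' - f x'| `^ pw + `|f x' - f x| `^ pw).
  have P := powR_sum_le [:: fhat Z x' - f x'; f x' - f x] pw_gt0 (fun b : R => normr_ge0 b).
  rewrite !big_cons !big_nil !addr0 /= in P.
  apply: le_trans P; apply: ge0_ler_powR; rewrite ?nnegrE ?addr_ge0 ?(ltW pw_gt0)//.
  by apply: le_trans (ler_normD _ _); rewrite addrA subrK.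
apply: (le_trans tri).
have F1 : `|f x' - f x| `^ pw <= lipr `^ pw.
  apply: ge0_ler_powR; rewrite ?nnegrE ?(ltW pw_gt0)//; first exact: lipr_ge0.
  exact: f_dist.
apply: (@le_trans _ _ (2 `^ pw * ((B0 + E k Z) + lipr `^ pw))).
  by apply: ler_wpM2l => //; exact: lerD.
rewrite addrAC mulrDr lerD2l (bigD1 k)//= inb mulr1 lerDl sumr_ge0// => k' _.
by rewrite mulr_ge0.
Qed.

End Risk.

(** * Asymptotics of the bandwidth, the regularisation and the rate *)

Section Rates.
Variables (R : realType) (d : nat) (beta gamma c1 c2 cM : R).
Hypothesis d_gt0 : (0 < d)%N.
Hypothesis beta_gt0 : 0 < beta.
Hypothesis gamma_gt0 : 0 < gamma.
Hypothesis c1_gt0 : 0 < c1.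
Hypothesis c2_gt0 : 0 < c2.
Hypothesis cM_gt0 : 0 < cM.
Local Notation theta := (2 * beta + d%:R).

(* [lam] is [1] when [q] is finite and [ln n] when [q] is infinite. *)
Definition rho (n : nat) (lam : R) : R := (n%:R / lam) `^ (- theta^-1).

(** What the asymptotic hypotheses provide at one large [n], with all constants fixed beforehand.
    The last field ensures [lam <= H], which makes the later choices of [t] satisfy [t <= H]. *)
Record setting (n : nat) (lam h tau r : R) (M : nat) : Prop := Setting {
  s_lam1 : 1 <= lam;
  s_lamn : lam <= n%:R;
  s_r : 0 <= r;
  s_hlo : c1 * Num.max r (rho n lam) <= h;
  s_hhi : h <= c2 * Num.max r (rho n lam);
  s_M : (0 < M)%N;
  s_Mh : M%:R <= cM * h^-1;
  s_tau : 0 < tau;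
  s_taun : tau^-1 <= n%:R `^ gamma;
  s_large : 1 <= c1 ^+ d * (n%:R / lam) `^ (2 * beta / theta)
}.

Lemma theta_gt1 : 1 < theta.
Proof. have : 1 <= d%:R :> R by rewrite ler1n. by move: beta_gt0; lra. Qed.

Lemma theta_gt0 : 0 < theta.
Proof. exact: lt_trans theta_gt1. Qed.

Lemma powR_exp_bounded (A k s : R) : 0 <= A -> 0 < k -> 0 < s ->
  exists2 C, 0 < C & forall x, 0 < x -> x `^ A * expR (- (k * x `^ s)) <= C.
Proof.
move=> A0 k0 s0.
(* The exponent is [(A + s) / s] and not [A / s] because it has to be positive also when [A = 0]. *)
have p0 : 0 < (A + s) / s by rewrite divr_gt0// ltr_pwDr.
have [C C0 HC] := powR_le_expR p0.
exists (1 + C * (k `^ ((A + s) / s))^-1).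
  by rewrite ltr_pwDl// mulr_ge0 ?invr_ge0 ?powR_ge0// ltW.
move=> x x0; have [x1|x1] := leP x 1.
  apply: (@le_trans _ _ 1); last by rewrite lerDl mulr_ge0 ?invr_ge0 ?powR_ge0// ltW.
  rewrite -[leRHS]mulr1; apply: ler_pM; rewrite ?powR_ge0 ?expR_ge0//.
    have <- : 1 `^ A = 1 :> R by rewrite powR1.
    by apply: ge0_ler_powR; rewrite ?nnegrE// ltW.
  by rewrite -expR0 ler_expR oppr_le0 mulr_ge0 ?powR_ge0// ltW.
have y0 : 0 <= k * x `^ s by rewrite mulr_ge0 ?powR_ge0// ltW.
have := HC _ y0; rewrite powRM ?powR_ge0 ?(ltW k0)// -powRrM mulrCA divff ?gt_eqF// mulr1.
move=> H; rewrite expRN ler_pdivrMr ?expR_gt0//.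
have kp : 0 < k `^ ((A + s) / s) by rewrite powR_gt0.
apply: (@le_trans _ _ (x `^ (A + s))).
  by apply: ler_powR; [exact: ltW|rewrite lerDl ltW].
have := expR_ge0 (k * x `^ s); set e := expR _ in H *.
rewrite mulrDl mul1r => e0; apply: (@le_trans _ _ (C * (k `^ ((A + s) / s))^-1 * e)); last by rewrite lerDr.
by rewrite mulrAC ler_pdivlMr// mulrC.
Qed.

Section Facts.
Variables (n : nat) (lam h tau r : R) (M : nat).
Hypothesis S : setting n lam h tau r M.
Local Notation H := (n%:R * h ^+ d).
Local Notation y := (n%:R / lam).
Local Notation rh := (rho n lam).

Lemma lam_gt0 : 0 < lam. Proof. exact: lt_le_trans (s_lam1 S). Qed.
Lemma n_ge1 : 1 <= n%:R :> R. Proof. exact: le_trans (s_lam1 S) (s_lamn S). Qed.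
Lemma n_pos : 0 < n%:R :> R. Proof. exact: lt_le_trans n_ge1. Qed.
Lemma y_ge1 : 1 <= y. Proof. by rewrite ler_pdivlMr ?lam_gt0// mul1r (s_lamn S). Qed.
Lemma y_gt0 : 0 < y. Proof. exact: lt_le_trans y_ge1. Qed.
Lemma rho_gt0 : 0 < rh. Proof. exact: powR_gt0 y_gt0. Qed.

Lemma rho_ge_invn : n%:R^-1 <= rh.
Proof.
have t0 := theta_gt0; have l0 := lam_gt0.
apply: (@le_trans _ _ (y `^ (- 1))).
  rewrite powR_inv1 ?(ltW y_gt0)// lef_pV2 ?posrE ?n_pos ?y_gt0//.
  by rewrite ler_pdivrMr// ler_peMr ?(ltW n_pos) ?(s_lam1 S).
apply: ler_powR; first exact: y_ge1.
by rewrite lerN2 invf_le1// ltW// theta_gt1.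
Qed.

Lemma h_ge_rho : c1 * rh <= h.
Proof.
apply: le_trans (s_hlo S); apply: ler_wpM2l; first exact: ltW.
by rewrite le_max lexx orbT.
Qed.

Lemma h_ge_r : c1 * r <= h.
Proof.
apply: le_trans (s_hlo S); apply: ler_wpM2l; first exact: ltW.
by rewrite le_max lexx.
Qed.

Lemma h_pos : 0 < h.
Proof. by apply: lt_le_trans h_ge_rho; rewrite mulr_gt0// rho_gt0. Qed.

(** The balance that defines the rate: [1 - d / theta = 2 * beta / theta], so [lam] divided by
    [n rho^d] is the squared bias [rho^(2 beta)]. *)
Lemma n_rho : n%:R * rh ^+ d = lam * y `^ (2 * beta / theta).
Proof.
have t0 := theta_gt0; have yn := y_gt0.
have -> : 2 * beta / theta = 1 + (- theta^-1) * d%:R.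
  by field; rewrite gt_eqF.
rewrite powRD; last by rewrite (gt_eqF yn) implybT.
rewrite powRr1 ?(ltW yn)// mulrA [lam * _]mulrC divfK ?gt_eqF ?lam_gt0//.
by rewrite powRrM powR_mulrn// powR_ge0.
Qed.

Lemma H_ge : c1 ^+ d * (lam * y `^ (2 * beta / theta)) <= H.
Proof.
rewrite -n_rho mulrCA; apply: ler_wpM2l; first exact: ltW n_pos.
rewrite -exprMn; apply: lerXn2r; rewrite ?nnegrE ?h_ge_rho ?(ltW h_pos)//.
by rewrite mulr_ge0 ?(ltW c1_gt0) ?(ltW rho_gt0).
Qed.

Lemma lam_le_H : lam <= H.
Proof.
apply: le_trans H_ge; rewrite mulrCA -[leLHS]mulr1; apply: ler_wpM2l; first exact: ltW lam_gt0.
exact: s_large S.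
Qed.

Lemma H_pos : 0 < H. Proof. exact: lt_le_trans lam_gt0 lam_le_H. Qed.

(** Removes [lam]: as [1 <= lam] and the exponent is below [1], the power of [lam] is at most [lam].
    The decay on the bad event can then be compared with powers of [n]. *)
Lemma H_ge_pow : c1 ^+ d * n%:R `^ (2 * beta / theta) <= H.
Proof.
apply: le_trans H_ge; apply: ler_wpM2l; first by rewrite exprn_ge0// ltW.
have l0 := lam_gt0; have t0 := theta_gt0.
have -> : n%:R `^ (2 * beta / theta) = lam `^ (2 * beta / theta) * y `^ (2 * beta / theta).
  by rewrite -powRM ?(ltW l0) ?(ltW y_gt0)// [lam * _]mulrC divfK ?gt_eqF.
apply: ler_wpM2r; first exact: powR_ge0.
rewrite -[leRHS]powRr1 ?(ltW l0)//; apply: ler_powR; first exact: s_lam1 S.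
by rewrite ler_pdivrMr// mul1r lerDl.
Qed.

Lemma rho_2beta : rh `^ (2 * beta) = (y `^ (2 * beta / theta))^-1.
Proof. by rewrite /rho -powRrM mulNr powRN [theta^-1 * _]mulrC. Qed.

Lemma lam_div_H : lam / H <= (c1 ^+ d)^-1 * rh `^ (2 * beta).
Proof.
have c10 : 0 < c1 ^+ d by rewrite exprn_gt0.
have yp : 0 < y `^ (2 * beta / theta) by rewrite powR_gt0 ?y_gt0.
rewrite rho_2beta -invfM ler_pdivrMr ?H_pos// mulrC ler_pdivlMr ?mulr_gt0//.
by have := H_ge; rewrite mulrCA.
Qed.

Lemma sqrt_lam_div_H : Num.sqrt (lam / H) <= ((c1 ^+ d)^-1) `^ (2^-1) * rh `^ beta.
Proof.
have c10 : 0 <= (c1 ^+ d)^-1 by rewrite invr_ge0 exprn_ge0// ltW.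
have -> : rh `^ beta = (rh `^ (2 * beta)) `^ (2^-1).
  by rewrite -powRrM mulrAC divff ?mul1r.
rewrite -powRM ?powR_ge0// powR12_sqrt; last by rewrite mulr_ge0 ?powR_ge0.
exact: ler_wsqrtr lam_div_H.
Qed.

(** Both factors grow polynomially: [tau^-1] by the lower bound on [tau], and the power of [h^-1]
    because [h >= c1 * rho] and [rho >= 1 / n]. *)
Lemma level_le : tau^-1 * (h ^+ d)^-1 + 1 <= ((c1 ^+ d)^-1 + 1) * n%:R `^ (gamma + d%:R).
Proof.
have n0 := n_pos; have c10 : 0 < c1 ^+ d by rewrite exprn_gt0.
have hd : (h ^+ d)^-1 <= (c1 ^+ d)^-1 * n%:R ^+ d.
  rewrite -[X in _ * X]invrK -invfM lef_pV2 ?posrE ?exprn_gt0 ?h_pos ?mulr_gt0 ?invr_gt0 ?exprn_gt0//.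
  rewrite -exprVn -exprMn; apply: lerXn2r; rewrite ?nnegrE ?(ltW h_pos)//.
    by rewrite mulr_ge0 ?invr_ge0 ?(ltW c1_gt0)// ltW.
  by apply: le_trans h_ge_rho; apply: ler_wpM2l; [exact: ltW|exact: rho_ge_invn].
have np : n%:R `^ (gamma + d%:R) = n%:R `^ gamma * n%:R ^+ d.
  by rewrite powRD ?powR_mulrn ?(ltW n0)// (gt_eqF n0) implybT.
rewrite mulrDl mul1r; apply: lerD.
  rewrite np mulrCA; apply: ler_pM; rewrite ?invr_ge0 ?exprn_ge0 ?(ltW h_pos) ?(ltW (s_tau S))//.
  exact: s_taun S.
rewrite -[leLHS](powRr0 n%:R).
by apply: ler_powR; [exact: n_ge1|rewrite addr_ge0// ltW].
Qed.

Lemma Md_le : (M ^ d)%:R <= (cM / c1) ^+ d * n%:R `^ d%:R.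
Proof.
have n0 := n_pos.
rewrite powR_mulrn ?(ltW n0)// natrX -exprMn; apply: lerXn2r; rewrite ?nnegrE//.
  by rewrite mulr_ge0 ?divr_ge0 ?(ltW n0) ?(ltW cM_gt0) ?(ltW c1_gt0).
apply: (le_trans (s_Mh S)); rewrite -mulrA; apply: ler_wpM2l; first exact: ltW.
rewrite -[X in _ * X]invrK -invfM lef_pV2 ?posrE ?h_pos ?mulr_gt0 ?invr_gt0//.
by apply: le_trans h_ge_rho; apply: ler_wpM2l; [exact: ltW|exact: rho_ge_invn].
Qed.

Lemma Mh_le : M%:R * h <= cM.
Proof. by have := s_Mh S; rewrite ler_pdivlMr ?h_pos. Qed.

Lemma h_le_cM : h <= cM.
Proof.
apply: le_trans Mh_le; rewrite -[leLHS]mul1r; apply: ler_wpM2r; first exact: ltW h_pos.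
by rewrite ler1n; exact: s_M S.
Qed.

Lemma r_le : r <= cM / c1.
Proof. by rewrite ler_pdivlMr// mulrC (le_trans h_ge_r h_le_cM). Qed.

Lemma powR_max_le (a b p : R) : 0 <= a -> 0 <= b -> 0 <= p -> Num.max a b `^ p <= a `^ p + b `^ p.
Proof. by move=> a0 b0 p0; case: (leP a b) => _; rewrite ?lerDl ?lerDr powR_ge0. Qed.

Lemma powR_expo_le (x m s s' : R) : 0 <= x -> x <= m -> 0 < s -> s <= s' ->
  x `^ s' <= m `^ (s' - s) * x `^ s.
Proof.
move=> x0 xm s0 ss'; move: x0; rewrite le_eqVlt => /orP[/eqP <-|x0].
  by rewrite powR0 ?mulr_ge0 ?powR_ge0// gt_eqF// (lt_le_trans s0).
have -> : x `^ s' = x `^ (s' - s) * x `^ s by rewrite -powRD ?subrK// (gt_eqF x0) implybT.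
apply: ler_wpM2r; first exact: powR_ge0.
by apply: ge0_ler_powR; rewrite ?nnegrE ?subr_ge0 ?(ltW x0)// (le_trans _ xm)// ltW.
Qed.

(** A power [beta * p] of [r] can be charged to the smaller power [p * Num.min 1 beta] because [r]
    is bounded: [1 <= M] and [M%:R * h <= cM] bound [h], and [c1 * r <= h]. *)
Lemma bias_le p : 0 < p -> (h `^ beta) `^ p <=
  c2 `^ (beta * p) * ((cM / c1) `^ (beta * p - p * Num.min 1 beta) + 1) *
   (r `^ (p * Num.min 1 beta) + rh `^ (beta * p)).
Proof.
move=> p0; rewrite -powRrM; set m := Num.min 1 beta.
have m0 : 0 < m by rewrite lt_min ltr01.
have bp : 0 <= beta * p by rewrite mulr_ge0// ltW.
have rh0 := ltW rho_gt0; have r0 := s_r S.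
apply: (@le_trans _ _ ((c2 * Num.max r rh) `^ (beta * p))).
  apply: ge0_ler_powR; rewrite ?nnegrE ?(ltW h_pos) ?(s_hhi S)//.
  by rewrite mulr_ge0 ?(ltW c2_gt0)// le_max r0.
rewrite powRM ?(ltW c2_gt0)// ?le_max ?r0// -mulrA; apply: ler_wpM2l; first exact: powR_ge0.
apply: (le_trans (powR_max_le r0 rh0 bp)).
have pm : p * m <= beta * p by rewrite mulrC; apply: ler_wpM2r; [exact: ltW|rewrite ge_min lexx orbT].
have := powR_expo_le r0 r_le (mulr_gt0 p0 m0) pm.
set u := _ `^ (_ - _); set a := r `^ (p * m); set b := rh `^ _ => Hr.
have u0 : 0 <= u by exact: powR_ge0.
have a0 : 0 <= a by exact: powR_ge0.
have b0 : 0 <= b by exact: powR_ge0.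
rewrite mulrDr !mulrDl !mul1r; have := mulr_ge0 u0 b0; lra.
Qed.

End Facts.

(** The power [D] leaves room for a sum over the grid; it is [0] for finite exponents and [d] for
    the supremum loss. The exponential absorbs an additional [n^(beta p)], and the gained
    [n^(- beta p)] becomes the rate through [1 / n <= rho]. *)
Lemma bad_rate (D p k : R) : 0 <= D -> 0 < p -> 0 < k ->
  exists2 C, 0 < C & forall n lam h tau r M, setting n lam h tau r M ->
   n%:R `^ D * ((tau^-1 * (h ^+ d)^-1 + 1) `^ p * expR (- k * (n%:R * h ^+ d))) <=
    C * rho n lam `^ (beta * p).
Proof.
move=> D0 p0 k0.
have c10 : 0 < c1 ^+ d by rewrite exprn_gt0.
have s0 : 0 < 2 * beta / theta by rewrite divr_gt0 ?mulr_gt0 ?theta_gt0.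
have A0 : 0 <= D + (gamma + d%:R) * p + beta * p.
  have gd : 0 <= gamma + d%:R by rewrite addr_ge0// ltW.
  apply: addr_ge0; [apply: addr_ge0 => //|]; apply: mulr_ge0 => //; exact: ltW.
have [C C0 HC] := powR_exp_bounded A0 (mulr_gt0 k0 c10) s0.
have q0 : 0 < (c1 ^+ d)^-1 + 1 by rewrite ltr_pwDr// invr_ge0 ltW.
exists (((c1 ^+ d)^-1 + 1) `^ p * C); first by rewrite mulr_gt0// powR_gt0.
move=> n lam h tau r M S.
have n0 := n_pos S.
have lev0 : 0 <= tau^-1 * (h ^+ d)^-1 + 1.
  by rewrite addr_ge0// mulr_ge0// invr_ge0 ?exprn_ge0 ?(ltW (h_pos S)) ?(ltW (s_tau S)).
have E1 : (tau^-1 * (h ^+ d)^-1 + 1) `^ p <=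
    ((c1 ^+ d)^-1 + 1) `^ p * n%:R `^ ((gamma + d%:R) * p).
  rewrite [X in _ <= _ * X]powRrM -powRM ?powR_ge0 ?(ltW q0)//.
  apply: ge0_ler_powR; rewrite ?nnegrE ?(ltW p0)// ?mulr_ge0 ?powR_ge0 ?(ltW q0)//.
  exact: level_le S.
have E2 : expR (- k * (n%:R * h ^+ d)) <= expR (- (k * c1 ^+ d * n%:R `^ (2 * beta / theta))).
  rewrite ler_expR mulNr lerN2 -mulrA; apply: ler_wpM2l; first exact: ltW.
  exact: H_ge_pow S.
have E3 : n%:R `^ (- (beta * p)) <= rho n lam `^ (beta * p).
  have -> : n%:R `^ (- (beta * p)) = (n%:R^-1) `^ (beta * p) :> R.
    by rewrite -powR_inv1 ?(ltW n0)// -powRrM mulN1r.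
  by apply: ge0_ler_powR; rewrite ?nnegrE ?invr_ge0 ?mulr_ge0 ?(ltW p0) ?(ltW beta_gt0) ?(ltW n0) ?(ltW (rho_gt0 S)) ?(rho_ge_invn S).
have E4 := HC _ n0.
set X := expR (- (k * c1 ^+ d * _)) in E2 E4.
apply: (@le_trans _ _ (n%:R `^ D * ((((c1 ^+ d)^-1 + 1) `^ p * n%:R `^ ((gamma + d%:R) * p)) * X))).
  apply: ler_wpM2l; first exact: powR_ge0.
  by apply: ler_pM; rewrite ?powR_ge0 ?expR_ge0.
have -> : n%:R `^ D * (((c1 ^+ d)^-1 + 1) `^ p * n%:R `^ ((gamma + d%:R) * p) * X) =
  ((c1 ^+ d)^-1 + 1) `^ p * (n%:R `^ (D + (gamma + d%:R) * p + beta * p) * X) * n%:R `^ (- (beta * p)).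
  rewrite !powRD ?(gt_eqF n0) ?implybT// powRN.
  by field; rewrite gt_eqF// powR_gt0.
apply: ler_pM; rewrite ?mulr_ge0 ?powR_ge0 ?expR_ge0//.
by apply: ler_wpM2l; first exact: powR_ge0.
Qed.

End Rates.

(** * Choice of the exponential parameters and the two risk bounds *)

Section RiskBounds.
Variables (R : realType) (d l : nat) (beta Cb mumin mumax sigma : R) (K : d.-tuple R -> R).
Variables (Kmin Kmax Delta gamma c1 c2 c1' cM : R).
Hypothesis d_gt0 : (0 < d)%N.
Hypothesis beta_gt0 : 0 < beta.
Hypothesis Cb_gt0 : 0 < Cb.
Hypothesis mumin_gt0 : 0 < mumin.
Hypothesis mumin_lt : mumin < mumax.
Hypothesis sigma_gt0 : 0 < sigma.
Hypothesis Kmin_gt0 : 0 < Kmin.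
Hypothesis Kmax_gt0 : 0 < Kmax.
Hypothesis Delta_gt0 : 0 < Delta.
Hypothesis KP : forall w, (if enorm w <= Delta then Kmin else 0) <= K w /\
  K w <= (if enorm w <= 1 then Kmax else 0).
Hypothesis lbeta : (floor_lt beta <= l)%N.
Hypothesis gamma_gt0 : 0 < gamma.
Hypothesis c1_gt0 : 0 < c1.
Hypothesis c2_gt0 : 0 < c2.
Hypothesis c1'_gt0 : 0 < c1'.
Hypothesis cM_gt0 : 0 < cM.
Local Notation setting := (setting d beta gamma c1 c2 cM).
Local Notation rho := (rho d beta).
Local Notation m1 := (Num.min 1 beta).

(** The second term makes the closest grid point lie within [c3 * h] in every coordinate; the cap
    [1] makes [c3] admissible as a bound for rescaled coordinates in [monom_bound]. *)
Let c3 := Num.max 1 (d%:R / (2 * c1')).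

Lemma grid_spacing (M : nat) (h : R) : (0 < M)%N -> 0 < h -> c1' * h^-1 <= M%:R ->
  d%:R / (2 * M)%:R <= c3 * h.
Proof.
move=> M0 h0 hM; have Mp : 0 < M%:R :> R by rewrite ltr0n.
apply: (@le_trans _ _ (d%:R / (2 * c1') * h)); last first.
  by apply: ler_wpM2r; [exact: ltW|rewrite le_max lexx orbT].
rewrite -mulrA; apply: ler_wpM2l => //.
rewrite natrM !invfM -mulrA; apply: ler_wpM2l; first by rewrite invr_ge0.
rewrite -[h in leRHS]invrK -invfM lef_pV2 ?posrE ?mulr_gt0 ?invr_gt0//.
Qed.

Lemma risk_bound_fin (p : R) : 1 <= p ->
  exists C tau0, [/\ 0 < C, 0 < tau0 & forall n h tau r M,
    setting n 1 h tau r M -> tau <= tau0 -> c1' * h^-1 <= M%:R ->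
    forall mu kappa f, in_class beta Cb mumin mumax sigma mu kappa f ->
    forall A : d.-tuple R -> set (d.-tuple R), adv_class r A ->
    (adv_risk p%:E mu kappa n (fPP M l h tau K) f A <=
      (C * (r `^ (p * m1) + rho n 1 `^ (beta * p)))%:E)%E].
Proof.
move=> p1; have p0 : 0 < p by exact: lt_le_trans p1.
have c31 : 1 <= c3 by rewrite le_max lexx.
have c30 : 0 <= c3 by exact: le_trans c31.
have [C [kap [Lam [tau0 [C0 kap0 Lam0 tau00 LB]]]]] :=
  local_bound d_gt0 beta_gt0 Cb_gt0 mumin_gt0 mumin_lt sigma_gt0 Kmin_gt0 Kmax_gt0
    Delta_gt0 KP lbeta cM_gt0 c31 p1.
have [Ce Ce0 HCe] := @powR_le_expR R p p0.
have [Cd Cd0 HCd] := bad_rate c2 cM d_gt0 beta_gt0 gamma_gt0 c1_gt0 (lexx 0) p0 kap0.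
have mumax0 : 0 <= mumax by rewrite ltW// (lt_trans mumin_gt0).
set k1 := 2 `^ p * C * (c2 `^ (beta * p) * ((cM / c1) `^ (beta * p - p * m1) + 1)).
set k2 := 2 `^ p * (d%:R * Cb) `^ p.
set W := mumax * (2 * (c3 + c1^-1)) ^+ d * 2 `^ p * cM ^+ d.
set G := ((c1 ^+ d)^-1) `^ (2^-1).
set k3 := W * (C * (Ce * G `^ p * expR Lam + Cd)).
have c50 : 0 <= c1^-1 by rewrite invr_ge0 ltW.
have W10 : 0 <= mumax * (2 * (c3 + c1^-1)) ^+ d * 2 `^ p.
  apply: mulr_ge0; last exact: powR_ge0.
  by apply: mulr_ge0 => //; apply: exprn_ge0; apply: mulr_ge0 => //; exact: addr_ge0.
have W0 : 0 <= W by apply: mulr_ge0 => //; apply: exprn_ge0; exact: ltW.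
have k10 : 0 <= k1.
  rewrite /k1; apply: mulr_ge0; first by rewrite mulr_ge0 ?powR_ge0// ltW.
  by rewrite mulr_ge0 ?powR_ge0// addr_ge0 ?powR_ge0.
have k20 : 0 <= k2 by rewrite mulr_ge0 ?powR_ge0.
have k30 : 0 <= k3.
  rewrite /k3 mulr_ge0// mulr_ge0 ?(ltW C0)// addr_ge0 ?(ltW Cd0)//.
  by rewrite mulr_ge0 ?expR_ge0// mulr_ge0 ?powR_ge0// ltW.
exists (k1 + k2 + k3 + 1), tau0; split => //; first by rewrite ltr_pwDr// !addr_ge0.
move=> n h tau r M S tau1 hM mu kappa f cl A advA.
have hp := h_pos c1_gt0 S.
have Hp := H_pos d_gt0 beta_gt0 c1_gt0 S.
set H := n%:R * h ^+ d in Hp.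
have H1 := lam_le_H d_gt0 beta_gt0 c1_gt0 S; rewrite -/H in H1.
set t := Num.sqrt H.
have t0 : 0 < t by rewrite sqrtr_gt0.
have tt : t ^+ 2 = H by rewrite sqr_sqrtr// ltW.
have tH : t <= H.
  rewrite -tt expr2 ler_peMr ?(ltW t0)//.
  by rewrite -(sqrtr1 R) ler_wsqrtr.
(* Here [a] is [0]: the inequality between powers and exponentials at [t * |s|] yields this weight,
   and [t^-1], the inverse square root of [H], is at most a constant times [rho^beta]. *)
set b := Ce * (t^-1) `^ p.
have b0 : 0 <= b by rewrite mulr_ge0 ?powR_ge0// ltW.
have sP s : `|s| `^ p <= 0 + b * (expR (t * s) + expR (- t * s)).
  have -> : `|s| `^ p = (t^-1) `^ p * (t * `|s|) `^ p.
    by rewrite -powRM ?invr_ge0 ?mulr_ge0 ?(ltW t0)// mulrA mulVf ?mul1r// gt_eqF.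
  rewrite add0r /b [Ce * _]mulrC -mulrA; apply: ler_wpM2l; first exact: powR_ge0.
  apply: (@le_trans _ _ (Ce * expR (t * `|s|))).
    by apply: HCe; rewrite mulr_ge0// ltW.
  apply: ler_wpM2l; first exact: ltW.
  case: (leP 0 s) => s0; first by rewrite ger0_norm// lerDl expR_ge0.
  by rewrite ltr0_norm// mulrN -mulNr lerDr expR_ge0.
have n0 : (0 < n)%N by rewrite -(ltr_nat R); exact: n_pos S.
have M0 := s_M S.
have [E HE] := choice (fun k : {ffun 'I_d -> 'I_M} =>
  LB n h tau mu kappa f (gridpt R k) t 0 b n0
   (introT andP (conj hp (h_le_cM c1_gt0 S))) cl (gridpt_open R M0 k)
   (introT andP (conj (s_tau S) tau1)) (introT andP (conj t0 tH)) (lexx 0) b0 sP).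
have rh : r <= c1^-1 * h.
  by rewrite mulrC ler_pdivlMr// mulrC; exact: (h_ge_r c1_gt0 S).
have h0 : 0 <= C * (h `^ beta `^ p + 0) by rewrite mulr_ge0 ?addr_ge0 ?powR_ge0// ltW.
apply: le_trans (adv_risk_fin d_gt0 beta_gt0 Cb_gt0 mumin_gt0 M0 hp cl advA
  (grid_spacing M0 hp hM) rh c30 (s_r S) h0 p0 (fun k Z => (let: And3 e _ _ := HE k in e) Z)
  (fun k => (let: And3 _ e _ := HE k in e))
  (fun k Z => (let: And3 _ _ e := HE k in e) Z) c50) _.
rewrite lee_fin.
set X := r `^ (p * m1); set Y := rho n 1 `^ (beta * p).
have X0 : 0 <= X by exact: powR_ge0.
have Y0 : 0 <= Y by exact: powR_ge0.
have T1 : 2 `^ p * (C * (h `^ beta `^ p + 0)) <= k1 * (X + Y).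
  rewrite addr0 mulrA /k1 -[leRHS]mulrA; apply: ler_wpM2l.
    by rewrite mulr_ge0 ?powR_ge0// ltW.
  by exact: (bias_le beta_gt0 c1_gt0 c2_gt0 S p0).
have T2 : 2 `^ p * (d%:R * Cb * r `^ m1) `^ p <= k2 * (X + Y).
  have dC : 0 <= d%:R * Cb by rewrite mulr_ge0// ltW.
  have -> : (d%:R * Cb * r `^ m1) `^ p = (d%:R * Cb) `^ p * (r `^ m1) `^ p.
    by apply: powRM => //; exact: powR_ge0.
  rewrite mulrA -/k2; apply: ler_wpM2l => //.
  by rewrite -powRrM [m1 * p]mulrC lerDl.
have B1 : b * expR (Lam * t ^+ 2 / H) + (tau^-1 * (h ^+ d)^-1 + 1) `^ p * expR (- kap * H)
   <= (Ce * G `^ p * expR Lam + Cd) * Y.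
  rewrite mulrDl; apply: lerD.
    rewrite tt mulfK ?gt_eqF// [leRHS]mulrAC; apply: ler_wpM2r; first exact: expR_ge0.
    rewrite /b -mulrA; apply: ler_wpM2l; first exact: ltW.
    rewrite /Y powRrM -powRM ?powR_ge0//.
    apply: ge0_ler_powR; rewrite ?nnegrE ?(ltW p0) ?invr_ge0 ?(ltW t0) ?mulr_ge0 ?powR_ge0//.
    have := sqrt_lam_div_H d_gt0 beta_gt0 c1_gt0 S.
    by rewrite div1r sqrtrV// ltW.
  have := HCd _ _ _ _ _ _ S; rewrite powRr0 mul1r => HH; exact: HH.
have T3 : mumax * (2 * ((c3 + c1^-1) * h)) ^+ d * 2 `^ p *
    ((M ^ d)%:R * (C * (b * expR (Lam * t ^+ 2 / H) +
      (tau^-1 * (h ^+ d)^-1 + 1) `^ p * expR (- kap * H)))) <= k3 * (X + Y).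
  apply: (@le_trans _ _ (k3 * Y)); last by apply: ler_wpM2l => //; rewrite lerDr.
  set B := b * _ + _ in B1 *.
  have B0 : 0 <= B.
    by apply: addr_ge0; apply: mulr_ge0; rewrite ?expR_ge0 ?powR_ge0.
  have -> : mumax * (2 * ((c3 + c1^-1) * h)) ^+ d * 2 `^ p * ((M ^ d)%:R * (C * B)) =
    mumax * (2 * (c3 + c1^-1)) ^+ d * 2 `^ p * (M%:R * h) ^+ d * (C * B).
    by rewrite natrX [2 * ((_ + _) * h)]mulrA ![(_ * h) ^+ d]exprMn; ring.
  rewrite /k3 -[leRHS]mulrA -[X in _ <= _ * X]mulrA; apply: ler_pM.
  - by apply: mulr_ge0 => //; apply: exprn_ge0; apply: mulr_ge0 => //; exact: ltW.
  - by apply: mulr_ge0 => //; exact: ltW.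
  - apply: ler_wpM2l => //; apply: lerXn2r; rewrite ?nnegrE ?(ltW cM_gt0)//.
      by apply: mulr_ge0 => //; exact: ltW.
    exact: (Mh_le c1_gt0 S).
  - by apply: ler_wpM2l => //; exact: ltW.
rewrite mulrDr; apply: le_trans (lerD (lerD T1 T2) T3) _.
by rewrite -!mulrDl; apply: ler_wpM2r; rewrite ?lerDl ?addr_ge0.
Qed.

Lemma risk_bound_oo :
  exists C tau0, [/\ 0 < C, 0 < tau0 & forall n h tau r M,
    setting n (ln n%:R) h tau r M -> tau <= tau0 -> c1' * h^-1 <= M%:R ->
    forall mu kappa f, in_class beta Cb mumin mumax sigma mu kappa f ->
    forall A : d.-tuple R -> set (d.-tuple R), adv_class r A ->
    (adv_risk +oo mu kappa n (fPP M l h tau K) f A <=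
      (C * (r `^ m1 + rho n (ln n%:R) `^ beta))%:E)%E].
Proof.
have c31 : 1 <= c3 by rewrite le_max lexx.
have [C [kap [Lam [tau0 [C0 kap0 Lam0 tau00 LB]]]]] :=
  local_bound d_gt0 beta_gt0 Cb_gt0 mumin_gt0 mumin_lt sigma_gt0 Kmin_gt0 Kmax_gt0
    Delta_gt0 KP lbeta cM_gt0 c31 (lexx 1).
have [Cd Cd0 HCd] := bad_rate c2 cM d_gt0 beta_gt0 gamma_gt0 c1_gt0 (ler0n R d) ltr01 kap0.
(* [Q] is dictated by the sum over the grid: the number of grid points is at most a constant times
   [expR (d%:R * ln n%:R)], the exponential moment of a score is at most [expR (Lam * ln n%:R)], and
   [expR (- (Q * ln n%:R))] cancels both. *)
set Q := Lam + d%:R.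
have Q0 : 0 <= Q by rewrite addr_ge0// ltW.
set W := (cM / c1) ^+ d.
have W0 : 0 <= W by apply: exprn_ge0; rewrite divr_ge0// ltW.
set G := ((c1 ^+ d)^-1) `^ (2^-1).
have G0 : 0 <= G by exact: powR_ge0.
have C0' := ltW C0.
set k1 := C * (c2 `^ (beta * 1) * ((cM / c1) `^ (beta * 1 - 1 * m1) + 1)).
set k2 := C * (Q * G).
set k3 := d%:R * Cb.
set k4 := W * (C * (G + Cd)).
have k10 : 0 <= k1.
  by apply: mulr_ge0 => //; apply: mulr_ge0; rewrite ?addr_ge0 ?powR_ge0.
have k20 : 0 <= k2 by apply: mulr_ge0 => //; exact: mulr_ge0.
have k30 : 0 <= k3 by apply: mulr_ge0 => //; exact: ltW.
have k40 : 0 <= k4.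
  by apply: mulr_ge0 => //; apply: mulr_ge0 => //; apply: addr_ge0 => //; exact: ltW.
exists (k1 + k2 + k3 + k4 + 1), tau0; split => //; first by rewrite ltr_pwDr// !addr_ge0.
move=> n h tau r M; set lam := ln n%:R => S tau1 hM mu kappa f cl A advA.
have hp := h_pos c1_gt0 S.
have Hp := H_pos d_gt0 beta_gt0 c1_gt0 S.
have lamH := lam_le_H d_gt0 beta_gt0 c1_gt0 S.
have sqH := sqrt_lam_div_H d_gt0 beta_gt0 c1_gt0 S.
have lam0 := lam_gt0 S; have lam1 := s_lam1 S; have n0' := n_pos S.
set H := n%:R * h ^+ d in Hp lamH sqH.
set t := Num.sqrt (H * lam).
have Hlam : 0 < H * lam by exact: mulr_gt0.
have t0 : 0 < t by rewrite sqrtr_gt0.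
have tt : t ^+ 2 = H * lam by rewrite sqr_sqrtr// ltW.
have tH : t <= H.
  rewrite -(ler_sqr (x := t)) ?nnegrE ?(ltW t0) ?(ltW Hp)// tt expr2.
  by apply: ler_wpM2l => //; exact: ltW.
have lamt : lam / t = Num.sqrt (lam / H).
  rewrite -[LHS]ger0_norm ?divr_ge0 ?(ltW lam0) ?(ltW t0)// -sqrtr_sqr; congr Num.sqrt.
  by rewrite expr_div_n tt; field; rewrite !gt_eqF.
have lamtG : lam / t <= G * rho n lam `^ beta by rewrite lamt.
(* From [1 + x <= expR x] one gets [t * |s| <= Q * lam + expR (t * |s| - Q * lam)]; division by [t]
   gives [a] and [b]. The threshold [a] is itself of the order of the rate, since [lam / t] is the
   square root of [lam / H]. *)
set a := Q * (lam / t); set b := expR (- (Q * lam)) / t.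
have a0 : 0 <= a by apply: mulr_ge0 => //; rewrite divr_ge0 ?(ltW lam0) ?(ltW t0).
have b0 : 0 <= b by rewrite divr_ge0 ?expR_ge0 ?(ltW t0).
have sP s : `|s| `^ 1 <= a + b * (expR (t * s) + expR (- t * s)).
  rewrite powRr1//.
  have e1 : expR (t * `|s|) <= expR (t * s) + expR (- t * s).
    case: (leP 0 s) => s0; first by rewrite ger0_norm// lerDl expR_ge0.
    by rewrite ltr0_norm// mulrN -mulNr lerDr expR_ge0.
  apply: (@le_trans _ _ (a + b * expR (t * `|s|))); last first.
    by rewrite lerD2l; apply: ler_wpM2l.
  have -> : `|s| = t * `|s| / t by rewrite mulrAC mulfV ?mul1r ?gt_eqF.
  rewrite /a /b mulrA [_ / t * _]mulrAC -mulrDl; apply: ler_wpM2r.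
    by rewrite invr_ge0 ltW.
  rewrite [t * (_ / t)]mulrA [t * _ / t]mulrAC mulfV ?gt_eqF// mul1r -expRD.
  rewrite -lerBlDl addrC; apply: le_trans (expR_ge1Dx _).
  by rewrite lerDr.
have n0 : (0 < n)%N by rewrite -(ltr_nat R).
have M0 := s_M S.
have [E HE] := choice (fun k : {ffun 'I_d -> 'I_M} =>
  LB n h tau mu kappa f (gridpt R k) t a b n0
   (introT andP (conj hp (h_le_cM c1_gt0 S))) cl (gridpt_open R M0 k)
   (introT andP (conj (s_tau S) tau1)) (introT andP (conj t0 tH)) a0 b0 sP).
have h0 : 0 <= C * (h `^ beta `^ 1 + a) by rewrite mulr_ge0// addr_ge0// powR_ge0.
apply: le_trans (adv_risk_oo d_gt0 beta_gt0 Cb_gt0 mumin_gt0 M0 cl advA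
  (grid_spacing M0 hp hM) (s_r S) h0 (fun k Z => (let: And3 e _ _ := HE k in e) Z)
  (fun k => (let: And3 _ e _ := HE k in e))
  (fun k Z => (let: And3 _ _ e := HE k in e) Z) erefl) _.
rewrite lee_fin.
set X := r `^ m1; set Y := rho n lam `^ beta in lamtG *.
have X0 : 0 <= X by exact: powR_ge0.
have Y0 : 0 <= Y by exact: powR_ge0.
have YS : Y <= X + Y by rewrite lerDr.
have T1 : C * h `^ beta `^ 1 <= k1 * (X + Y).
  rewrite /k1 -[leRHS]mulrA; apply: ler_wpM2l => //.
  have := bias_le beta_gt0 c1_gt0 c2_gt0 S ltr01.
  by rewrite [_ `^ (1 * m1)]/(_ `^ _) mul1r mulr1.
have T2 : C * a <= k2 * (X + Y).
  rewrite /k2 /a -mulrA; apply: ler_wpM2l => //; rewrite -mulrA; apply: ler_wpM2l => //.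
  by apply: le_trans lamtG _; apply: ler_wpM2l.
have T3 : d%:R * Cb * X <= k3 * (X + Y) by apply: ler_wpM2l => //; rewrite lerDl.
have nexp : n%:R `^ d%:R = expR (d%:R * lam) by rewrite /powR gt_eqF.
have T4 : (M ^ d)%:R * (C * (b * expR (Lam * t ^+ 2 / H) +
    (tau^-1 * (h ^+ d)^-1 + 1) `^ 1 * expR (- kap * H))) <= k4 * (X + Y).
  apply: (@le_trans _ _ (k4 * Y)); last exact: ler_wpM2l.
  set D := _ `^ 1 * _.
  have D0 : 0 <= D by rewrite mulr_ge0 ?powR_ge0 ?expR_ge0.
  set B := b * _.
  have B0 : 0 <= B by rewrite mulr_ge0 ?expR_ge0.
  apply: (@le_trans _ _ (W * n%:R `^ d%:R * (C * (B + D)))).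
    apply: ler_wpM2r; last exact: (Md_le d_gt0 beta_gt0 c1_gt0 cM_gt0 S).
    by apply: mulr_ge0 => //; exact: addr_ge0.
  rewrite /k4 -!mulrA; apply: ler_wpM2l => //; rewrite mulrCA; apply: ler_wpM2l => //.
  rewrite mulrDr mulrDl; apply: lerD.
    rewrite /B tt [Lam * _]mulrCA [H * _]mulrC mulfK ?gt_eqF//.
    rewrite /b nexp mulrCA mulrAC -!expRD.
    have -> : - (Q * lam) + (d%:R * lam + Lam * lam) = 0 by rewrite /Q; ring.
    rewrite expR0 mul1r; apply: le_trans lamtG.
    by rewrite -[leLHS]mul1r; apply: ler_wpM2r; rewrite ?invr_ge0 ?(ltW t0).
  by have := HCd _ _ _ _ _ _ S; rewrite mulr1.
rewrite mulrDr; apply: le_trans (lerD (lerD (lerD T1 T2) T3) T4) _.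
by rewrite -!mulrDl; apply: ler_wpM2r; rewrite ?lerDl ?addr_ge0.
Qed.

End RiskBounds.

(** * The asymptotic hypotheses at large sample size *)

Section Eventually.
Variables (R : realType) (d : nat) (beta gamma c1 c2 c1' cM : R).
Variables (r h tau lam : nat -> R) (M : nat -> nat).
Hypothesis d_gt0 : (0 < d)%N.
Hypothesis beta_gt0 : 0 < beta.
Hypothesis c1_gt0 : 0 < c1.

Lemma pow_ratio_large :
  exists2 X : R, 1 <= X & forall y, X <= y -> 1 <= c1 ^+ d * y `^ (2 * beta / (2 * beta + d%:R)).
Proof.
have s0 : 0 < 2 * beta / (2 * beta + d%:R) by rewrite divr_gt0 ?mulr_gt0 ?theta_gt0.
have p0 : 0 < c1 ^+ d by rewrite exprn_gt0.
set s := _ / _ in s0 *.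
exists (Num.max 1 (((c1 ^+ d)^-1) `^ (s^-1))); first by rewrite le_max lexx.
move=> y; rewrite ge_max => /andP[y1 yX].
rewrite mulrC -ler_pdivrMr// div1r.
have -> : (c1 ^+ d)^-1 = (((c1 ^+ d)^-1) `^ (s^-1)) `^ s.
  by rewrite -powRrM mulVf ?gt_eqF// powRr1// invr_ge0 ltW.
by apply: ge0_ler_powR; rewrite ?nnegrE ?powR_ge0 ?(ltW s0)// (le_trans ler01).
Qed.

(** The square of [ln n] is at most a constant times [n], so [n / ln n] exceeds [ln n] divided by
    that constant. *)
Lemma ln_sublinear (X : R) : 0 < X -> \forall n \near \oo,
  [/\ 1 <= ln n%:R :> R & X <= n%:R / ln (n%:R : R)].
Proof.
move=> X0; have [C C0 HC] := @powR_le_expR R 2 (ltr0Sn _ _).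
near=> n.
have nb : expR (Num.max 1 (X * C)) <= n%:R by near: n; exact: nbhs_infty_ger.
have n0 : 0 < n%:R :> R by exact: lt_le_trans (expR_gt0 _) nb.
have : Num.max 1 (X * C) <= ln n%:R by rewrite -ler_expR lnK.
rewrite ge_max => /andP[l1 lX]; split => //.
have l0 : 0 < ln (n%:R : R) by exact: lt_le_trans l1.
rewrite ler_pdivlMr// -(ler_pM2l C0).
have := HC _ (ltW l0); rewrite lnK// powR_mulrn ?(ltW l0)//; apply: le_trans.
by rewrite mulrA [C * X]mulrC expr2; apply: ler_wpM2r => //; exact: ltW.
Unshelve. all: by end_near.
Qed.

Lemma setting_near :
  (forall n, 0 <= r n) -> (forall n, (0 < M n)%N) ->
  (\forall n \near \oo, c1 * Num.max (r n) (rho d beta n (lam n)) <= h n <=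
     c2 * Num.max (r n) (rho d beta n (lam n))) ->
  (\forall n \near \oo, c1' * (h n)^-1 <= (M n)%:R <= cM * (h n)^-1) ->
  (fun n => n%:R `^ gamma * tau n) @ \oo --> +oo ->
  (forall X, 0 < X -> \forall n \near \oo, [/\ 1 <= lam n & X <= n%:R / lam n]) ->
  \forall n \near \oo, setting d beta gamma c1 c2 cM n (lam n) (h n) (tau n) (r n) (M n) /\
    c1' * (h n)^-1 <= (M n)%:R.
Proof.
move=> r0 M0 hP MP /cvgryPge tauP lamP.
have [X X1 HX] := pow_ratio_large.
near=> n.
have /andP[h1 h2] : c1 * Num.max (r n) (rho d beta n (lam n)) <= h n <=
  c2 * Num.max (r n) (rho d beta n (lam n)) by near: n.
have /andP[m1 m2] : c1' * (h n)^-1 <= (M n)%:R <= cM * (h n)^-1 by near: n.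
have t1 : 1 <= n%:R `^ gamma * tau n by near: n; exact: tauP.
have [l1 lX] : 1 <= lam n /\ X <= n%:R / lam n.
  suff [] : [/\ 1 <= lam n & X <= n%:R / lam n] by [].
  by near: n; apply: lamP; exact: lt_le_trans X1.
have l0 : 0 < lam n by exact: lt_le_trans l1.
have ln : lam n <= n%:R.
  by rewrite -[leLHS]mul1r -ler_pdivlMr// (le_trans X1).
have ng : 0 < n%:R `^ gamma :> R by rewrite powR_gt0// (lt_le_trans l0).
(* The sign of [tau n] is read off from [1 <= n^gamma * tau n]. *)
have t0 : 0 < tau n by rewrite -(pmulr_rgt0 _ ng) (lt_le_trans ltr01).
split=> //; split => //.
- by rewrite -div1r ler_pdivrMr.
- exact: HX.
Unshelve. all: by end_near.
Qed.

End Eventually.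

Theorem theorem3p2 (R : realType) (d : nat) (beta : R) (q : \bar R)
    (Cbeta mumin mumax sigma : R) (K : d.-tuple R -> R) (l : nat)
    (r h tau : nat -> R) (M : nat -> nat) (gamma : R) :
  (0 < d)%N -> 0 < beta -> (1 <= q)%E ->
  0 < Cbeta -> 0 < mumin -> mumin < mumax -> 0 < sigma ->
  kernel_assumption K ->
  (forall n, 0 <= r n) ->
  (floor_lt beta <= l)%N ->
  asymp_equiv h (bw_rate q beta d r) ->
  (forall n, (0 < M n)%N) ->
  asymp_equiv (fun n => (M n)%:R) (fun n => (h n)^-1) ->
  tau @ \oo --> 0 ->
  0 < gamma ->
  (fun n => n%:R `^ gamma * tau n) @ \oo --> +oo ->
  exists C : R, 0 < C /\
    \forall n \near \oo,
      forall (mu : d.-tuple R -> R) (kappa : R.-pker (d.-tuple R) ~> R)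
             (f : d.-tuple R -> R),
        in_class beta Cbeta mumin mumax sigma mu kappa f ->
        forall A : d.-tuple R -> set (d.-tuple R), adv_class (r n) A ->
          (adv_risk q mu kappa n (fun Z => fPP (M n) l (h n) (tau n) K Z) f A
             <= (C * risk_rate q beta d r n)%:E)%E.
Proof.
move=> d0 b0 q1 Cb0 mumin0 mulr0 s0 [Kmin [Kmax [Delta [Kmin0 KK Delta0 Delta1 KP]]]] r0 lb.
move=> [c1 [c2 [c10 c20 hP]]] M0 [c1' [cM [c1'0 cM0 MP]]] tauP g0 gtau.
have Kmax0 : 0 < Kmax by exact: lt_trans KK.
case: q q1 hP => [p| |]//.
- rewrite lee_fin => p1 hP.
  have [C [tau0 [C0 tau00 HC]]] := risk_bound_fin d0 b0 Cb0 mumin0 mulr0 s0 Kmin0 Kmax0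
    Delta0 KP lb g0 c10 c20 c1'0 cM0 p1.
  exists C; split=> //.
  have lamP (X : R) : 0 < X -> \forall n \near \oo, [/\ 1 <= 1 :> R & X <= n%:R / 1].
    move=> _; have : \forall n \near \oo, X <= n%:R :> R by exact: nbhs_infty_ger.
    by apply: filterS => n Xn; rewrite divr1.
  have hP' : \forall n \near \oo, c1 * Num.max (r n) (rho d beta n 1) <= h n <=
      c2 * Num.max (r n) (rho d beta n 1).
    by apply: filterS hP => n; rewrite /rho divr1.
  near=> n => mu kappa f cl A advA.
  have [S hM] : setting d beta gamma c1 c2 cM n 1 (h n) (tau n) (r n) (M n) /\
    c1' * (h n)^-1 <= (M n)%:R.
    by near: n; exact: (setting_near d0 b0 c10 r0 M0 hP' MP gtau lamP).
  (* [tau0] is the coercivity level of the Gram matrix on good samples; below it the regularisation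
     is inactive there. *)
  have t0 : tau n <= tau0 by near: n; apply: (cvgr_le _ tauP).
  apply: le_trans (HC _ _ _ _ _ S t0 hM _ _ _ cl _ advA) _.
  rewrite lee_fin /= /rho divr1 -powRrM; apply: ler_wpM2l; first exact: ltW.
  suff -> : - (2 * beta + d%:R)^-1 * (beta * p) = - (p * beta / (2 * beta + d%:R)) by [].
  by rewrite mulNr mulrC [beta * p]mulrC.
- move=> _ hP.
  have [C [tau0 [C0 tau00 HC]]] := risk_bound_oo d0 b0 Cb0 mumin0 mulr0 s0 Kmin0 Kmax0
    Delta0 KP lb g0 c10 c20 c1'0 cM0.
  exists C; split=> //.
  near=> n => mu kappa f cl A advA.
  have [S hM] : setting d beta gamma c1 c2 cM n (ln n%:R) (h n) (tau n) (r n) (M n) /\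
    c1' * (h n)^-1 <= (M n)%:R.
    by near: n; exact: (setting_near d0 b0 c10 r0 M0 hP MP gtau (@ln_sublinear R)).
  have t0 : tau n <= tau0 by near: n; apply: (cvgr_le _ tauP).
  apply: le_trans (HC _ _ _ _ _ S t0 hM _ _ _ cl _ advA) _.
  rewrite lee_fin /= /rho -powRrM; apply: ler_wpM2l; first exact: ltW.
  suff -> : - (2 * beta + d%:R)^-1 * beta = - (beta / (2 * beta + d%:R)) by [].
  by rewrite mulNr mulrC.
Unshelve. all: by end_near.
Qed.
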